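(* Let $\Sigma$ be a (possibly non-reduced) abstract root system with set of positive roots $\Sigma^+$ and set of simple roots $\Pi$. Let $\Phi$ be a proper subset of $\Pi$, and let $\lambda$ be a root in $\Sigma$. Then: (i) If $\lambda\in\operatorname{span}\Phi$, then the $\Phi$-string of $\lambda$ is the root subsystem $\Sigma_\Phi$ of $\Sigma$ spanned by $\Phi$. If $\lambda\in\Sigma^+$ is not spanned by $\Phi$ and it is of minimum level in its $\Phi$-string, then: (ii) The set $\Sigma_{\lambda,\Phi}=\operatorname{span}_{\mathbb Z}(\{\lambda\}\cup\Phi)\cap\Sigma$ is a root subsystem of $\Sigma$ for which $\Pi_{\lambda,\Phi}=\{\lambda\}\cup\Phi$ is a simple system, and $\lambda$ is the unique root of minimum level in its $\Phi$-string. (iii) The $\Phi$-string of $\lambda$ has no gaps, that is, given any root $\gamma$ in the $\Phi$-string of $\lambda$ different from $\lambda$, there exists some $\alpha\in\Phi$ such that $\gamma-\alpha$ is a root. (iv) If $\Phi=\{\alpha_1,\dots,\alpha_n\}$ is a connected subset of $\Pi$ (with the $\Phi$-string of $\lambda$ non-trivial, i.e. $I_\Phi^\lambda\ne\{\lambda\}$, and $\Sigma_{\lambda,\Phi}$ not of type $G_2$), the $\Phi$-string of $\lambda$ is explicitly calculated in the first table below when $\Sigma_{\lambda,\Phi}$ is of classical type, and in the second table below if $\Sigma_{\lambda,\Phi}$ is of exceptional type. Each row gives the type of the pair $(\Sigma_\Phi,\Sigma_{\lambda,\Phi})$, the Dynkin diagram of $\Sigma_{\lambda,\Phi}$ with simple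 system $\{\lambda\}\cup\Phi$ (which fixes the labelling of $\Phi$; bonds are single unless stated otherwise), and the $\Phi$-string of $\lambda$. First table ($\Sigma_{\lambda,\Phi}$ classical): (a) Type $(A_n,A_{n+1})$, $(A_n,B_{n+1})$ or $(A_n,BC_{n+1})$, $n\ge1$; diagram the chain $\lambda,\alpha_1,\alpha_2,\dots,\alpha_n$, where the bond between $\lambda$ and $\alpha_1$ is single in the first case and double, with $\lambda$ shorter than $\alpha_1$, in the other two: $$I_\Phi^\lambda=\{\lambda\}\cup\Big\{\lambda+\sum_{i=1}^l\alpha_i: 1\le l\le n\Big\}.$$ (b) Type $(A_n,C_{n+1})$, $n\ge1$; diagram the chain $\lambda,\alpha_1,\dots,\alpha_n$ with a double bond between $\lambda$ and $\alpha_1$, $\lambda$ longer than $\alpha_1$: $$I_\Phi^\lambda=\{\lambda\}\cup\Big\{\lambda+\sum_{i=1}^l\alpha_i,\ \lambda+\sum_{i=1}^l\alpha_i+\sum_{j=1}^m\alpha_j: 1\le l\le n,\ 1\le m\le l\Big\}.$$ (c) Type $(B_n,B_{n+1})$ or $(BC_n,BC_{n+1})$, $n\ge2$; diagram the chain $\lambda,\alpha_1,\dots,\alpha_n$ whose last bond (between $\alpha_{n-1}$ and $\alpha_n$) is double, with $\alpha_n$ the shortest simple root: $$I_\Phi^\lambda=\{\lambda\}\cup\Big\{\lambda+\sum_{i=1}^l\alpha_i,\ \lambda+\sum_{i=1}^n\alpha_i+\sum_{j=0}^k\alpha_{n-j}: 1\le l\le n,\ 0\le k\le n-1\Big\}.$$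 (d) Type $(C_n,C_{n+1})$, $n\ge3$; diagram the chain $\lambda,\alpha_1,\dots,\alpha_n$ whose last bond is double, with $\alpha_n$ the longest simple root: $$I_\Phi^\lambda=\{\lambda\}\cup\Big\{\lambda+\sum_{i=1}^l\alpha_i,\ \lambda+\sum_{i=1}^n\alpha_i+\sum_{j=1}^k\alpha_{n-j}: 1\le l\le n,\ 1\le k\le n-1\Big\}.$$ (e) Type $(D_n,D_{n+1})$, $n\ge3$ (with $D_3\cong A_3$); diagram the chain $\lambda,\alpha_1,\dots,\alpha_{n-2}$ with both $\alpha_{n-1}$ and $\alpha_n$ joined to $\alpha_{n-2}$ only: $$I_\Phi^\lambda=\Big\{\lambda,\ \lambda+\sum_{1\le i\le n,\ i\ne n-1}\alpha_i\Big\}\cup\Big\{\lambda+\sum_{i=1}^l\alpha_i,\ \lambda+\sum_{i=1}^n\alpha_i+\sum_{j=2}^k\alpha_{n-j}: 1\le l\le n,\ 2\le k\le n-1\Big\}.$$ Second table ($\Sigma_{\lambda,\Phi}$ exceptional): (f) Type $(A_n,E_{n+1})$, $n\in\{5,6,7\}$; diagram the chain $\alpha_1,\alpha_2,\dots,\alpha_n$ with $\lambda$ joined to $\alpha_3$ only. Write $[c_7c_6c_5c_4c_3c_2c_1]$ for $\lambda+\sum_i c_i\alpha_i$ (terms with $i>n$ have $c_i=0$ and are omitted). The $\Phi$-string consists of the 20 roots of list (f1) if $n=5$, of the 35 roots of lists (f1), (f2) if $n=6$, and of the 56 roots of lists (f1), (f2), (f3) if $n=7$. (f1): [0000000], [0000100],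 [0001100], [0000110], [0011100], [0001110], [0000111], [0011110], [0001210], [0001111], [0011210], [0011111], [0001211], [0012210], [0011211], [0001221], [0012211], [0011221], [0012221], [0012321]. (f2): [0111100], [0111110], [0111210], [0112210], [0122210], [0111111], [0111211], [0112211], [0122211], [0111221], [0112221], [0122221], [0112321], [0122321], [0123321]. (f3): [1111100], [1111110], [1111210], [1111111], [1112210], [1111211], [1122210], [1112211], [1111221], [1222210], [1122211], [1112221], [1222211], [1122221], [1112321], [1222221], [1122321], [1222321], [1123321], [1223321], [1233321]. (g) Type $(D_n,E_{n+1})$, $n\in\{5,6,7\}$; diagram the chain $\lambda,\alpha_1,\alpha_3,\alpha_4,\dots,\alpha_n$ with $\alpha_2$ joined to $\alpha_3$ only. Write $[c_7c_6c_5c_4c_3c_1|c_2]$ for $\lambda+\sum_i c_i\alpha_i$ (terms with $i>n$ have $c_i=0$ and are omitted). The $\Phi$-string consists of the 16 roots of list (g1) if $n=5$, of the 32 roots of lists (g1), (g2) if $n=6$, and of the 64 roots of lists (g1), (g2), (g3) if $n=7$. (g1): [000000|0], [000001|0], [000011|0], [000111|0], [000011|1], [001111|0], [000111|1], [001111|1], [000121|1], [001121|1], [000122|1], [001221|1], [001122|1], [001222|1], [001232|1], [001232|2]. (g2): [011111|0], [011111|1], [011121|1], [011221|1], [011122|1], [012221|1], [011222|1], [012222|1], [011232|1], [012232|1], [011232|2], [012332|1], [012232|2], [012332|2], [012342|2], [012343|2]. (g3): [111111|0], [111111|1], [111121|1], [111221|1], [111122|1], [112221|1], [111222|1], [122221|1],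 [112222|1], [111232|1], [122222|1], [112232|1], [111232|2], [122232|1], [112332|1], [112232|2], [122332|1], [122232|2], [112332|2], [123332|1], [122332|2], [112342|2], [123332|2], [122342|2], [112343|2], [123342|2], [122343|2], [123442|2], [123343|2], [123443|2], [123453|2], [123453|3]. (h) Type $(E_6,E_7)$; diagram the chain $\lambda,\alpha_6,\alpha_5,\alpha_4,\alpha_3,\alpha_1$ with $\alpha_2$ joined to $\alpha_4$ only. Writing $[c_6c_5c_4c_3c_1|c_2]$ for $\lambda+\sum_{i=1}^6c_i\alpha_i$, the $\Phi$-string consists of: [00000|0], [10000|0], [11000|0], [11100|0], [11110|0], [11100|1], [11110|1], [11111|0], [11210|1], [11111|1], [12210|1], [11211|1], [22210|1], [12211|1], [11221|1], [22211|1], [12221|1], [22221|1], [12321|1], [22321|1], [12321|2], [23321|1], [22321|2], [23321|2], [23421|2], [23431|2], [23432|2]. (j) Type $(E_7,E_8)$; diagram the chain $\lambda,\alpha_7,\alpha_6,\alpha_5,\alpha_4,\alpha_3,\alpha_1$ with $\alpha_2$ joined to $\alpha_4$ only. Writing $[c_7c_6c_5c_4c_3c_1|c_2]$ for $\lambda+\sum_{i=1}^7c_i\alpha_i$, the $\Phi$-string consists of: [000000|0], [100000|0], [110000|0], [111000|0], [111100|0], [111110|0], [111100|1], [111110|1], [111111|0], [111210|1], [111111|1], [112210|1], [111211|1], [122210|1], [112211|1], [111221|1], [222210|1], [122211|1], [112221|1], [222211|1], [122221|1], [112321|1], [222221|1], [122321|1], [112321|2], [222321|1], [123321|1], [122321|2],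 [223321|1], [222321|2], [123321|2], [233321|1], [223321|2], [123421|2], [233321|2], [223421|2], [123431|2], [233421|2], [223431|2], [123432|2], [234421|2], [233431|2], [223432|2], [234431|2], [233432|2], [234531|2], [234432|2], [234531|3], [234532|2], [234542|2], [234532|3], [234542|3], [234642|3], [235642|3], [245642|3], [345642|3]. (k) Type $(B_3,F_4)$; diagram the chain $\lambda,\alpha_1,\alpha_2,\alpha_3$ with a double bond between $\alpha_1$ and $\alpha_2$ ($\lambda,\alpha_1$ short, $\alpha_2,\alpha_3$ long). Writing $(1\,c_1\,c_2\,c_3)$ for $\lambda+c_1\alpha_1+c_2\alpha_2+c_3\alpha_3$, the $\Phi$-string consists of: (1000), (1100), (1110), (1111), (1210), (1211), (1221), (1321). (l) Type $(C_3,F_4)$; diagram the chain $\alpha_3,\alpha_2,\alpha_1,\lambda$ with a double bond between $\alpha_2$ and $\alpha_1$ ($\alpha_3,\alpha_2$ short, $\alpha_1,\lambda$ long). Writing $(c_3\,c_2\,c_1\,1)$ for $\lambda+c_1\alpha_1+c_2\alpha_2+c_3\alpha_3$, the $\Phi$-string consists of: (0001), (0011), (0111), (0211), (1111), (0221), (1211), (1221), (2211), (1321), (2221), (2321), (2421), (2431). (v) If $\Phi=\Phi_1\cup\dots\cup\Phi_n$, where the $\Phi_i$'s are mutually orthogonal connected subsets of $\Pi$, then $$I_\Phi^\lambda=\Big\{\lambda+\sum_{k=1}^n\gamma_k:\ \gamma_k\in\operatorname{span}\Phi_k\ \text{and}\ \lambda+\gamma_k\in I_{\Phi_k}^\lambda\subset\Sigma^+,\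 \text{for all } k=1,\dots,n\Big\}.$$
   Context: An abstract root system $\Sigma$ (possibly non-reduced) in a finite-dimensional real inner product space $V$ is a finite set of non-zero vectors spanning $V$ such that, for all $\alpha,\beta\in\Sigma$, $A_{\alpha,\beta}=2\langle\alpha,\beta\rangle/|\alpha|^2\in\mathbb Z$ and $\beta-A_{\alpha,\beta}\alpha\in\Sigma$; it is reduced if $\lambda\in\Sigma$ implies $2\lambda\notin\Sigma$. Fix a positivity criterion: $\Sigma^+$ is the set of roots in one of the two half-spaces determined by a hyperplane of $V$ containing no root. A positive root is simple if it is not the sum of two positive roots; the set $\Pi$ of simple roots is a basis of $V$, and every root is an integer combination of $\Pi$ with coefficients all $\ge0$ or all $\le0$. The level of a root is the sum of these coefficients. For $\Phi\subset\Pi$, $\Sigma_\Phi=\operatorname{span}_{\mathbb Z}(\Phi)\cap\Sigma$; it is a root system for which $\Phi$ is a simple system. Root subsystems carry the positivity criterion induced from $\Sigma$. For $\lambda\in\Sigma$, the $\Phi$-string of $\lambda$ is the set $I_\Phi^\lambda$ of elements of $\Sigma\cup\{0\}$ of the form $\lambda+\sum_{\alpha\in\Phi}n_\alpha\alpha$ with $n_\alpha\in\mathbb Z$ for each $\alpha\in\Phi$. The root $\lambda$ is of minimum level in its $\Phi$-string if no root of $I_\Phi^\lambda$ has smaller level. The Dynkin diagram of a simple system has the simple roots as nodes, $\alpha$ and $\beta$ being joined by $A_{\alpha,\beta}A_{\beta,\alpha}$ edges. A subset $\Phi\subset\Pi$ is connected if there is a connected subgraph of the Dynkin diagram of $\Sigma$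 whose nodes are precisely the roots in $\Phi$ (equivalently, $\Phi$ is not a non-trivial union of two mutually orthogonal subsets). Types are the usual $A_m,B_m,C_m,D_m$ and the non-reduced $BC_m$ (classical), and $E_6,E_7,E_8,F_4,G_2$ (exceptional); the Dynkin diagram of $BC_m$ is that of $B_m$.
   Formalization: In (iv) the pairs (A_n, D_{n+1}), n≥4 (λ the end of a short branch of D_{n+1}), are excluded, since the first table has no row for them; row (d) is taken for n≥2 and the BC part of row (c) for n≥1, because the printed ranges omit (C_2, C_3) and (BC_1, BC_2). *)

(* Defs.v *)
From Corelib Require Import Decimal.
From mathcomp Require Import all_boot all_order all_algebra.
From mathcomp Require Import boolp classical_sets cardinality fsbigop reals.

Set Implicit Arguments.
Unset Strict Implicit.
Unset Printing Implicit Defensive.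

Import Order.TTheory GRing.Theory Num.Theory.
Local Open Scope classical_set_scope.
Local Open Scope ring_scope.

Section Spans.
Context {R : realType} {V : vectType R}.
Implicit Types A : set V.

(* The sums below run over finite sets A in all uses: a finitely supported
   sum over an infinite set could silently be 0. *)
Definition zspan A : set V :=
  [set v | exists c : V -> int, v = \sum_(a \in A) a *~ c a].

Definition rspan A : set V :=
  [set v | exists c : V -> R, v = \sum_(a \in A) c a *: a].

End Spans.

Section RootSystems.
Context {R : realType} {V : vectType R} (ip : {dot V for @idfun R}).
Implicit Types (S P Pi Phi : set V) (a b lam : V).

(* A_{a,b}: the first argument is the one in the denominator. *)
Definition cartan a b : R := 2 * ip a b / ip a a.

(* S is a (possibly non-reduced) root system in the subspace W, with the
   inner product restricted to W. *)
Definition root_system (W : {vspace V}) S : Prop :=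
  [/\ finite_set S,
      ~ S 0,
      rspan S = [set v | v \in W],
      (forall a b, S a -> S b -> cartan a b \is a Num.int) &
      (forall a b, S a -> S b -> S (b - cartan a b *: a))].

Definition reduced S : Prop := forall a, S a -> ~ S (a *+ 2).

Definition root_subsystem S S' : Prop :=
  S' `<=` S /\ exists W : {vspace V}, root_system W S'.

(* The hyperplane is given by its normal vector h. *)
Definition positive_system S P : Prop :=
  exists h : V, [/\ h != 0, (forall a, S a -> ip h a != 0)
    & P = [set a | S a /\ 0 < ip h a]].

Definition simple_roots P : set V :=
  [set a | P a /\ ~ exists b c, [/\ P b, P c & a = b + c]].

(* The default value 0 is never reached when Pi is the set of simple roots of a
   root system containing g. *)
Definition level Pi (g : V) : int :=
  xget 0 [set k | exists c : V -> int,
    g = \sum_(a \in Pi) a *~ c a /\ k = \sum_(a \in Pi) c a].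

Definition sub_roots S Phi : set V := zspan Phi `&` S.

Definition root_string S Phi lam : set V :=
  [set g | (S `|` [set 0]) g /\
    exists n : V -> int, g = lam + \sum_(a \in Phi) a *~ n a].

(* g is a root of minimum level in the string I; the element 0 is not compared,
   as it is not a root. *)
Definition min_level S Pi (I : set V) (g : V) : Prop :=
  [/\ I g, S g & forall m, I m -> S m -> level Pi g <= level Pi m].

Definition edges a b : R := cartan a b * cartan b a.

Definition joined : rel V := fun a b => edges a b != 0.

(* Any two nodes are linked by a path of the Dynkin diagram inside Phi. *)
Definition connected Phi : Prop :=
  forall a b, Phi a -> Phi b ->
    exists p : seq V, [/\ path joined a p, last a p = b & [set` p] `<=` Phi].

End RootSystems.

(* A diagram is a list of bonds (i, j, k): the nodes i and j are joined by k
   edges and, if 1 < k, the node i is the shorter one. Nodes not listed together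
   are not joined. *)
Definition diagram := seq (nat * nat * nat).

Definition mult (D : diagram) (i j : nat) : nat :=
  (\sum_(b <- D | (b.1 == (i, j)) || (b.1 == (j, i))) b.2)%N.

(* chain i k is the simply laced chain i, i + 1, ..., i + k. *)
Definition chain (i k : nat) : diagram := [seq (j, j.+1, 1%N) | j <- iota i k].

Inductive rtype : Type :=
  | TA of nat | TB of nat | TC of nat | TD of nat | TBC of nat
  | TE of nat | TF4 | TG2.

(* The low rank coincidences B_2 = C_2 and A_3 = D_3 are allowed: a root system
   can have several types. *)
Definition classical (X : rtype) : bool :=
  match X with
  | TA m | TBC m => (1 <= m)%N
  | TB m | TC m => (2 <= m)%N
  | TD m => (3 <= m)%N
  | _ => false
  end.

Definition exceptional (X : rtype) : bool :=
  match X with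
  | TE m => (6 <= m <= 8)%N
  | TF4 | TG2 => true
  | _ => false
  end.

Definition rank (X : rtype) : nat :=
  match X with
  | TA m | TB m | TC m | TD m | TBC m | TE m => m
  | TF4 => 4
  | TG2 => 2
  end.

(* Nodes are numbered from 0; E_m has Bourbaki's labelling shifted by one. *)
Definition type_diagram (X : rtype) : diagram :=
  match X with
  | TA m => chain 0 m.-1
  | TB m | TBC m => if m is k.+2 then rcons (chain 0 k) (k.+1, k, 2%N) else [::]
  | TC m => if m is k.+2 then rcons (chain 0 k) (k, k.+1, 2%N) else [::]
  | TD m => if m is k.+3 then rcons (chain 0 k.+1) (k, k.+2, 1%N) else [::]
  | TE m => [:: (0, 2, 1); (1, 3, 1)]%N ++ chain 2 (m - 3)
  | TF4 => [:: (0, 1, 1); (2, 1, 2); (2, 3, 1)]%N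
  | TG2 => [:: (0, 1, 3)]%N
  end.

Section Types.
Context {R : realType} {V : vectType R} (ip : {dot V for @idfun R}).

Definition has_diagram (s : seq V) (D : diagram) : Prop :=
  (forall i j, (i < size s)%N -> (j < size s)%N -> i != j ->
     edges ip s`_i s`_j = (mult D i j)%:R) /\
  (forall i j k, (i, j, k) \in D -> (1 < k)%N -> ip s`_i s`_i < ip s`_j s`_j).

(* The root system S, with simple system B, is of type X. The non-reduced type
   BC_m has the diagram of B_m (a single node if m = 1). *)
Definition has_type (S B : set V) (X : rtype) : Prop :=
  (exists s : seq V, [/\ uniq s, [set` s] = B, size s = rank X
     & has_diagram s (type_diagram X)]) /\
  (reduced S <-> if X is TBC _ then False else True).

End Types.

(* Coefficient vectors, written as strings of decimal digits (leading zeros are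
   kept by Number.uint). *)
Fixpoint decimal_digits (d : Decimal.uint) : seq nat :=
  match d with
  | Decimal.Nil => [::]
  | Decimal.D0 d => 0%N :: decimal_digits d
  | Decimal.D1 d => 1%N :: decimal_digits d
  | Decimal.D2 d => 2%N :: decimal_digits d
  | Decimal.D3 d => 3%N :: decimal_digits d
  | Decimal.D4 d => 4%N :: decimal_digits d
  | Decimal.D5 d => 5%N :: decimal_digits d
  | Decimal.D6 d => 6%N :: decimal_digits d
  | Decimal.D7 d => 7%N :: decimal_digits d
  | Decimal.D8 d => 8%N :: decimal_digits d
  | Decimal.D9 d => 9%N :: decimal_digits d
  end.

Definition digits (d : Number.uint) : seq nat :=
  if d is Number.UIntDecimal d' then decimal_digits d' else [::].

(* Digits c_7 c_6 c_5 c_4 c_3 c_2 c_1. *)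
Definition codes_f1 : seq (seq nat) := map digits [::
  0000000; 0000100; 0001100; 0000110; 0011100; 0001110; 0000111; 0011110;
  0001210; 0001111; 0011210; 0011111; 0001211; 0012210; 0011211; 0001221;
  0012211; 0011221; 0012221; 0012321]%uint.

Definition codes_f2 : seq (seq nat) := map digits [::
  0111100; 0111110; 0111210; 0112210; 0122210; 0111111; 0111211; 0112211;
  0122211; 0111221; 0112221; 0122221; 0112321; 0122321; 0123321]%uint.

Definition codes_f3 : seq (seq nat) := map digits [::
  1111100; 1111110; 1111210; 1111111; 1112210; 1111211; 1122210; 1112211;
  1111221; 1222210; 1122211; 1112221; 1222211; 1122221; 1112321; 1222221;
  1122321; 1222321; 1123321; 1223321; 1233321]%uint.

(* Digits c_7 c_6 c_5 c_4 c_3 c_1 c_2. *)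
Definition codes_g1 : seq (seq nat) := map digits [::
  0000000; 0000010; 0000110; 0001110; 0000111; 0011110; 0001111; 0011111;
  0001211; 0011211; 0001221; 0012211; 0011221; 0012221; 0012321; 0012322]%uint.

Definition codes_g2 : seq (seq nat) := map digits [::
  0111110; 0111111; 0111211; 0112211; 0111221; 0122211; 0112221; 0122221;
  0112321; 0122321; 0112322; 0123321; 0122322; 0123322; 0123422; 0123432]%uint.

Definition codes_g3 : seq (seq nat) := map digits [::
  1111110; 1111111; 1111211; 1112211; 1111221; 1122211; 1112221; 1222211;
  1122221; 1112321; 1222221; 1122321; 1112322; 1222321; 1123321; 1122322;
  1223321; 1222322; 1123322; 1233321; 1223322; 1123422; 1233322; 1223422;
  1123432; 1233422; 1223432; 1234422; 1233432; 1234432; 1234532; 1234533]%uint.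

(* Digits c_6 c_5 c_4 c_3 c_1 c_2. *)
Definition codes_h : seq (seq nat) := map digits [::
  000000; 100000; 110000; 111000; 111100; 111001; 111101; 111110; 112101;
  111111; 122101; 112111; 222101; 122111; 112211; 222111; 122211; 222211;
  123211; 223211; 123212; 233211; 223212; 233212; 234212; 234312; 234322]%uint.

(* Digits c_7 c_6 c_5 c_4 c_3 c_1 c_2. *)
Definition codes_j : seq (seq nat) := map digits [::
  0000000; 1000000; 1100000; 1110000; 1111000; 1111100; 1111001; 1111101;
  1111110; 1112101; 1111111; 1122101; 1112111; 1222101; 1122111; 1112211;
  2222101; 1222111; 1122211; 2222111; 1222211; 1123211; 2222211; 1223211;
  1123212; 2223211; 1233211; 1223212; 2233211; 2223212; 1233212; 2333211;
  2233212; 1234212; 2333212; 2234212; 1234312; 2334212; 2234312; 1234322;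
  2344212; 2334312; 2234322; 2344312; 2334322; 2345312; 2344322; 2345313;
  2345322; 2345422; 2345323; 2345423; 2346423; 2356423; 2456423; 3456423]%uint.

(* Digits 1 c_1 c_2 c_3, the first one being the coefficient of lambda. *)
Definition codes_k : seq (seq nat) := map digits [::
  1000; 1100; 1110; 1111; 1210; 1211; 1221; 1321]%uint.

(* Digits c_3 c_2 c_1 1, the last one being the coefficient of lambda. *)
Definition codes_l : seq (seq nat) := map digits [::
  0001; 0011; 0111; 0211; 1111; 0221; 1211; 1221; 2211; 1321; 2221; 2321;
  2421; 2431]%uint.


Section Tables.
Context {R : realType} {V : vectType R} (ip : {dot V for @idfun R}).

(* In this section al 0 is lambda and al i is alpha_i for i >= 1; likewise the
   nodes of the diagrams are 0 for lambda and i for alpha_i. *)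
Implicit Type al : nat -> V.

Definition string_a (n : nat) al : set V :=
  [set al 0%N] `|`
  [set g | exists2 l, (1 <= l <= n)%N & g = al 0%N + \sum_(1 <= i < l.+1) al i].

Definition string_b (n : nat) al : set V :=
  [set al 0%N] `|`
  [set g | exists2 l, (1 <= l <= n)%N & g = al 0%N + \sum_(1 <= i < l.+1) al i] `|`
  [set g | exists l m, [/\ (1 <= l <= n)%N, (1 <= m <= l)%N
    & g = al 0%N + \sum_(1 <= i < l.+1) al i + \sum_(1 <= j < m.+1) al j]].

Definition string_c (n : nat) al : set V :=
  [set al 0%N] `|`
  [set g | exists2 l, (1 <= l <= n)%N & g = al 0%N + \sum_(1 <= i < l.+1) al i] `|`
  [set g | exists2 k, (0 <= k <= n.-1)%N
    & g = al 0%N + \sum_(1 <= i < n.+1) al i + \sum_(0 <= j < k.+1) al (n - j)%N].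

Definition string_d (n : nat) al : set V :=
  [set al 0%N] `|`
  [set g | exists2 l, (1 <= l <= n)%N & g = al 0%N + \sum_(1 <= i < l.+1) al i] `|`
  [set g | exists2 k, (1 <= k <= n.-1)%N
    & g = al 0%N + \sum_(1 <= i < n.+1) al i + \sum_(1 <= j < k.+1) al (n - j)%N].

Definition string_e (n : nat) al : set V :=
  [set al 0%N; al 0%N + \sum_(1 <= i < n.+1 | i != n.-1) al i] `|`
  [set g | exists2 l, (1 <= l <= n)%N & g = al 0%N + \sum_(1 <= i < l.+1) al i] `|`
  [set g | exists2 k, (2 <= k <= n.-1)%N
    & g = al 0%N + \sum_(1 <= i < n.+1) al i + \sum_(2 <= j < k.+1) al (n - j)%N].

Definition lincomb al (labels c : seq nat) : V :=
  \sum_(p <- zip labels c) al p.1 *+ p.2.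

Definition coded_string (labels : seq nat) (codes : seq (seq nat)) al : set V :=
  [set` [seq al 0%N + lincomb al labels c | c <- codes]].

(* table n X Y D f: there is a row for sets Phi of n simple roots, of type
   (X, Y), with diagram D and string f. *)
Definition table : Type :=
  nat -> rtype -> rtype -> diagram -> ((nat -> V) -> set V) -> Prop.

(* The rows for (BC_n, BC_{n+1}) and (C_n, C_{n+1}) include the ranks n = 1 and
   n = 2 respectively, where the formulas of the larger ranks remain valid. *)
Inductive classical_table (n : nat) :
    rtype -> rtype -> diagram -> ((nat -> V) -> set V) -> Prop :=
  | row_AA of (1 <= n)%N :
      classical_table n (TA n) (TA n.+1) (chain 0 n) (string_a n)
  | row_AB of (1 <= n)%N :
      classical_table n (TA n) (TB n.+1)
        ((0, 1, 2)%N :: chain 1 n.-1) (string_a n)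
  | row_ABC of (1 <= n)%N :
      classical_table n (TA n) (TBC n.+1)
        ((0, 1, 2)%N :: chain 1 n.-1) (string_a n)
  | row_AC of (1 <= n)%N :
      classical_table n (TA n) (TC n.+1)
        ((1, 0, 2)%N :: chain 1 n.-1) (string_b n)
  | row_BB of (2 <= n)%N :
      classical_table n (TB n) (TB n.+1)
        (rcons (chain 0 n.-1) (n, n.-1, 2%N)) (string_c n)
  | row_BCBC of (1 <= n)%N :
      classical_table n (TBC n) (TBC n.+1)
        (rcons (chain 0 n.-1) (n, n.-1, 2%N)) (string_c n)
  | row_CC of (2 <= n)%N :
      classical_table n (TC n) (TC n.+1)
        (rcons (chain 0 n.-1) (n.-1, n, 2%N)) (string_d n)
  | row_DD of (3 <= n)%N :
      classical_table n (TD n) (TD n.+1)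
        (chain 0 n.-2 ++ [:: (n.-2, n.-1, 1%N); (n.-2, n, 1%N)]) (string_e n).

Definition diagram_f (n : nat) : diagram := (0, 3, 1)%N :: chain 1 n.-1.

Definition diagram_g (n : nat) : diagram :=
  [:: (0, 1, 1); (1, 3, 1); (2, 3, 1)]%N ++ chain 3 (n - 3).

Definition labels_f : seq nat := [:: 7; 6; 5; 4; 3; 2; 1]%N.
Definition labels_g : seq nat := [:: 7; 6; 5; 4; 3; 1; 2]%N.
Definition labels_h : seq nat := [:: 6; 5; 4; 3; 1; 2]%N.

Inductive exceptional_table (n : nat) :
    rtype -> rtype -> diagram -> ((nat -> V) -> set V) -> Prop :=
  | row_AE6 of n = 5%N :
      exceptional_table n (TA n) (TE n.+1) (diagram_f n)
        (coded_string labels_f codes_f1)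
  | row_AE7 of n = 6%N :
      exceptional_table n (TA n) (TE n.+1) (diagram_f n)
        (coded_string labels_f (codes_f1 ++ codes_f2))
  | row_AE8 of n = 7%N :
      exceptional_table n (TA n) (TE n.+1) (diagram_f n)
        (coded_string labels_f (codes_f1 ++ codes_f2 ++ codes_f3))
  | row_DE6 of n = 5%N :
      exceptional_table n (TD n) (TE n.+1) (diagram_g n)
        (coded_string labels_g codes_g1)
  | row_DE7 of n = 6%N :
      exceptional_table n (TD n) (TE n.+1) (diagram_g n)
        (coded_string labels_g (codes_g1 ++ codes_g2))
  | row_DE8 of n = 7%N :
      exceptional_table n (TD n) (TE n.+1) (diagram_g n)
        (coded_string labels_g (codes_g1 ++ codes_g2 ++ codes_g3))
  | row_E6E7 of n = 6%N :
      exceptional_table n (TE 6) (TE 7)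
        ([:: (0, 6, 1); (3, 1, 1); (2, 4, 1)]%N ++ chain 3 3)
        (coded_string labels_h codes_h)
  | row_E7E8 of n = 7%N :
      exceptional_table n (TE 7) (TE 8)
        ([:: (0, 7, 1); (3, 1, 1); (2, 4, 1)]%N ++ chain 3 4)
        (coded_string labels_g codes_j)
  | row_B3F4 of n = 3%N :
      exceptional_table n (TB 3) TF4 [:: (0, 1, 1); (1, 2, 2); (2, 3, 1)]%N
        (fun al => [set` [seq lincomb al [:: 0; 1; 2; 3]%N c | c <- codes_k]])
  | row_C3F4 of n = 3%N :
      exceptional_table n (TC 3) TF4 [:: (3, 2, 1); (2, 1, 2); (1, 0, 1)]%N
        (fun al => [set` [seq lincomb al [:: 3; 2; 1; 0]%N c | c <- codes_l]]).

(* The sequence s = [:: alpha_1; ...; alpha_n] labels Phi as in a row of type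
   (X, Y) with diagram D. *)
Definition row_applies (S Phi : set V) (lam : V) (X Y : rtype) (D : diagram)
    (s : seq V) : Prop :=
  [/\ uniq s, [set` s] = Phi, has_diagram ip (lam :: s) D,
      has_type ip (sub_roots S Phi) Phi X &
      has_type ip (sub_roots S (lam |` Phi)) (lam |` Phi) Y].

(* Some row of T applies, and every row of T that applies, with every admissible
   labelling of Phi, gives the Phi-string of lam. *)
Definition string_given_by (T : table) (S Phi : set V) (lam : V) : Prop :=
  (exists X Y D f s, T (size s) X Y D f /\ row_applies S Phi lam X Y D s) /\
  (forall X Y D f s, T (size s) X Y D f -> row_applies S Phi lam X Y D s ->
     root_string S Phi lam = f (nth 0 (lam :: s))).

(* The pairs (A_n, D_{n+1}) with n >= 4, which occur when lam is an end of one of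
   the two short branches of D_{n+1}. They have no row in classical_table. *)
Definition type_AD (S Phi : set V) (lam : V) : Prop :=
  exists n, [/\ (4 <= n)%N, has_type ip (sub_roots S Phi) Phi (TA n) &
    has_type ip (sub_roots S (lam |` Phi)) (lam |` Phi) (TD n.+1)].

End Tables.

(* Main.v *)
Require Import Defs.
From mathcomp Require Import all_boot all_order all_algebra.
From mathcomp Require Import boolp classical_sets cardinality fsbigop reals.
From mathcomp Require Import zify ring lra.

Set Implicit Arguments.
Unset Strict Implicit.
Unset Printing Implicit Defensive.

Import Order.TTheory GRing.Theory Num.Theory.
Local Open Scope classical_set_scope.
Local Open Scope ring_scope.

(** The pair (Phi, lam) behaves like a lowest weight: lam is a positive root of minimum level in its
    Phi-string, so no nonnegative combination of Phi can be subtracted from it. The simple system of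
    the root system spanned by lam and Phi contains Phi and, by a comparison of coefficients, a single
    further root mu with lam = mu + (a nonnegative combination of Phi); minimality gives mu = lam
    ([lowest_simple]). Hence every root of the string is lam plus a nonnegative combination of Phi, which
    gives uniqueness, and the predicate [lowest] records what the rest of the proof uses.

    No gaps ([no_gap]): a root g of the string that makes an acute angle with some a in Phi can be
    lowered by a. Otherwise g makes a positive inner product with lam, so that d = g - lam is a root, and
    a Jacobi-like statement on three roots ([root_jacobi]) allows peeling simple roots off d until one of
    them can be subtracted from g.

    From then on everything is driven by reflections. If g + a is a root then either the Cartan number
    of g against a is negative, or the reflection in a sends g + a to a root below g ([root_flip]); the
    converse holds too. Together with the absence of gaps, this determines the string level by level
    from the Cartan matrix. For orthogonal components the relevant Cartan numbers see one component
    only, so the string of Phi is the product of the strings of the components ([string_join],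
    [string_split]). For a row of the tables it is enough that the listed coefficient vectors form a
    set that is closed under these rules and reachable from the unit vector ([closed_list],
    [closed_list_string]). This is checked by computation for the exceptional types, and by hand on
    parametrized families of vectors for the classical ones ([closed_a], [closed_b], [closed_c],
    [closed_d], [closed_e]).

    It remains to find a row that applies. As Phi is connected, lam is an end of the Dynkin diagram of
    the whole system ([label_noncut]), and the ends of each diagram are known; removing one and
    relabelling gives the row ([classical_exists], [exceptional_exists]). In type BC the type of the
    subsystem also depends on which simple roots can be doubled: doubled roots descend to doubled simple
    roots by reflections ([double_simple]), and a simple root that can be doubled has even Cartan
    numbers ([double_even]), hence is the short end of the diagram. *)

(** * Inner products and coordinates *)

Section InnerProduct.
Context {R : realType} {V : vectType R} (ip : {dot V for @idfun R}).
Implicit Types a b c : V.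

Lemma ipC a b : ip a b = ip b a.
Proof. by rewrite hermC /= expr0 mul1r. Qed.
Lemma ipDr a b c : ip a (b + c) = ip a b + ip a c.
Proof. exact: linearDr. Qed.
Lemma ipDl a b c : ip (a + b) c = ip a c + ip b c.
Proof. by rewrite ![ip _ c]ipC ipDr. Qed.
Lemma ipZr a b (r : R) : ip a (r *: b) = r * ip a b.
Proof. exact: linearZr_LR. Qed.
Lemma ipZl a b (r : R) : ip (r *: a) b = r * ip a b.
Proof. by rewrite ![ip _ b]ipC ipZr. Qed.
Lemma ip0r a : ip a 0 = 0.
Proof. exact: linear0r. Qed.
Lemma ipNr a b : ip a (- b) = - ip a b.
Proof. exact: linearNr. Qed.
Lemma ipBr a b c : ip a (b - c) = ip a b - ip a c.
Proof. exact: linearBr. Qed.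
Lemma ipBl a b c : ip (a - b) c = ip a c - ip b c.
Proof. by rewrite ![ip _ c]ipC ipBr. Qed.
Lemma ipMnr a b n : ip a (b *+ n) = ip a b *+ n.
Proof. exact: linearMnr. Qed.
Lemma ip_sumr a (I : Type) (r : seq I) (F : I -> V) :
  ip a (\sum_(i <- r) F i) = \sum_(i <- r) ip a (F i).
Proof. exact: linear_sumr. Qed.
Lemma ip_gt0 a : a != 0 -> 0 < ip a a.
Proof. exact: neq0_dnorm_gt0. Qed.
End InnerProduct.

Section Coordinates.
Context {R : realType} {V : vectType R}.
Implicit Types (s : seq V) (a b v : V).

(** The coefficient of v at the member a of the family s, as a linear form in v. Indexing by vectors
    rather than by positions makes it insensitive to the order of s. *)
Definition cf s a v : R := \sum_(i < size s | s`_i == a) coord (in_tuple s) i v.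

Lemma cfD s a v w : cf s a (v + w) = cf s a v + cf s a w.
Proof. by rewrite -big_split; apply: eq_bigr => i _; rewrite linearD. Qed.
Lemma cfZ s a (r : R) v : cf s a (r *: v) = r * cf s a v.
Proof. by rewrite big_distrr; apply: eq_bigr => i _; rewrite linearZ. Qed.
Lemma cf0 s a : cf s a 0 = 0.
Proof. by rewrite -(scale0r 0) cfZ mul0r. Qed.
Lemma cfN s a v : cf s a (- v) = - cf s a v.
Proof. by rewrite -scaleN1r cfZ mulN1r. Qed.
Lemma cfB s a v w : cf s a (v - w) = cf s a v - cf s a w.
Proof. by rewrite cfD cfN. Qed.
Lemma cfMz s a v n : cf s a (v *~ n) = cf s a v *~ n.
Proof. by rewrite -scaler_int cfZ mulrzl. Qed.
Lemma cf_sum s a (I : Type) (r : seq I) (P : pred I) (F : I -> V) :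
  cf s a (\sum_(i <- r | P i) F i) = \sum_(i <- r | P i) cf s a (F i).
Proof. by apply: (big_morph (cf s a) (cfD s a) (cf0 s a)). Qed.

Lemma cf_id s a b : free s -> a \in s -> b \in s -> cf s a b = (a == b)%:R.
Proof.
move=> fs sa sb; have us := free_uniq fs.
have la : (index a s < size s)%N by rewrite index_mem.
have lb : (index b s < size s)%N by rewrite index_mem.
rewrite /cf (big_pred1 (Ordinal la)) => [|i].
  rewrite -{1}(nth_index 0 sb) -[nth _ _ _]/((in_tuple s)`_(Ordinal lb)).
  rewrite coord_free // -val_eqE /=; congr (_%:R); congr nat_of_bool.
  by apply/eqP/eqP => [e|->//]; rewrite -(nth_index 0 sa) -(nth_index 0 sb) e.
apply/eqP/eqP => [e|->/=]; last exact: nth_index.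
by apply: val_inj; rewrite /= -e index_uniq.
Qed.

Lemma cf_comb s a (c : V -> R) : free s -> a \in s ->
  cf s a (\sum_(b <- s) c b *: b) = c a.
Proof.
move=> fs sa; rewrite cf_sum (bigD1_seq a) ?free_uniq //= cfZ cf_id // eqxx mulr1.
rewrite big_seq_cond big1 ?addr0 // => b /andP[sb ba].
by rewrite cfZ cf_id // eq_sym (negbTE ba) mulr0.
Qed.

Lemma cf_span s v : free s -> v \in <<s>>%VS -> v = \sum_(a <- s) cf s a v *: a.
Proof.
move=> fs sv; rewrite {1}(coord_span (X := in_tuple s) sv).
rewrite (big_nth 0) big_mkord; apply: eq_bigr => i _; congr (_ *: _).
rewrite /cf (big_pred1 i) // => j.
apply/eqP/eqP => [e|->//]; apply: val_inj => /=.
by apply/eqP; rewrite -(nth_uniq 0 _ _ (free_uniq fs)) // e.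
Qed.

Lemma natcombE s (c : V -> nat) :
  \sum_(a <- s) a *+ c a = \sum_(a <- s) (c a)%:R *: a.
Proof. by apply: eq_bigr => a _; rewrite scaler_nat. Qed.
Lemma intcombE s (c : V -> int) :
  \sum_(a <- s) a *~ c a = \sum_(a <- s) (c a)%:~R *: a.
Proof. by apply: eq_bigr => a _; rewrite scaler_int. Qed.
Lemma cf_nat s a (c : V -> nat) : free s -> a \in s ->
  cf s a (\sum_(b <- s) b *+ c b) = (c a)%:R.
Proof. by move=> fs sa; rewrite natcombE cf_comb. Qed.
Lemma cf_int s a (c : V -> int) : free s -> a \in s ->
  cf s a (\sum_(b <- s) b *~ c b) = (c a)%:~R.
Proof. by move=> fs sa; rewrite intcombE cf_comb. Qed.
Lemma comb_span s (c : V -> R) : \sum_(a <- s) c a *: a \in <<s>>%VS.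
Proof. by rewrite big_seq memv_suml // => a sa; rewrite memvZ ?memv_span. Qed.

(** The integral cone and the lattice generated by s. *)
Definition nspan s v := exists c : V -> nat, v = \sum_(a <- s) a *+ c a.
Definition ispan s v := exists c : V -> int, v = \sum_(a <- s) a *~ c a.

Lemma nspan_ispan s v : nspan s v -> ispan s v.
Proof. by case=> c ->; exists (fun a => (c a)%:Z). Qed.
Lemma ispan0 s : ispan s 0.
Proof. by exists (fun _ => 0); rewrite big1. Qed.
Lemma ispanD s v w : ispan s v -> ispan s w -> ispan s (v + w).
Proof.
move=> [c ->] [d ->]; exists (fun a => c a + d a); rewrite -big_split.
by apply: eq_bigr => a _; rewrite mulrzDr.
Qed.
Lemma ispanMz s v n : ispan s v -> ispan s (v *~ n).
Proof.
move=> [c ->]; exists (fun a => c a * n); rewrite mulrz_suml.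
by apply: eq_bigr => a _; rewrite mulrzA.
Qed.
Lemma ispanN s v : ispan s v -> ispan s (- v).
Proof. by move=> /(ispanMz (-1)); rewrite mulrNz. Qed.
Lemma ispanB s v w : ispan s v -> ispan s w -> ispan s (v - w).
Proof. by move=> sv sw; apply: ispanD => //; apply: ispanN. Qed.
Lemma nspan0 s : nspan s 0.
Proof. by exists (fun _ => 0%N); rewrite big1. Qed.
Lemma nspanD s v w : nspan s v -> nspan s w -> nspan s (v + w).
Proof.
move=> [c ->] [d ->]; exists (fun a => c a + d a)%N; rewrite -big_split.
by apply: eq_bigr => a _; rewrite mulrnDr.
Qed.
Lemma nspan_id s a : uniq s -> a \in s -> nspan s a.
Proof.
move=> us sa; exists (fun b => b == a); rewrite (bigD1_seq a) //= eqxx big1 ?addr0 // => b.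
by move=> /negbTE->.
Qed.
Lemma ispan_id s a : uniq s -> a \in s -> ispan s a.
Proof. by move=> us sa; apply: nspan_ispan; apply: nspan_id. Qed.
Lemma ispan_span s v : ispan s v -> v \in <<s>>%VS.
Proof. by move=> [c ->]; rewrite intcombE comb_span. Qed.

Lemma cf_nspan_ge0 s v a : free s -> nspan s v -> a \in s -> 0 <= cf s a v.
Proof. by move=> fs [c ->] sa; rewrite cf_nat. Qed.

End Coordinates.

(** * Cartan numbers *)

Section Roots.
Context {R : realType} {V : vectType R} (ip : {dot V for @idfun R}).
Implicit Types (S : set V) (a b c : V).
Local Notation A := (cartan ip).

Lemma cartanDr a b c : A a (b + c) = A a b + A a c.
Proof. by rewrite /cartan ipDr mulrDr mulrDl. Qed.
Lemma cartanZr a b r : A a (r *: b) = r * A a b.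
Proof. by rewrite /cartan ipZr mulrCA !mulrA. Qed.
Lemma cartan0r a : A a 0 = 0.
Proof. by rewrite -(scale0r 0) cartanZr mul0r. Qed.
Lemma cartanNr a b : A a (- b) = - A a b.
Proof. by rewrite -scaleN1r cartanZr mulN1r. Qed.
Lemma cartanBr a b c : A a (b - c) = A a b - A a c.
Proof. by rewrite cartanDr cartanNr. Qed.
Lemma cartanMzr a b n : A a (b *~ n) = A a b *~ n.
Proof. by rewrite -scaler_int cartanZr mulrzl. Qed.
Lemma cartan_sumr a (I : Type) (r : seq I) (P : pred I) (F : I -> V) :
  A a (\sum_(i <- r | P i) F i) = \sum_(i <- r | P i) A a (F i).
Proof. exact: (big_morph (A a) (cartanDr a) (cartan0r a)). Qed.
Lemma cartan_id a : a != 0 -> A a a = 2.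
Proof. by move=> a0; rewrite /cartan mulfK // gt_eqF // ip_gt0. Qed.
Lemma cartan_gt0 a b : a != 0 -> (0 < A a b) = (0 < ip a b).
Proof. by move=> a0; rewrite /cartan pmulr_lgt0 ?invr_gt0 ?ip_gt0 // pmulr_rgt0. Qed.
Lemma cartan_lt0 a b : a != 0 -> (A a b < 0) = (ip a b < 0).
Proof. by move=> a0; rewrite -[LHS]oppr_gt0 -(cartanNr a b) cartan_gt0 // ipNr oppr_gt0. Qed.
Lemma cartan_le0 a b : a != 0 -> (A a b <= 0) = (ip a b <= 0).
Proof. by move=> a0; rewrite !leNgt cartan_gt0. Qed.

(** The strict Cauchy-Schwarz inequality, read on the two Cartan numbers. *)
Lemma edges_lt4 a b : a != 0 -> b \notin <[a]>%VS -> edges ip a b < 4.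
Proof.
move=> a0 ba; have b0 : b != 0 by apply: contraNneq ba => ->; exact: mem0v.
set r := ip a b / ip a a; have d0 : b - r *: a != 0.
  apply: contraNneq ba => /eqP; rewrite subr_eq0 => /eqP ->.
  by apply/vlineP; exists r.
have gd := ip_gt0 ip d0; have ga := ip_gt0 ip a0; have gb := ip_gt0 ip b0.
have nza : ip a a != 0 by rewrite gt_eqF.
have nzb : ip b b != 0 by rewrite gt_eqF.
rewrite /edges /cartan [ip b a]ipC.
have -> : 2 * ip a b / ip a a * (2 * ip a b / ip b b) =
          4 * (ip a b ^+ 2 / (ip a a * ip b b)) by field; rewrite nza nzb.
rewrite gtr_pMr // ltr_pdivrMr ?mulr_gt0 // mul1r -subr_gt0.
have -> : ip a a * ip b b - ip a b ^+ 2 = ip a a * ip (b - r *: a) (b - r *: a).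
  by rewrite ipBr !ipBl !ipZr !ipZl [ip b a]ipC /r; field.
exact: mulr_gt0.
Qed.

(** The axioms of a root system that do not mention the space that it spans. *)
Definition is_roots S : Prop :=
  [/\ finite_set S, ~ S 0, (forall a b, S a -> S b -> A a b \is a Num.int) &
      (forall a b, S a -> S b -> S (b - A a b *: a))].

Section IsRoots.
Context (S : set V) (rS : is_roots S).

Lemma root_neq0 a : S a -> a != 0.
Proof. by case: rS => _ S0 _ _ Sa; apply/eqP => a0; apply: S0; rewrite -a0. Qed.

Lemma root_cartan a b : S a -> S b -> exists n : int, A a b = n%:~R.
Proof. by case: rS => _ _ h _ Sa Sb; apply/intrP; apply: h. Qed.

Lemma root_refl a b : S a -> S b -> S (b - A a b *: a).
Proof. by case: rS => _ _ _ h; apply: h. Qed.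

Lemma root_opp a : S a -> S (- a).
Proof.
move=> Sa; have := root_refl Sa Sa; rewrite cartan_id ?root_neq0 //.
by rewrite scaler_nat mulr2n opprD addrA subrr add0r.
Qed.

(** Of two positive integers with product less than 4, one is 1; the reflection in the corresponding
    root subtracts that root once. *)
Lemma root_sub a b : S a -> S b -> b \notin <[a]>%VS -> 0 < ip a b -> S (b - a).
Proof.
move=> Sa Sb ba; have a0 := root_neq0 Sa; have b0 := root_neq0 Sb => ab.
have := edges_lt4 a0 ba; have := cartan_gt0 b a0; have := cartan_gt0 a b0.
rewrite [ip b a]ipC ab /edges.
have [n en] := root_cartan Sa Sb; have [m em] := root_cartan Sb Sa.
have rb := root_refl Sa Sb; have ra := root_refl Sb Sa.
rewrite en in rb *; rewrite em in ra *.
rewrite !ltr0z -intrM -[4]/(4%:~R) ltr_int => m0 n0 nm.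
have [n1|m1] : n = 1 \/ m = 1 by nia.
  by rewrite n1 scale1r in rb.
by rewrite m1 scale1r in ra; rewrite -opprB; apply: root_opp.
Qed.

Lemma root_add a b : S a -> S b -> b \notin <[a]>%VS -> ip a b < 0 -> S (b + a).
Proof.
move=> Sa Sb ba ab; rewrite -[a]opprK; apply: root_sub => //; first exact: root_opp.
  by rewrite -scaleN1r; apply: contra ba => /vlineP[k ->]; apply/vlineP; exists (k * -1); rewrite scalerA.
by rewrite ipC ipNr ipC oppr_gt0.
Qed.

(** The reflection in a reverses the a-string through b. *)
Lemma root_flip a b c : S a -> S c -> c = b + a -> S (b - (A a b + 1) *: a).
Proof.
move=> Sa Sc e; have := root_refl Sa Sc; rewrite e cartanDr cartan_id ?root_neq0 //.
suff -> : b + a - (A a b + 2) *: a = b - (A a b + 1) *: a by [].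
rewrite -addrA; congr (b + _); rewrite -[X in X - _]scale1r -scalerBl -scaleNr.
by congr (_ *: _); ring.
Qed.

Lemma root_flipV a b : S a -> S (b - (A a b + 1) *: a) -> S (b + a).
Proof.
move=> Sa Sc; have := root_refl Sa Sc.
rewrite cartanBr cartanZr cartan_id ?root_neq0 // -addrA -opprD -scalerDl.
suff -> : A a b + 1 + (A a b - (A a b + 1) * 2) = -1 by rewrite scaleN1r opprK.
by ring.
Qed.

(** The Cartan number of n a against a is 2 / n. *)
Lemma root_line a (n : nat) : S a -> S (a *+ n) -> (n <= 2)%N.
Proof.
move=> Sa Sn; have [k] := root_cartan Sn Sa.
have n0 : (0 < n)%N by case: n Sn => // /root_neq0; rewrite mulr0n eqxx.
rewrite /cartan -scaler_nat ipZr !ipZl => e.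
have ga := ip_gt0 ip (root_neq0 Sa).
have nza : ip a a != 0 by rewrite gt_eqF.
have nz : n%:R != 0 :> R by rewrite pnatr_eq0 -lt0n.
have : (k * n%:Z)%:~R = 2%:~R :> R.
  by rewrite intrM -e /=; field; rewrite nza nz.
move/eqP; rewrite eqr_int => /eqP kn; rewrite leqNgt; apply/negP => n2.
have [] : (k <= 0 \/ 1 <= k)%R by lia.
  by nia.
by nia.
Qed.

End IsRoots.
End Roots.

(** * Positive systems *)

Section SimpleSystems.
Context {R : realType} {V : vectType R} (ip : {dot V for @idfun R}).
Implicit Types (S : set V) (s : seq V) (a b c : V).
Local Notation A := (cartan ip).

(** A linear dependency among pairwise obtuse vectors splits into two equal nonnegative combinations;
    their common value has nonpositive norm, and lies in an open half-space unless it is trivial. *)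
Lemma obtuse_free h s : uniq s -> (forall a, a \in s -> 0 < ip h a) ->
  {in s &, forall a b, a != b -> ip a b <= 0} -> free s.
Proof.
move=> us hs obt; change (free (in_tuple s)); apply/freeP => k.
pose c a := \sum_(i < size s | s`_i == a) k i.
have ck (i : 'I_(size s)) : c s`_i = k i.
  rewrite /c (big_pred1 i) // => j; apply/eqP/eqP => [e|->//].
  by apply: val_inj => /=; apply/eqP; rewrite -(nth_uniq 0 _ _ us) // e.
rewrite (eq_bigr (fun i : 'I__ => c s`_i *: s`_i)); last by move=> i _; rewrite ck.
rewrite -(big_mkord xpredT (fun i => c s`_i *: s`_i)) -(big_nth 0 xpredT (fun a => c a *: a)).
move=> c0 i; rewrite -ck; have : s`_i \in s by rewrite mem_nth.
move: (s`_i) => {i} a sa.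
have maxB (r : R) : Num.max 0 r - Num.max 0 (- r) = r.
  have [r0|/ltW r0] := leP 0 r.
    by rewrite max_l ?subr0 // oppr_le0.
  by rewrite max_r ?oppr_ge0 // sub0r opprK.
have maxM (r : R) : Num.max 0 (- r) * Num.max 0 r = 0.
  have [r0|/ltW r0] := leP 0 r; first by rewrite (@max_l _ _ 0 (- r)) ?mul0r // oppr_le0.
  by rewrite mulr0.
have max0 (r : R) : 0 <= Num.max 0 r by rewrite le_max lexx.
pose u := \sum_(b <- s) Num.max 0 (c b) *: b.
pose w := \sum_(b <- s) Num.max 0 (- c b) *: b.
have uw : u = w.
  apply/eqP; rewrite -subr_eq0 -sumrB; apply/eqP; rewrite -[RHS]c0; apply: eq_bigr => b _.
  by rewrite -scalerBl maxB.
have u0 : u = 0.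
  apply/eqP; apply: contraT => /(ip_gt0 ip); rewrite {2}uw ltNge => /negP[].
  rewrite ip_sumr big_seq sumr_le0 // => d sd; rewrite ipZr ipC ip_sumr mulr_sumr.
  rewrite big_seq sumr_le0 // => b sb; rewrite ipZr mulrA.
  case: (eqVneq b d) => [<-|bd].
    by rewrite maxM mul0r.
  rewrite mulr_ge0_le0 ?mulr_ge0 ?le_max ?lexx // obt // 1?eq_sym //.
have vanish (f : V -> R) : (forall b, 0 <= f b) -> \sum_(b <- s) f b *: b = 0 -> f a = 0.
  move=> f0 e; have := ip0r ip h; rewrite -e ip_sumr big_seq => /eqP.
  rewrite psumr_eq0 => [/allP/(_ a sa)|b sb].
    by rewrite sa ipZr mulf_eq0 (gt_eqF (hs a sa)) orbF => /eqP.
  by rewrite ipZr mulr_ge0 // ltW ?hs.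
have u1 := vanish _ (fun b => max0 (c b)) u0; rewrite uw in u0.
have u2 := vanish _ (fun b => max0 (- c b)) u0.
by rewrite -[c a]maxB u1 u2 subr0.
Qed.

Section Positive.
Context (S : set V) (rS : is_roots ip S) (h : V) (h0 : forall a, S a -> ip h a != 0).

Definition positive : set V := [set a | S a /\ 0 < ip h a].
Local Notation P := positive.

(** Induction along the linear form h, which takes finitely many values on the roots. *)
Lemma positive_ind (Q : V -> Prop) :
  (forall b, P b -> (forall a, P a -> ip h a < ip h b -> Q a) -> Q b) ->
  forall b, P b -> Q b.
Proof.
move=> ind; case: rS => /finite_seqP[r er] _ _ _.
have Sr a : S a <-> a \in r by rewrite er.
pose m b := count (fun x => ip h x < ip h b) r.
suff H n b : (m b < n)%N -> P b -> Q b by move=> b; apply: (H (m b).+1).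
elim: n b => // n IH b mb Pb; apply: ind => // a Pa ab; apply: IH => //.
apply: (@leq_trans (m b)) => //; rewrite /m.
have ra : a \in r by apply/Sr; case: Pa.
move: ra; elim: {Sr er m mb} r => //= x r IHr; rewrite inE => /orP[/eqP<-|].
  rewrite ltxx ab add0n add1n ltnS; apply: sub_count => y /=; move/lt_trans; exact.
move/IHr; case: ltP => //= [xa|_]; first by rewrite (lt_trans xa ab).
by move=> /leq_trans; apply; rewrite leq_addl.
Qed.

Lemma positive_nspan s : uniq s -> [set` s] = simple_roots P ->
  forall b, P b -> nspan s b.
Proof.
move=> us es; apply: positive_ind => b Pb IH.
have [sb|sb] := pselect (simple_roots P b).
  by apply: nspan_id => //; rewrite -es in sb.
have [c [d [Pc Pd e]]] : exists c d, [/\ P c, P d & b = c + d].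
  by apply: contrapT => N; apply: sb.
rewrite e; apply: nspanD; apply: IH => //; rewrite e ipDr ?ltrDl ?ltrDr.
  by case: Pd.
by case: Pc.
Qed.

(** If two simple roots made an acute angle then their difference would be a root, and one of them
    would be the sum of the other and of that difference; proportional roots are handled through
    their Cartan numbers. *)
Lemma simple_obtuse a b : simple_roots P a -> simple_roots P b -> a != b -> ip a b <= 0.
Proof.
move=> [Pa sa] [Pb sb] ab; rewrite leNgt; apply/negP => ipab.
have [Sa ha] := Pa; have [Sb hb] := Pb.
have [|ba] := boolP (b \in <[a]>%VS); last first.
  have Sba := root_sub rS Sa Sb ba ipab.
  have := h0 Sba; rewrite neq_lt => /orP[|] hba.
    apply: sa; exists (a - b), b; split=> //; last by rewrite subrK.
    split; first by rewrite -opprB; exact: (root_opp rS Sba).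
    by rewrite -opprB ipNr oppr_gt0.
  by apply: sb; exists (b - a), a; split=> //; rewrite subrK.
move/vlineP => [k ek]; have ga := ip_gt0 ip (root_neq0 rS Sa).
have k0 : 0 < k by move: ipab; rewrite ek ipZr pmulr_lgt0.
have [n en] := root_cartan rS Sa Sb; have [m em] := root_cartan rS Sb Sa.
have nza : ip a a != 0 by rewrite gt_eqF.
have nzk : k != 0 by rewrite gt_eqF.
rewrite /cartan ek !ipZr !ipZl in en em.
have {}en : n%:~R = 2 * k by rewrite -en; field; rewrite ?nza ?nzk.
have {}em : m%:~R * k = 2 by rewrite -em; field; rewrite ?nza ?nzk.
have nm : n * m = 4 by apply/eqP; rewrite -(eqr_int R) intrM en -mulrA [k * _]mulrC em -[4]/(4%:R) -natrM.
have n0 : 0 < n by rewrite -(ltr0z R) en; lra.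
have m0 : 0 < m by nia.
have n4 : n <= 4 by nia.
have [n1|[n2|{}n4]] : n = 1 \/ n = 2 \/ n = 4.
  have [n1|[n2|[n3|]]] : n = 1 \/ n = 2 \/ n = 3 \/ n = 4 by lia.
  - by left.
  - by right; left.
  - by move: nm; rewrite n3; lia.
  - by right; right.
- apply: sa; exists b, b; split=> //; rewrite ek -scalerDl; have -> : k + k = 1 by move: en; rewrite n1; lra.
  by rewrite scale1r.
- by move/eqP: ab; apply; rewrite ek; have -> : k = 1 by [move: en; rewrite n2; lra]; rewrite scale1r.
- apply: sb; exists a, a; split=> //; rewrite ek -[a in RHS]scale1r -scalerDl; congr (_ *: _).
  by move: en; rewrite n4; lra.
Qed.
End Positive.
End SimpleSystems.

(** * Simple systems and the system spanned by a lowest root *)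

Section Spans.
Context {R : realType} {V : vectType R}.
Implicit Types (s f p : seq V) (a b c v : V).

Lemma zspanP s v : uniq s -> zspan [set` s] v <-> ispan s v.
Proof.
by move=> us; split=> -[c ->]; exists c; rewrite -fsbig_seq.
Qed.

Lemma rspanP s v : uniq s -> rspan [set` s] v <-> v \in <<s>>%VS.
Proof.
move=> us; split=> [[c ->]|]; first by rewrite -fsbig_seq // comb_span.
move=> /(@coord_span _ _ _ (in_tuple s)) e.
exists (fun a => cf s a v); rewrite -fsbig_seq //.
rewrite (big_nth 0) big_mkord {1}e; apply: eq_bigr => i _; congr (_ *: _).
rewrite /cf (big_pred1 i) // => j.
apply/eqP/eqP => [ee|->//]; apply: val_inj => /=.
by apply/eqP; rewrite -(nth_uniq 0 _ _ us) // ee.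
Qed.

Lemma sum_subseq (M : zmodType) f p (F : V -> M) : uniq f -> uniq p -> {subset f <= p} ->
  \sum_(a <- f) F a = \sum_(a <- p | a \in f) F a.
Proof.
move=> uf up fp; rewrite -[RHS]big_filter; apply: perm_big; apply: uniq_perm => //.
  exact: filter_uniq.
by move=> a; rewrite mem_filter; have [/fp->|] := boolP (a \in f).
Qed.

Lemma ispan_sub f p v : uniq f -> uniq p -> {subset f <= p} -> ispan f v -> ispan p v.
Proof.
move=> uf up fp [c ->]; exists (fun a => if a \in f then c a else 0).
rewrite (sum_subseq _ uf up fp) big_mkcond; apply: eq_bigr => a _.
by case: ifP => //; rewrite mulr0z.
Qed.

Lemma nspan_sub f p v : uniq f -> uniq p -> {subset f <= p} -> nspan f v -> nspan p v.
Proof.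
move=> uf up fp [c ->]; exists (fun a => if a \in f then c a else 0%N).
rewrite (sum_subseq _ uf up fp) big_mkcond; apply: eq_bigr => a _.
by case: ifP => //; rewrite mulr0n.
Qed.

Lemma free_sub f p : uniq f -> {subset f <= p} -> free p -> free f.
Proof.
move=> uf fp fr; have pe : perm_eq f [seq a <- p | a \in f].
  apply: uniq_perm => //; first by rewrite filter_uniq ?free_uniq.
  by move=> a; rewrite mem_filter; have [/fp->|] := boolP (a \in f).
by rewrite (perm_free pe) filter_free.
Qed.

(** The level is well defined because the coefficients of a vector on a basis are unique. *)
Lemma level_comb p (c : V -> int) : free p ->
  level [set` p] (\sum_(a <- p) a *~ c a) = \sum_(a <- p) c a.
Proof.
move=> fp; have up := free_uniq fp; apply: xget_unique.
  by exists c; rewrite -!fsbig_seq.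
move=> k [d]; rewrite -!fsbig_seq // => -[e ->].
rewrite big_seq [RHS]big_seq; apply: eq_bigr => a pa.
by apply/eqP; rewrite -(eqr_int R) -!(cf_int _ fp pa) e.
Qed.

Lemma level_add p f v (c : V -> int) : free p -> uniq f -> {subset f <= p} -> ispan p v ->
  level [set` p] (v + \sum_(a <- f) a *~ c a) = level [set` p] v + \sum_(a <- f) c a.
Proof.
move=> fp uf sfp [d ->]; have up := free_uniq fp; rewrite level_comb //.
rewrite (sum_subseq _ uf up sfp) (sum_subseq c uf up sfp).
rewrite [X in level _ (_ + X)]big_mkcond [X in _ = _ + X]big_mkcond.
rewrite -!big_split /= -(level_comb _ fp); congr (level _ _); apply: eq_bigr => a _.
by case: ifP; rewrite ?addr0 // mulrzDr.
Qed.

End Spans.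

Section StringSimple.
Context {R : realType} {V : vectType R} (ip : {dot V for @idfun R}).
Implicit Types (S : set V) (s f : seq V) (a b c : V).

(** The simple roots are a basis: they generate the positive roots, by induction, and are linearly
    independent because they are pairwise obtuse. *)
Lemma simple_seq S h : is_roots ip S -> (forall a, S a -> ip h a != 0) ->
  exists s, [/\ [set` s] = simple_roots (positive ip S h), free s &
    forall b, positive ip S h b -> nspan s b].
Proof.
move=> rS h0; case: (rS) => /finite_seqP[r er] _ _ _.
pose s := undup [seq a <- r | `[< simple_roots (positive ip S h) a >]].
have us : uniq s by rewrite undup_uniq.
have es : [set` s] = simple_roots (positive ip S h).
  apply/seteqP; split=> a /=; rewrite mem_undup mem_filter; first by case/andP => /asboolP.
  move=> sa; apply/andP; split; first exact/asboolP.
  by case: sa => -[]; rewrite {1}er.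
have sP a : a \in s -> simple_roots (positive ip S h) a by rewrite -es.
exists s; split=> //; last exact: (positive_nspan rS us es).
apply: (@obtuse_free _ _ ip h) => // [a /sP[[]] //|a b /sP sa /sP sb].
exact: (simple_obtuse rS h0).
Qed.

Lemma sub_is_roots S Q : is_roots ip S -> uniq Q -> (forall a, a \in Q -> S a) ->
  is_roots ip (sub_roots S [set` Q]).
Proof.
move=> rS uQ QS; case: (rS) => fS S0 SA Sr; split.
- by apply: sub_finite_set fS => a [].
- by case.
- by move=> a b [_ Sa] [_ Sb]; apply: SA.
- move=> a b [za Sa] [zb Sb]; split; last exact: Sr.
  have [n ->] := root_cartan rS Sa Sb; rewrite scaler_int.
  by apply/zspanP => //; apply: ispanB; [|apply: ispanMz]; apply/zspanP.
Qed.

Context (S : set V) (rS : is_roots ip S) (h : V) (h0 : forall a, S a -> ip h a != 0).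
Local Notation P := (positive ip S h).

(** Let s' be the simple system of the lattice root system spanned by lam and f. It contains f, and
    comparing coefficients in both directions shows that it contains exactly one further root mu,
    with lam = mu + (a nonnegative combination of f). Minimality of lam makes it equal to mu. *)
Lemma lowest_simple f lam : uniq f -> (forall a, a \in f -> simple_roots P a) ->
  P lam -> free (lam :: f) ->
  (forall c : V -> nat, S (lam - \sum_(a <- f) a *+ c a) -> forall a, a \in f -> c a = 0%N) ->
  simple_roots (positive ip (sub_roots S [set` lam :: f]) h) = [set` lam :: f] /\
  (forall b, sub_roots S [set` lam :: f] b -> 0 < ip h b -> nspan (lam :: f) b).
Proof.
move=> uf fP Plam flf minl; set S' := sub_roots S _.
have ulf := free_uniq flf; have ff : free f by move: flf; rewrite free_cons => /andP[].
have lamf : lam \notin <<f>>%VS by move: flf; rewrite free_cons => /andP[].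
have lfS a : a \in lam :: f -> S a.
  by rewrite inE => /orP[/eqP->|/fP[[]]//]; case: Plam.
have rS' : is_roots ip S' by apply: sub_is_roots.
have h0' a : S' a -> ip h a != 0 by case=> _ /h0.
have lfS' a : a \in lam :: f -> S' a.
  by move=> sa; split; [apply/zspanP => //; apply: ispan_id | apply: lfS].
have [s [es fs sP]] := simple_seq rS' h0'.
have us := free_uniq fs.
have sS a : a \in s -> S' a /\ 0 < ip h a.
  by move=> sa; have : [set` s] a by []; rewrite es => -[].
have subfs : {subset f <= s}.
  move=> a fa; suff : [set` s] a by []; rewrite es; split.
    by split; [apply: lfS'; rewrite inE fa orbT | case: (fP a fa) => -[]].
  move=> [b [c [[[_ Sb] hb] [[_ Sc] hc] e]]]; case: (fP a fa) => _; apply.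
  by exists b, c.
have [d ed] : nspan s lam by apply: sP; split; [apply: lfS'; rewrite inE eqxx | case: Plam].
have dE a : a \in s -> cf s a lam = (d a)%:R by move=> sa; rewrite ed cf_nat.
(* the coefficient of lam in a simple root outside f *)
have outside mu : mu \in s -> mu \notin f -> d mu = 1%N /\
    forall nu, nu \in s -> nu \notin f -> nu = mu.
  have key a : a \in s -> a \notin f -> exists k : int, forall b, b \in s -> b \notin f ->
      (b == a)%:Z = k * (d b)%:Z.
    move=> sa naf; have [[/(zspanP _ ulf)[c ec] _] _] := sS a sa.
    exists (c lam) => b sb nbf; apply/eqP; rewrite -(eqr_int R).
    rewrite -[X in X == _]/((b == a)%:R) -(cf_id fs sb sa) ec big_cons cfD cfMz dE // intrM.
    rewrite cf_sum big_seq big1 ?addr0 => [|e fe]; first by rewrite -mulrzl.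
    rewrite cfMz cf_id // ?subfs // (negbTE (_ : b != e)) ?mul0rz //.
    by apply: contraNneq nbf => ->.
  move=> smu nmu; have [k ek] := key mu smu nmu.
  have d1 : d mu = 1%N.
    have := ek mu smu nmu; rewrite eqxx /= => k1.
    have [d0|[//|d2]] : (d mu = 0 \/ d mu = 1 \/ 2 <= d mu)%N by lia.
      by move: k1; rewrite d0 mulr0.
    have [] : (k <= 0 \/ 1 <= k)%R by lia.
      by nia.
    by nia.
  split=> // nu snu nnu; have [l el] := key nu snu nnu.
  have := el mu smu nmu; have := el nu snu nnu; rewrite eqxx d1 mulr1 => e1 e2.
  by apply/eqP; rewrite eq_sym; move: e1 e2; case: (mu == nu) => //=; lia.
have [mu smu nmu] : exists2 mu, mu \in s & mu \notin f.
  apply: contrapT => N; move/negP: lamf; apply; rewrite ed natcombE big_seq memv_suml // => a sa.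
  apply: memvZ; apply: memv_span; apply: contrapT => /negP fa; apply: N; by exists a.
have [dmu uniqmu] := outside mu smu nmu.
have elam : lam = mu + \sum_(a <- f) a *+ d a.
  rewrite {1}ed (bigID (mem f)) /= -(sum_subseq _ uf us subfs) addrC; congr (_ + _).
  rewrite big_mkcond (bigD1_seq mu) //= nmu dmu mulr1n big_seq_cond big1 ?addr0 // => a.
  by case/andP => sa amu; case: ifP => // /(uniqmu _ sa) e; rewrite e eqxx in amu.
have lmu : lam = mu.
  rewrite elam big_seq big1 ?addr0 // => a fa; rewrite (minl d) ?mulr0n //.
  by rewrite {1}elam addrK; case: (sS mu smu) => -[].
have mem_s : s =i lam :: f.
  move=> a; rewrite inE; apply/idP/orP => [sa|[/eqP->|/subfs//]]; last by rewrite lmu.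
  by have [fa|/(uniqmu a sa) ->] := boolP (a \in f); [right|left; rewrite lmu].
split.
  by rewrite -es; apply/seteqP; split=> a /=; rewrite mem_s.
by move=> b Sb hb; apply: (@nspan_sub _ _ s) => // [a|]; [rewrite mem_s|apply: sP].
Qed.

End StringSimple.

(** * Strings without gaps *)

Section Lowest.
Context {R : realType} {V : vectType R} (ip : {dot V for @idfun R}).
Implicit Types (S : set V) (s f p : seq V) (a b c v : V).
Local Notation A := (cartan ip).

Lemma cf_sub f p (c : V -> int) a : free p -> uniq f -> {subset f <= p} -> a \in f ->
  cf p a (\sum_(b <- f) b *~ c b) = (c a)%:~R.
Proof.
move=> fp uf sfp fa; rewrite (sum_subseq _ uf (free_uniq fp) sfp) big_mkcond.
rewrite (eq_bigr (fun b => b *~ (if b \in f then c b else 0))); last first.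
  by move=> b _; case: ifP => //; rewrite mulr0z.
by rewrite cf_int ?sfp // fa.
Qed.

(** The signs of the coefficients on a basis are inherited by a subfamily. *)
Lemma nspan_sign f p v : free p -> uniq f -> {subset f <= p} ->
  ispan f v -> nspan p v -> nspan f v.
Proof.
move=> fp uf sfp [c ->] np; exists (fun a => `|c a|%N); rewrite big_seq [RHS]big_seq.
apply: eq_bigr => a fa; have := cf_nspan_ge0 fp np (sfp _ fa).
by rewrite cf_sub // ler0z => c0; rewrite -[in LHS](gez0_abs c0).
Qed.

(** A nonzero nonnegative combination makes an acute angle with some element of its support. *)
Lemma acute_support f d (c : V -> nat) : d != 0 -> d = \sum_(a <- f) a *+ c a ->
  exists a, [/\ a \in f, (0 < c a)%N & 0 < ip a d].
Proof.
move=> d0 ed.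
have [a fa] : exists2 a, a \in f & 0 < (c a)%:R * ip d a.
  apply: contrapT => N; have := ip_gt0 ip d0; rewrite ltNge => /negP[].
  rewrite {2}ed natcombE ip_sumr big_seq sumr_le0 // => a fa; rewrite ipZr leNgt.
  by apply/negP => H; apply: N; exists a.
have [->|ca] := posnP (c a); first by rewrite mul0r ltxx.
by rewrite pmulr_rgt0 ?ltr0n // ipC => da; exists a.
Qed.

(** In this situation lam plays the role of a lowest weight: every root of the string of lam along f
    is obtained from lam by adding elements of f. *)
Definition lowest S f lam : Prop :=
  [/\ is_roots ip S, free (lam :: f), (forall a, a \in lam :: f -> S a) &
   forall g, S g -> ispan f (g - lam) -> nspan f (g - lam)].

(** By [lowest_simple] the coefficients of a root are all of the same sign in the simple system
    lam :: f, and for a root of the string the coefficient of lam is 1. *)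
Lemma lowest_intro S h f lam : is_roots ip S -> (forall a, S a -> ip h a != 0) ->
  uniq f -> (forall a, a \in f -> simple_roots (positive ip S h) a) ->
  positive ip S h lam -> free (lam :: f) ->
  (forall c : V -> nat, S (lam - \sum_(a <- f) a *+ c a) -> forall a, a \in f -> c a = 0%N) ->
  lowest S f lam.
Proof.
move=> rS h0 uf fP Plam flf minl; have [_ pos] := lowest_simple rS h0 uf fP Plam flf minl.
have ulf := free_uniq flf; have sub : {subset f <= lam :: f} by move=> a; rewrite inE orbC => ->.
have lamf : lam \notin f by move: ulf => /andP[].
have lf : lam \in lam :: f by rewrite inE eqxx.
split=> // [a|g Sg sg].
  by rewrite inE => /orP[/eqP->|/fP[[]]//]; case: Plam.
have {}pos b : S b -> ispan (lam :: f) b -> 0 < ip h b -> nspan (lam :: f) b.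
  by move=> Sb sb; apply: pos; split=> //; apply/zspanP.
have sg' : ispan (lam :: f) g.
  by rewrite -(subrK lam g); apply: ispanD; [exact: ispan_sub sg | exact: ispan_id].
have cl : cf (lam :: f) lam g = 1.
  case: sg => c ec; rewrite -(subrK lam g) cfD ec (cf_id flf lf lf) eqxx cf_sum big_seq big1 ?add0r // => a fa.
  have /negbTE n : lam != a by apply: contraNneq lamf => ->.
  by rewrite cfMz (cf_id flf lf (sub a fa)) n mul0rz.
have := h0 g Sg; rewrite neq_lt => /orP[] hg.
  have : nspan (lam :: f) (- g).
    by apply: pos; [exact: root_opp rS _ Sg | exact: ispanN | rewrite ipNr oppr_gt0].
  by move/(cf_nspan_ge0 flf)/(_ lf); rewrite cfN cl oppr_ge0 ler10.
case: (sg) => c ec; exists (fun a => `|c a|%N); rewrite ec big_seq [RHS]big_seq.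
apply: eq_bigr => a fa; have := cf_nspan_ge0 flf (pos g Sg sg' hg) (sub a fa).
rewrite -{1}(subrK lam g) cfD ec cf_sub // (cf_id flf (sub a fa) lf).
have /negbTE -> : a != lam by apply: contraNneq lamf => <-.
by rewrite addr0 ler0z => c0; rewrite -[in LHS](gez0_abs c0).
Qed.

Context S f lam (low : lowest S f lam).

Lemma lowest_roots : is_roots ip S. Proof. by case: low. Qed.
Let rS := lowest_roots.
Lemma lowest_free : free f.
Proof. by case: low => _ + _ _; rewrite free_cons => /andP[]. Qed.
Let ff := lowest_free.
Let uf := free_uniq ff.
Lemma lowest_notin : lam \notin <<f>>%VS.
Proof. by case: low => _ + _ _; rewrite free_cons => /andP[]. Qed.
Lemma lowest_mem a : a \in f -> S a.
Proof. by case: low => _ _ + _; move=> + fa; apply; rewrite inE fa orbT. Qed.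
Let fS := lowest_mem.
Lemma lowest_lam : S lam.
Proof. by case: low => _ _ + _; apply; rewrite inE eqxx. Qed.
Lemma lowest_nspan g : S g -> ispan f (g - lam) -> nspan f (g - lam).
Proof. by case: low => _ _ _; apply. Qed.

(** A root of the string is never proportional to an element of the span of f, so that the sign of
    an inner product decides whether a sum or a difference is a root. *)
Lemma string_line g d : g - lam \in <<f>>%VS -> d \in <<f>>%VS -> g \notin <[d]>%VS.
Proof.
move=> gl df; apply: contra lowest_notin => /vlineP[k e].
by rewrite -[lam](subrKC g) -opprB e rpredD ?rpredN // ?memvZ // -e.
Qed.

Lemma string_add g d : S g -> g - lam \in <<f>>%VS -> S d -> d \in <<f>>%VS ->
  ip g d < 0 -> S (g + d).
Proof. by move=> Sg gl Sd df gd; apply: (root_add rS Sd Sg (string_line gl df)); rewrite ipC. Qed.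

Lemma string_sub g d : S g -> g - lam \in <<f>>%VS -> S d -> d \in <<f>>%VS ->
  0 < ip g d -> S (g - d).
Proof. by move=> Sg gl Sd df gd; apply: (root_sub rS Sd Sg (string_line gl df)); rewrite ipC. Qed.

Lemma string_obtuse a : a \in f -> ip lam a <= 0.
Proof.
move=> fa; rewrite leNgt; apply/negP => la; have af := memv_span fa.
have Sla : S (lam - a).
  by apply: string_sub => //; [exact: lowest_lam | rewrite subrr mem0v | exact: fS].
have e : lam - a - lam = - a by rewrite addrAC subrr add0r.
have := lowest_nspan Sla; rewrite e => /(_ (ispanN (ispan_id uf fa))).
by move/(cf_nspan_ge0 ff)/(_ fa); rewrite cfN cf_id // eqxx oppr_ge0 ler10.
Qed.

(** A positive combination of f that is a root, but not in f, stays a root after the removal of one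
    element of f: some element of its support makes an acute angle with it. *)
Lemma root_peel d (c : V -> nat) : S d -> d = \sum_(a <- f) a *+ c a -> d \notin f ->
  exists a, [/\ a \in f, (0 < c a)%N & S (d - a)].
Proof.
move=> Sd ed ndf; have d0 := root_neq0 rS Sd.
have [a [fa ca da]] := acute_support d0 ed; exists a; split=> //; have Sa := fS fa.
have [/vlineP[k ek]|] := boolP (d \in <[a]>%VS); last by move=> nda; exact: (root_sub rS).
have ek' : k = (c a)%:R.
  by rewrite -(cf_nat c ff fa) -ed ek cfZ cf_id // eqxx mulr1.
rewrite ek ek' scaler_nat in Sd ndf *.
have := root_line rS Sa Sd; case: (c a) ca Sd ndf => [|[|[|//]]] //.
  by rewrite mulr1n fa.
by rewrite mulr2n addrK.
Qed.

(** The root system counterpart of the Jacobi identity: if neither mu + a nor mu + d were a root, then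
    mu would make nonobtuse angles, and mu + a + d nonacute ones, with both a and d, whereas
    <mu + a + d, a + d> - <mu, a + d> = |a + d|^2 is positive. *)
Lemma root_jacobi mu a d : S mu -> mu - lam \in <<f>>%VS -> S a -> a \in <<f>>%VS ->
  S d -> d \in <<f>>%VS -> S (a + d) -> S (mu + a + d) -> S (mu + a) \/ S (mu + d).
Proof.
move=> Smu mul Sa af Sd df Sad Sg.
have [?|nma] := pselect (S (mu + a)); first by left.
have [?|nmd] := pselect (S (mu + d)); first by right.
exfalso; have ge0 b : S b -> b \in <<f>>%VS -> ~ S (mu + b) -> 0 <= ip mu b.
  by move=> Sb bf nb; rewrite leNgt; apply/negP => H; apply: nb; apply: string_add.
have gl : mu + a + d - lam \in <<f>>%VS by rewrite addrAC rpredD // addrAC rpredD.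
have le0 b : S b -> b \in <<f>>%VS -> ~ S (mu + a + d - b) -> ip (mu + a + d) b <= 0.
  by move=> Sb bf nb; rewrite leNgt; apply/negP => H; apply: nb; apply: string_sub.
have h1 := ge0 a Sa af nma; have h2 := ge0 d Sd df nmd.
have h3 : ip (mu + a + d) d <= 0 by apply: le0; rewrite ?addrK.
have h4 : ip (mu + a + d) a <= 0 by apply: le0; rewrite // addrAC addrK.
have h5 := ip_gt0 ip (root_neq0 rS Sad); move: h3 h4 h5; rewrite !ipDl !ipDr; lra.
Qed.

(** By induction on the height of d: peel a off d, leaving d'; by [root_jacobi] either mu + d' is a
    root, which is mu + d - a, or mu + a is one and the pair (mu, d) is replaced by (mu + a, d'). *)
Lemma no_gap_root d (c : V -> nat) mu : d = \sum_(a <- f) a *+ c a -> S d ->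
  S mu -> mu - lam \in <<f>>%VS -> S (mu + d) -> exists2 a, a \in f & S (mu + d - a).
Proof.
have [n] := ubnP (\sum_(a <- f) c a)%N; elim: n d c mu => // n IH d c mu hn ed Sd Smu mul Smd.
have [fd|nfd] := boolP (d \in f); first by exists d => //; rewrite addrK.
have [a [fa ca Sda]] := root_peel Sd ed nfd.
have af := memv_span fa.
pose c' b := (c b - (b == a))%N.
have ed' : d - a = \sum_(b <- f) b *+ c' b.
  rewrite ed (bigD1_seq a) //= [RHS](bigD1_seq a) //= addrAC /c' eqxx; congr (_ + _).
    by rewrite mulrnBr.
  by apply: eq_bigr => b /negbTE->; rewrite subn0.
have df : d - a \in <<f>>%VS by rewrite ed' natcombE comb_span.
have e : mu + a + (d - a) = mu + d by rewrite -addrA subrKC.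
have [] := @root_jacobi mu a (d - a) => //.
- exact: fS.
- by rewrite addrC subrK.
- by rewrite e.
- move=> Sma; have [] := IH (d - a) c' (mu + a) => //.
  + move: hn; rewrite ltnS; apply: leq_trans; rewrite /c' (bigD1_seq a) //= [in X in (_ <= X)%N](bigD1_seq a) //=.
    rewrite eqxx; apply: (@leq_ltn_trans (c a - 1 + \sum_(i <- f | i != a) c i)%N).
      by rewrite leq_add2l leq_sum // => i _; exact: leq_subr.
    by rewrite ltn_add2r; lia.
  + by rewrite addrAC rpredD.
  + by rewrite e.
  + by move=> b fb Sb; exists b; rewrite // -e.
- by move=> Smda; exists a => //; rewrite -addrA.
Qed.

(** If every element of f makes an obtuse angle with a root g of the string then so does g - lam,
    hence <g, lam> is positive and g - lam is itself a root, which is then peeled off g. *)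
Lemma no_gap g : S g -> ispan f (g - lam) -> g <> lam -> exists2 a, a \in f & S (g - a).
Proof.
move=> Sg sg gl; have := lowest_nspan Sg sg => -[c ec].
have glf := ispan_span sg.
apply: contrapT => N.
have le0 a : a \in f -> ip g a <= 0.
  move=> fa; rewrite leNgt; apply/negP => H; apply: N; exists a => //.
  by apply: string_sub => //; [exact: fS|exact: memv_span].
have gphi : ip g (g - lam) <= 0.
  rewrite ec natcombE ip_sumr big_seq sumr_le0 // => a fa; rewrite ipZr.
  by rewrite mulr_ge0_le0 // le0.
have : 0 < ip lam g.
  rewrite ipC; have := ip_gt0 ip (root_neq0 rS Sg); move: gphi; rewrite ipBr; lra.
move/(root_sub rS lowest_lam Sg) => sub; apply: N.
have Sd : S (g - lam).
  apply: sub; apply/negP => /vlineP[k ek]; move: glf; rewrite ek -{2}[lam]scale1r -scalerBl.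
  have [k1|k1] := eqVneq (k - 1) 0.
    move=> _; apply: gl; have k1' : k = 1 by lra.
    by rewrite ek k1' scale1r.
  move/(memvZ (k - 1)^-1); rewrite scalerA mulVf // scale1r; apply/negP.
  exact: lowest_notin.
have := no_gap_root ec Sd lowest_lam; rewrite subrr mem0v [lam + _]addrC subrK; exact.
Qed.

End Lowest.

(** * Orthogonal components *)

Section Orthogonal.
Context {R : realType} {V : vectType R} (ip : {dot V for @idfun R}).
Implicit Types (S : set V) (s f p : seq V) (a b c v : V).
Local Notation A := (cartan ip).

Lemma lowest_sub S f f' lam : lowest ip S f lam -> uniq f' -> {subset f' <= f} ->
  lowest ip S f' lam.
Proof.
move=> low uf' sf; have ff := lowest_free low; have uf := free_uniq ff; case: low => rS fl lS nS.
split=> // [|a|g Sg sg].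
- rewrite free_cons (free_sub uf' sf ff) andbT.
  have : lam \notin <<f>>%VS by move: fl; rewrite free_cons => /andP[].
  by apply: contra => /(subvP (sub_span sf)).
- by rewrite inE => /orP[/eqP->|/sf fa]; apply: lS; rewrite inE ?eqxx ?fa ?orbT.
- apply: (nspan_sign ff uf' sf sg); apply: nS => //.
  exact: ispan_sub sg.
Qed.

(** The height with respect to a linearly independent family. *)
Definition ht f v : R := \sum_(a <- f) cf f a v.

Lemma htB f v w : ht f (v - w) = ht f v - ht f w.
Proof. by rewrite /ht -sumrB; apply: eq_bigr => a _; rewrite cfB. Qed.
Lemma htZ f (r : R) v : ht f (r *: v) = r * ht f v.
Proof. by rewrite /ht big_distrr; apply: eq_bigr => a _; rewrite cfZ. Qed.
Lemma ht_id f a : free f -> a \in f -> ht f a = 1.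
Proof.
move=> ff fa; rewrite /ht (bigD1_seq a) ?free_uniq //= cf_id // eqxx big_seq_cond.
by rewrite big1 ?addr0 // => b /andP[fb /negbTE ba]; rewrite cf_id // ba.
Qed.
Lemma ht_ge0 f v : free f -> nspan f v -> 0 <= ht f v.
Proof. by move=> ff nv; rewrite /ht big_seq sumr_ge0 // => a; apply: cf_nspan_ge0. Qed.

Context S f lam (low : lowest ip S f lam).
Let rS := lowest_roots low.
Let ff := lowest_free low.
Let uf := free_uniq ff.

(** If mu + a is a root then either the Cartan number of mu against a is negative, which also makes
    nu + a a root, or the reflection in a carries mu + a below mu; the same reflection then carries
    the matching root below nu to nu + a. *)
Lemma parallel_step a mu nu : a \in f -> S mu -> S nu -> nu - lam \in <<f>>%VS ->
  A a mu = A a nu -> S (mu + a) ->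
  (forall m : nat, S (mu - a *+ m.+1) -> S (nu - a *+ m.+1)) -> S (nu + a).
Proof.
move=> fa Smu Snu nul e Sa flip; have Sfa := lowest_mem low fa.
have [m em] := root_cartan rS Sfa Smu.
have [m0|m0] := ltP m 0.
  apply: (string_add low) => //; first exact: memv_span.
  by rewrite ipC -(cartan_lt0 _ _ (root_neq0 rS Sfa)) -e em ltrz0.
have := root_flip rS Sfa Sa erefl; rewrite em => S1.
apply: (root_flipV rS) => //; rewrite -e em.
have e1 : (m%:~R + 1 : R) *: a = a *+ (`|m|%N).+1.
  by rewrite -scaler_nat -natr1; congr ((_ + 1) *: _); rewrite -[in LHS](gez0_abs m0).
by rewrite e1 in S1 *; apply: flip.
Qed.

Context (n : nat) (fs : 'I_n -> seq V).
Context (ufs : forall k, uniq (fs k)) (sfs : forall k, {subset fs k <= f}).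
Context (cover : forall a, a \in f -> exists k, a \in fs k).
Context (orth : forall j k, j != k -> forall a b, a \in fs j -> b \in fs k -> ip a b = 0).
Implicit Type gam : 'I_n -> V.

Definition shift gam k v : 'I_n -> V := fun j => if j == k then gam k - v else gam j.

Lemma shift_sum gam k v : \sum_j shift gam k v j = \sum_j gam j - v.
Proof.
rewrite (bigD1 k) //= [X in _ = X - _](bigD1 k) //= /shift eqxx addrAC; congr (_ + _ - _).
by apply: eq_bigr => j /negbTE->.
Qed.

Lemma shift_span gam k a m : (forall j, ispan (fs j) (gam j)) -> a \in fs k ->
  forall j, ispan (fs j) (shift gam k (a *+ m) j).
Proof.
move=> sg fa j; rewrite /shift; case: eqP => // ->; apply: ispanB => //.
by apply: (ispanMz m%:Z); apply: ispan_id.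
Qed.

Lemma orth_cartan gam k a v : (forall j, ispan (fs j) (gam j)) -> a \in fs k ->
  A a (lam + gam k + v) = A a (lam + \sum_j gam j + v).
Proof.
move=> sg fa; rewrite !cartanDr; congr (_ + _ + _).
rewrite cartan_sumr (bigD1 k) //= big1 ?addr0 // => j jk; have [c ->] := sg j.
rewrite intcombE cartan_sumr big_seq big1 // => b fb.
by rewrite cartanZr /cartan (orth _ fa fb) ?mulr0 ?mul0r ?mulr0 // eq_sym.
Qed.

Lemma family_span gam : (forall j, ispan (fs j) (gam j)) -> ispan f (\sum_j gam j).
Proof.
move=> sg; apply: (big_ind (ispan f)) => [|v w|j _]; first exact: ispan0.
  exact: ispanD.
exact: ispan_sub (sg j).
Qed.

(** By induction on the height. One element a of some component is peeled off, and whether it can be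
    put back depends, by orthogonality, only on the a-string inside that component. *)
Lemma string_join gam : (forall j, ispan (fs j) (gam j)) ->
  (forall j, S (lam + gam j)) -> S (lam + \sum_j gam j).
Proof.
have lowk k : lowest ip S (fs k) lam by apply: lowest_sub low _ _.
have [N] : exists N : nat, ht f (\sum_j gam j) < N%:R.
  have [h0|h0] := leP 0 (ht f (\sum_j gam j)); last by exists 0%N.
  by exists (Num.bound (ht f (\sum_j gam j))); apply: archi_boundP.
elim: N gam => [|N IH] gam hN sg Sg.
  suff : 0 <= ht f (\sum_j gam j) by rewrite leNgt hN.
  apply: ht_ge0 => //; apply: (big_ind (nspan f)) => [|v w|j _]; first exact: nspan0.
    exact: nspanD.
  apply: (nspan_sub (ufs j) uf (@sfs j)); have := lowest_nspan (lowk j) (Sg j).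
  by rewrite addrAC subrr add0r; apply.
have [g0|[k gk]] : (forall j, gam j = 0) \/ exists j, gam j <> 0.
  have [?|H] := pselect (exists j, gam j <> 0); first by right.
  by left=> j; apply: contrapT => gj; apply: H; exists j.
  by rewrite big1 ?addr0 //; exact: lowest_lam low.
have [||a fa Sa] := no_gap (lowk k) (Sg k).
- by rewrite addrAC subrr add0r.
- by move/eqP; rewrite eq_sym -subr_eq0 opprD addrA subrr add0r oppr_eq0 => /eqP.
have down m : S (lam + gam k - a *+ m.+1) -> S (lam + \sum_j gam j - a *+ m.+1).
  move=> Sm; rewrite -addrA -(shift_sum gam k); apply: IH.
  - rewrite shift_sum htB -scaler_nat htZ (ht_id ff (sfs fa)) mulr1.
    by move: hN; rewrite -!natr1; have := ler0n R m; lra.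
  - exact: shift_span.
  - by move=> j; rewrite /shift; case: eqP => // _; rewrite addrA.
have fa' := sfs fa.
suff : S (lam + \sum_j gam j - a + a) by rewrite subrK.
apply: (@parallel_step _ (lam + gam k - a)) => //.
- exact: (down 0%N).
- rewrite addrAC [lam + _]addrC addrK; apply: rpredB; last exact: memv_span.
  exact: ispan_span (family_span sg).
- exact: orth_cartan.
- by rewrite subrK.
- by move=> m; rewrite -!addrA -!opprD -mulrS !addrA; apply: down.
Qed.

(** The converse inclusion, by the same step with the roles of the two roots exchanged. *)
Lemma string_split gam : (forall j, ispan (fs j) (gam j)) ->
  S (lam + \sum_j gam j) -> forall j, S (lam + gam j).
Proof.
have lowk k : lowest ip S (fs k) lam by apply: lowest_sub low _ _.
have [N] : exists N : nat, ht f (\sum_j gam j) < N%:R.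
  have [h0|h0] := leP 0 (ht f (\sum_j gam j)); last by exists 0%N.
  by exists (Num.bound (ht f (\sum_j gam j))); apply: archi_boundP.
elim: N gam => [|N IH] gam hN sg Sg k.
  suff : 0 <= ht f (\sum_j gam j) by rewrite leNgt hN.
  apply: ht_ge0 => //; have := lowest_nspan low Sg.
  by rewrite addrAC subrr add0r; apply; apply: family_span.
have sG := family_span sg.
have [g0|g0] := eqVneq (\sum_j gam j) 0.
  suff -> : gam k = 0 by rewrite addr0; exact: lowest_lam low.
  have [c ec] := sg k; rewrite ec big_seq big1 // => a fa.
  have : cf f a (\sum_j gam j) = (c a)%:~R.
    rewrite (bigD1 k) //= cfD ec (cf_sub _ ff (ufs k) (@sfs k) fa) cf_sum.
    rewrite big1 ?addr0 // => j jk; have [d ->] := sg j.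
    rewrite cf_sum big_seq big1 // => b fb; rewrite cfMz cf_id ?(sfs fa) ?(sfs fb) //.
    have /negbTE-> : a != b; last by rewrite mul0rz.
    apply/eqP => ab; have := orth jk fb fa; rewrite ab; apply/eqP.
    by rewrite gt_eqF // ip_gt0 // (root_neq0 rS (lowest_mem low (sfs fb))).
  by rewrite g0 cf0 => /esym/eqP; rewrite intr_eq0 => /eqP->; rewrite mulr0z.
have [||a fa Sa] := no_gap low Sg.
- by rewrite addrAC subrr add0r.
- by move/eqP; rewrite eq_sym -subr_eq0 opprD addrA subrr add0r oppr_eq0 (negbTE g0).
have [k' fk'] : exists k', a \in fs k'.
  exact: cover.
have down m : S (lam + \sum_j gam j - a *+ m.+1) -> forall j, S (lam + shift gam k' (a *+ m.+1) j).
  move=> Sm; apply: IH.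
  - rewrite shift_sum htB -scaler_nat htZ (ht_id ff fa) mulr1.
    by move: hN; rewrite -!natr1; have := ler0n R m; lra.
  - exact: shift_span.
  - by rewrite shift_sum addrA.
have [kk|/eqP kk] := k =P k'; last first.
  by have := down 0%N Sa k; rewrite /shift (negbTE kk).
rewrite -kk in fk' down.
have {}down m : S (lam + \sum_j gam j - a *+ m.+1) -> S (lam + gam k - a *+ m.+1).
  by move=> Sm; have := down m Sm k; rewrite /shift eqxx addrA.
suff : S (lam + gam k - a + a) by rewrite subrK.
apply: (@parallel_step _ (lam + \sum_j gam j - a)) => //.
- exact: (down 0%N).
- rewrite addrAC [lam + _]addrC addrK; apply: rpredB; last exact: memv_span.
  by apply: ispan_span; exact: ispan_sub (sg k).
- by rewrite (orth_cartan (- a) sg fk').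
- by rewrite subrK.
- by move=> m; rewrite -!addrA -!opprD -mulrS !addrA; apply: down.
Qed.
End Orthogonal.

(** * Coefficient vectors of a string *)

Section Coefficients.
Context {R : realType} {V : vectType R}.
Implicit Types (al : nat -> V) (c d : nat -> int).

Definition vec N al c : V := \sum_(j < N.+1) al j *~ c j.

Definition bump_at k (m : int) c : nat -> int := fun j => c j + m * (j == k)%:Z.

(** The Cartan numbers of the vector with coefficients c against the basis vectors. *)
Definition pairing (M : nat -> nat -> int) N k c : int := \sum_(j < N.+1) M k j * c j.

Lemma eq_vec N al c d : (forall j, (j <= N)%N -> c j = d j) -> vec N al c = vec N al d.
Proof. by move=> e; apply: eq_bigr => j _; rewrite e // -ltnS. Qed.

Lemma eq_pairing M N k c d : (forall j, (j <= N)%N -> c j = d j) ->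
  pairing M N k c = pairing M N k d.
Proof. by move=> e; apply: eq_bigr => j _; rewrite e // -ltnS. Qed.

Lemma vec_bump N al k m c : (k <= N)%N -> vec N al (bump_at k m c) = vec N al c + al k *~ m.
Proof.
move=> kN; rewrite /vec (bigD1 (inord k)) //= [X in _ = X + _](bigD1 (inord k)) //= addrAC.
rewrite inordK // /bump_at eqxx mulr1 mulrzDr; congr (_ + _); apply: eq_bigr => j jk.
suff /negbTE-> : j != k :> nat by rewrite mulr0 addr0.
by apply: contraNneq jk => e; apply/eqP/val_inj; rewrite /= inordK.
Qed.

Lemma pairing_bump M N k i m c : (i <= N)%N ->
  pairing M N k (bump_at i m c) = pairing M N k c + m * M k i.
Proof.
move=> iN; rewrite /pairing (bigD1 (inord i)) //= [X in _ = X + _](bigD1 (inord i)) //= addrAC.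
rewrite inordK // /bump_at eqxx mulr1 mulrDr [M k i * m]mulrC; congr (_ + _).
apply: eq_bigr => j ji.
suff /negbTE-> : j != i :> nat by rewrite mulr0 addr0.
by apply: contraNneq ji => e; apply/eqP/val_inj; rewrite /= inordK.
Qed.

Lemma vec_unit N al : vec N al (fun j => (j == 0%N)%:Z) = al 0%N.
Proof. by rewrite /vec big_ord_recl /= big1 ?addr0 // => j _; rewrite mulr0z. Qed.

Lemma vec_nth (t : seq V) N c : size t = N.+1 -> uniq t ->
  vec N (nth 0 t) c = \sum_(a <- t) a *~ c (index a t).
Proof.
move=> st ut; rewrite (big_nth 0) st big_mkord; apply: eq_bigr => j _.
by rewrite index_uniq // st.
Qed.

Lemma vec_inj (t : seq V) N c d : free t -> size t = N.+1 ->
  vec N (nth 0 t) c = vec N (nth 0 t) d -> forall j, (j <= N)%N -> c j = d j.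
Proof.
move=> ft st e j jN; have ut := free_uniq ft; have tj : t`_j \in t by rewrite mem_nth ?st.
have := congr1 (cf t t`_j) e; rewrite !vec_nth // !(cf_int _ ft tj) index_uniq ?st //.
by move/eqP; rewrite eqr_int => /eqP.
Qed.

End Coefficients.

Section StringChar.
Context {R : realType} {V : vectType R} (ip : {dot V for @idfun R}).
Implicit Types (c d : nat -> int).
Local Notation A := (cartan ip).

(** L lists the coefficient vectors of a string if it is closed upwards, as prescribed by the
    root strings of the simple roots k >= 1, and if each of its elements other than the unit vector
    is obtained from a smaller one by a step up or by a reflection. *)
Definition closed_list (M : nat -> nat -> int) N (L : (nat -> int) -> Prop) : Prop :=
  [/\ forall c, L c -> c 0%N = 1 /\ forall j, (j <= N)%N -> 0 <= c j,
      forall c d, L c -> (forall j, (j <= N)%N -> c j = d j) -> L d,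
      L (fun j => (j == 0%N)%:Z),
      forall c k, (1 <= k <= N)%N -> L c ->
        pairing M N k c < 0 \/ (0 <= pairing M N k c /\ L (bump_at k (- (pairing M N k c + 1)) c)) ->
        L (bump_at k 1 c) &
      forall c, L c -> (exists2 j, (1 <= j <= N)%N & c j != 0) ->
        exists2 k, (1 <= k <= N)%N &
          (L (bump_at k (-1) c) /\ pairing M N k (bump_at k (-1) c) < 0) \/
          (0 < pairing M N k c /\ L (bump_at k (- pairing M N k c) c))].

Context (S : set V) (f : seq V) (lam : V) (low : lowest ip S f lam).
Let rS := lowest_roots low.
Let ff := lowest_free low.
Let uf := free_uniq ff.
Let N := size f.
Local Notation al := (nth 0 (lam :: f)).

Context (M : nat -> nat -> int).
Context (MA : forall k j, (1 <= k <= N)%N -> (j <= N)%N -> A (al k) (al j) = (M k j)%:~R).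
Context (Mid : forall k, (1 <= k <= N)%N -> M k k = 2).

Lemma al_mem k : (1 <= k <= N)%N -> al k \in f.
Proof. by case: k => // k /= kN; apply: mem_nth. Qed.

Lemma cartan_vec k c : (1 <= k <= N)%N -> A (al k) (vec N al c) = (pairing M N k c)%:~R.
Proof.
move=> kN; rewrite /vec /pairing cartan_sumr rmorph_sum; apply: eq_bigr => j _.
have jN : (j <= N)%N by rewrite -ltnS.
by rewrite cartanMzr MA // rmorphM /= -mulrzr.
Qed.

Lemma vec_ispan c : c 0%N = 1 -> ispan f (vec N al c - lam).
Proof.
move=> c0; rewrite /vec big_ord_recl /= c0 addrC addrA addNr add0r.
apply: (big_ind (ispan f)) => [|v w|j _]; [exact: ispan0 | exact: ispanD |].
by apply: ispanMz; apply: ispan_id; rewrite ?mem_nth ?add0n ?ltn_ord.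
Qed.

(** Both inclusions are by induction on the height. Going up, there is no gap, so a root of the string
    is g + a with g in the list; if the Cartan number of g against a is not negative, the reflection
    in a turns g + a into a lower root, which is in the list, and the closure condition applies.
    Going down, a step with a negative Cartan number, or a reflection, produces a root. *)
Lemma closed_list_string L : closed_list M N L ->
  forall g, (S g /\ ispan f (g - lam)) <-> exists c, L c /\ g = vec N al c.
Proof.
move=> [L0 Lext L1 Lup Ldown] g; have freelf : free (lam :: f) by case: low.
split=> [[Sg sg]|].
  have [n] : exists n : nat, ht f (g - lam) < n%:R.
    have [h0|h0] := leP 0 (ht f (g - lam)); last by exists 0%N.
    by exists (Num.bound (ht f (g - lam))); apply: archi_boundP.
  elim: n g Sg sg => [|n IH] g Sg sg hn.
    have := ht_ge0 ff (lowest_nspan low Sg sg); by rewrite leNgt hn.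
  have [->|/eqP gl] := eqVneq g lam.
    by exists (fun j => (j == 0%N)%:Z); split=> //; rewrite vec_unit.
  have [a fa Sa] := no_gap low Sg sg gl.
  have [k kN ek] : exists2 k, (1 <= k <= N)%N & a = al k.
    by exists (index a f).+1; rewrite /= ?index_mem ?nth_index.
  have down m : S (g - a *+ m.+1) -> exists c, L c /\ g - a *+ m.+1 = vec N al c.
    move=> Sm; apply: IH => //.
      rewrite addrAC; apply: ispanB => //; apply: (ispanMz m.+1%:Z); exact: ispan_id.
    rewrite addrAC htB -scaler_nat htZ (ht_id ff fa) mulr1.
    by move: hn; rewrite -!natr1; have := ler0n R m; lra.
  have [c [Lc ec]] := down 0%N Sa.
  have eg : g = vec N al (bump_at k 1 c).
    rewrite vec_bump; last by case/andP: kN.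
    by rewrite -ec -ek subrK.
  exists (bump_at k 1 c); split=> //; apply: Lup => //.
  have [?|m0] := ltP (pairing M N k c) 0; first by left.
  right; split=> //; have Sg' : S (vec N al c + a) by rewrite -ec subrK.
  have := root_flip rS (lowest_mem low fa) Sg' erefl.
  rewrite {1}ek cartan_vec // -ec.
  have -> : g - a *+ 1 - ((pairing M N k c)%:~R + 1) *: a = g - a *+ (`|pairing M N k c|%N).+2.
    rewrite [in RHS]mulrS opprD addrA; congr (_ - _); rewrite -scaler_nat -natr1.
    by congr ((_ + 1) *: _); rewrite -[in LHS](gez0_abs m0).
  move/down => [d [Ld ed]]; apply: Lext Ld _ => j jN.
  apply: (vec_inj freelf _ _ jN) => //; rewrite -ed vec_bump; last by case/andP: kN.
  rewrite -ec -ek mulrS opprD addrA -[in RHS](gez0_abs m0) mulrNz.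
  by rewrite -PoszD addn1 mulr1n.
move=> [c [Lc ->]]; have [c0 _] := L0 c Lc; split; last exact: vec_ispan.
have [n] := ubnP (\sum_(j < N.+1) `|c j|)%N; elim: n c Lc {c0} => // n IH c Lc hn.
have [c0 cge] := L0 c Lc.
have [nz|z] := pselect (exists2 j, (1 <= j <= N)%N & c j != 0); last first.
  rewrite (@eq_vec _ _ N al c (fun j => (j == 0%N)%:Z)) ?vec_unit; first exact: lowest_lam low.
  case=> // j jN; apply/eqP; rewrite /=; apply: contraT => cj; case: z.
  by exists j.+1.
have smaller k m : (1 <= k <= N)%N -> 0 < m -> L (bump_at k (- m) c) ->
    S (vec N al (bump_at k (- m) c)).
  move=> /andP[k1 kN] m0 Lm; apply: IH => //; move: hn; rewrite ltnS; apply: leq_trans.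
  have [_ dge] := L0 _ Lm; have := dge k kN.
  rewrite (bigD1 (inord k)) //= [in X in (_ < X)%N](bigD1 (inord k)) //= inordK //.
  rewrite {1 2}/bump_at eqxx => dk.
  rewrite -addSn leq_add //; first by have := cge k kN; lia.
  rewrite leq_sum // => j jk; rewrite /bump_at.
  suff /negbTE-> : j != k :> nat by rewrite mulr0 addr0.
  by apply: contraNneq jk => e; apply/eqP/val_inj; rewrite /= inordK.
have [k kN [[Ld neg]|[pos Ld]]] := Ldown c Lc nz.
  have fk := al_mem kN; have [_ kN'] := andP kN.
  have -> : vec N al c = vec N al (bump_at k (-1) c) + al k.
    by rewrite vec_bump // mulrNz mulr1z subrK.
  have [d0 _] := L0 _ Ld; apply: (string_add low).
  - exact: smaller.
  - exact: ispan_span (vec_ispan d0).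
  - exact (lowest_mem low fk).
  - exact: memv_span.
  - rewrite ipC -(cartan_lt0 _ _ (root_neq0 rS (lowest_mem low fk))).
    by rewrite cartan_vec // ltrz0.
have Sd := smaller k _ kN pos Ld; have [_ kN'] := andP kN.
have := root_refl rS (lowest_mem low (al_mem kN)) Sd.
rewrite cartan_vec // pairing_bump // Mid // vec_bump // mulrNz.
have -> : pairing M N k c + - pairing M N k c * 2 = - pairing M N k c by lia.
by rewrite mulrNz scaleNr opprK scaler_int subrK.
Qed.

End StringChar.

(** * Cartan matrices of diagrams *)

Section Diagrams.
Implicit Types (D : diagram) (i j k : nat).

Lemma mult_cons x D i j :
  mult (x :: D) i j = ((if (x.1 == (i, j)) || (x.1 == (j, i)) then x.2 else 0) + mult D i j)%N.
Proof. by rewrite /mult big_cons; case: ifP. Qed.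

Lemma mult_nil i j : mult [::] i j = 0%N. Proof. by rewrite /mult big_nil. Qed.

Lemma mult_cat D D' i j : mult (D ++ D') i j = (mult D i j + mult D' i j)%N.
Proof. by rewrite /mult big_cat. Qed.

Lemma mult_rcons D x i j :
  mult (rcons D x) i j = (mult D i j + if (x.1 == (i, j)) || (x.1 == (j, i)) then x.2 else 0)%N.
Proof. by rewrite -cats1 mult_cat mult_cons mult_nil addn0. Qed.

Lemma mult_chain i k a b : mult (chain i k) a b =
  ((b == a.+1) && (i <= a < i + k) || (a == b.+1) && (i <= b < i + k))%N.
Proof.
elim: k i => [|k IH] i; first by rewrite mult_nil addn0; case: eqP; case: eqP => /=; lia.
by rewrite mult_cons /= -/(chain _ _) IH !xpair_eqE; case: ifP => h; lia.
Qed.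

Lemma mem_chain i k a b m : ((a, b, m.+2) \in chain i k) = false.
Proof. by apply/negP => /mapP[j _ []]. Qed.

(* [mult] is a locked big operator; this version computes. *)
Definition mult_comp D i j : nat :=
  foldr (fun x n => (if (x.1 == (i, j)) || (x.1 == (j, i)) then x.2 else 0) + n)%N 0%N D.

Lemma mult_compE D i j : mult D i j = mult_comp D i j.
Proof. by elim: D => [|x D IH]; rewrite ?mult_nil // mult_cons IH. Qed.

(** The Cartan matrix of a diagram without triple bonds. *)
Definition cmat D i j : int :=
  if i == j then 2 else if (i, j, 2%N) \in D then - 2 else - (mult D i j != 0)%N%:Z.

(** There are only single and double bonds, and each double bond is oriented. *)
Definition simple_bonds D N : Prop := forall i j, (i <= N)%N -> (j <= N)%N -> i != j ->
  (mult D i j <= 2)%N /\ (mult D i j = 2%N -> (i, j, 2%N) \in D \/ (j, i, 2%N) \in D).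

Lemma mult_mem D i j : (i, j, 2%N) \in D -> (2 <= mult D i j)%N.
Proof.
elim: D => // x D IH; rewrite inE mult_cons => /orP[/eqP<-|/IH] /=; first by rewrite eqxx /=; lia.
lia.
Qed.

End Diagrams.

Section CartanOfDiagram.
Context {R : realType} {V : vectType R} (ip : {dot V for @idfun R}).
Local Notation A := (cartan ip).

(** Two nonpositive integers are determined by their product, at most 2, and by the comparison of the
    lengths, which says which of the two is larger in absolute value. *)
Lemma cartan_cmat (S : set V) (t : seq V) D N : is_roots ip S -> size t = N.+1 ->
  (forall a, a \in t -> S a) ->
  (forall i j, (i <= N)%N -> (j <= N)%N -> i != j -> ip t`_i t`_j <= 0) ->
  has_diagram ip t D -> simple_bonds D N ->
  forall i j, (i <= N)%N -> (j <= N)%N -> A t`_i t`_j = (cmat D i j)%:~R.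
Proof.
move=> rS st tS obt [hE hL] wf i j iN jN; rewrite /cmat.
have mem k : (k <= N)%N -> S t`_k by move=> kN; apply: tS; rewrite mem_nth ?st.
have [<-|ij] := eqVneq i j; first by rewrite cartan_id // (root_neq0 rS) //; exact: mem.
have i0 := root_neq0 rS (mem i iN); have j0 := root_neq0 rS (mem j jN).
have gi := ip_gt0 ip i0; have gj := ip_gt0 ip j0.
have [n en] := root_cartan rS (mem i iN) (mem j jN).
have [m em] := root_cartan rS (mem j jN) (mem i iN).
have n0 : n <= 0 by rewrite -(lerz0 R) -en cartan_le0 // obt.
have m0 : m <= 0 by rewrite -(lerz0 R) -em cartan_le0 // obt // eq_sym.
have := hE i j; rewrite !st !ltnS => /(_ iN jN ij); rewrite /edges en em -intrM.
move=> /eqP; rewrite -[X in _ == X]/((Posz (mult D i j))%:~R) eqr_int => /eqP nm.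
have [le2 two] := wf i j iN jN ij.
have nE : n%:~R * ip t`_i t`_i = m%:~R * ip t`_j t`_j.
  rewrite -en -em /cartan [ip t`_j t`_i]ipC !divfK //; exact: lt0r_neq0.
have short k l (x y : int) : (k, l, 2%N) \in D -> x <= 0 -> x%:~R * ip t`_k t`_k = y%:~R * ip t`_l t`_l ->
    0 < ip t`_k t`_k -> x * y = 2 -> x = -2.
  move=> kl x0 e gk xy; have lkl := hL k l 2%N kl isT.
  have y0 : y < 0 by nia.
  have y0' : (y%:~R : R) < 0 by rewrite ltrz0.
  have : (x%:~R : R) < y%:~R by nra.
  by rewrite ltr_int; nia.
congr (_%:~R); case: ifP => [ijD|ijD].
  have m2 := mult_mem ijD; apply: (short i j n m ijD n0 nE gi); lia.
have [e|[e|e]] : (mult D i j = 0 \/ mult D i j = 1 \/ mult D i j = 2)%N by lia.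
- rewrite e in nm *; have ij0 : ip t`_i t`_j = 0.
    have /eqP := nm; rewrite mulf_eq0 => /orP[] /eqP z.
      have /eqP := en; rewrite z /cartan !mulf_eq0 invr_eq0 (gt_eqF gi) orbF pnatr_eq0 /=.
      by move/eqP.
    have /eqP := em; rewrite z /cartan !mulf_eq0 invr_eq0 (gt_eqF gj) orbF pnatr_eq0 /= ipC.
    by move/eqP.
  by apply/eqP; rewrite -(eqr_int R) -en /cartan ij0 mulr0 mul0r.
- rewrite e in nm *; have [n1|[//|n2]] : n = 0 \/ n = - 1 \/ n <= -2 by lia.
    by rewrite n1 mul0r in nm.
  have [m1|m1] : m = 0 \/ m <= -1 by lia.
    by rewrite m1 mulr0 in nm.
  nia.
- rewrite e in nm *; have [|ji] := two e; first by rewrite ijD.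
  have : m = -2 by apply: (short j i m n ji m0 (esym nE) gj); lia.
  by move=> m2; rewrite m2 in nm; lia.
Qed.

End CartanOfDiagram.

(* Decide, or else split on, each comparison of natural numbers in the goal, once the hypotheses
   are reduced to linear inequalities. *)
Ltac compare_nats :=
  repeat (match goal with
  | H : forall _, _ -> @eq int _ _ |- _ => clear H
  | H : context [nat_of_bool _] |- _ => revert H
  | H : is_true (_ && _) |- _ => case/andP: H => ? ?
  | H : is_true (_ || _) |- _ => case/orP: H => ?
  | H : is_true (_ ==> _) |- _ => move/implyP: H => ?
  | H : is_true (@eq_op nat _ _) |- _ => move/eqP: H => ?
  end);
  rewrite /=; repeat (match goal with
  | |- context [leq ?a ?b] =>
      first [ have -> : leq a b = true by lia | have -> : leq a b = false by lia
            | case: (leqP a b) => ? ]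
  | |- context [@eq_op _ ?a ?b] =>
      lazymatch type of a with nat => idtac end;
      lazymatch a with context [@eq_op _ _ _] => fail | context [leq _ _] => fail | _ => idtac end;
      first [ have -> : (a == b) = true by lia | have -> : (a == b) = false by lia
            | case: (a =P b) => ? ]
  end; rewrite /=); lia.

(** * Strings of types A, B and C *)

Section Families.
Implicit Types (c d : nat -> int) (N k j : nat).

(** A parametrized list of coefficient vectors. Only the coefficients up to N matter. *)
Definition in_family (T : Type) (D : T -> Prop) (F : T -> nat -> int) N c : Prop :=
  exists2 t, D t & forall j, (j <= N)%N -> c j = F t j.

(** The parameter t' gives the vector of t plus m times the k-th unit vector. *)
Definition adjacent (T : Type) (D : T -> Prop) (F : T -> nat -> int) N k (m : int) (t t' : T) : Prop :=
  D t' /\ forall j, (j <= N)%N -> F t' j = F t j + m * (j == k)%:Z.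

(** [closed_list] read on the parameters; p is a closed form of the pairing. *)
Lemma closed_family (T : Type) (D : T -> Prop) (F : T -> nat -> int) (M : nat -> nat -> int) N
    (p : T -> nat -> int) :
  (forall t k, D t -> (1 <= k <= N)%N -> pairing M N k (F t) = p t k) ->
  (forall t, D t -> F t 0%N = 1 /\ forall j, (j <= N)%N -> 0 <= F t j) ->
  (exists2 t, D t & forall j, (j <= N)%N -> F t j = (j == 0%N)%:Z) ->
  (forall t k, (1 <= k <= N)%N -> D t ->
     p t k < 0 \/ (0 <= p t k /\ exists t', adjacent D F N k (- (p t k + 1)) t t') ->
     exists t', adjacent D F N k 1 t t') ->
  (forall t, D t -> (exists2 j, (1 <= j <= N)%N & F t j != 0) ->
     exists2 k, (1 <= k <= N)%N &
       (exists2 t', adjacent D F N k (-1) t t' & p t' k < 0) \/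
       (0 < p t k /\ exists t', adjacent D F N k (- p t k) t t')) ->
  closed_list M N (in_family D F N).
Proof.
move=> Hp F0 F1 Up Down.
have bumpE k m t t' c : (forall j, (j <= N)%N -> c j = F t j) -> adjacent D F N k m t t' ->
    in_family D F N (bump_at k m c).
  by move=> ct [Dt' e]; exists t' => // j jN; rewrite /bump_at ct // e.
have bumpV k m t c : (forall j, (j <= N)%N -> c j = F t j) -> in_family D F N (bump_at k m c) ->
    exists t', adjacent D F N k m t t'.
  move=> ct [t' Dt' e]; exists t'; split=> // j jN.
  by rewrite -e // /bump_at ct.
have pE c t k : D t -> (forall j, (j <= N)%N -> c j = F t j) -> (1 <= k <= N)%N ->
    pairing M N k c = p t k.
  by move=> Dt ct kN; rewrite -Hp //; apply: eq_pairing.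
split.
- move=> c [t Dt ct]; have [t0 tge] := F0 t Dt; split; first by rewrite ct.
  by move=> j jN; rewrite ct //; apply: tge.
- by move=> c d [t Dt ct] cd; exists t => // j jN; rewrite -cd // ct.
- by have [t Dt e] := F1; exists t => // j jN; rewrite e.
- move=> c k kN [t Dt ct]; rewrite (pE c t k Dt ct kN) => H.
  have [|t' at'] := Up t k kN Dt; last exact: bumpE at'.
  case: H => [?|[p0 /(bumpV _ _ _ _ ct) H]]; first by left.
  by right.
- move=> c [t Dt ct] [j jN cj]; have [|k kN H] := Down t Dt.
    by exists j => //; rewrite -ct //; case/andP: jN.
  exists k => //; case: H => [[t' at' pt']|[p0 [t' at']]]; [left|right].
    have Lb := bumpE _ _ _ _ _ ct at'; split=> //.
    rewrite (pE _ t') //; first by case: at'.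
    by move=> i iN; rewrite /bump_at ct //; case: at' => _ ->.
  by rewrite (pE c t k Dt ct kN); split=> //; exact: bumpE at'.
Qed.

Lemma closed_list_ext M M' N L : (forall k j, (1 <= k <= N)%N -> (j <= N)%N -> M k j = M' k j) ->
  closed_list M N L -> closed_list M' N L.
Proof.
move=> e [H0 H1 H2 H3 H4].
have pE k c : (1 <= k <= N)%N -> pairing M' N k c = pairing M N k c.
  move=> kN; apply: eq_bigr => j _; rewrite e //; by rewrite -ltnS.
split=> // [c k kN Lc|c Lc nz].
  by rewrite pE //; apply: H3.
have [k kN H] := H4 c Lc nz; exists k => //; rewrite !pE //.
Qed.

Lemma pairing_support M N k c s : uniq s -> (forall j, j \in s -> (j <= N)%N) ->
  (forall j, (j <= N)%N -> j \notin s -> M k j = 0) ->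
  pairing M N k c = \sum_(j <- s) M k j * c j.
Proof.
move=> us sN M0; rewrite /pairing -(big_mkord xpredT (fun j => M k j * c j)) (bigID (mem s)) /=.
rewrite [X in _ + X]big_seq_cond [X in _ + X]big1 ?addr0; last first.
  by move=> j /andP[]; rewrite mem_index_iota ltnS /= => jN js; rewrite M0 // mul0r.
rewrite -[LHS]big_filter; apply: perm_big; apply: uniq_perm => //.
  by rewrite filter_uniq ?iota_uniq.
move=> j; rewrite mem_filter mem_index_iota ltnS /=.
by case js: (j \in s) => //=; rewrite sN.
Qed.

(** The Cartan matrix of a chain whose bonds may be multiple. *)
Definition chain_mat (x y : nat -> int) k j : int :=
  if j == k then 2 else if j == k.+1 then - x k else if k == j.+1 then - y k else 0.

Lemma pairing_chain x y N k c : (1 <= k <= N)%N ->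
  pairing (chain_mat x y) N k c =
  2 * c k - (if (k < N)%N then x k * c k.+1 else 0) - y k * c k.-1.
Proof.
case: k => // k kN; pose s := if (k.+1 < N)%N then [:: k.+1; k; k.+2] else [:: k.+1; k].
rewrite (@pairing_support _ _ _ _ s).
- have e1 : (k == k.+1) = false by lia.
  have e2 : (k == k.+2) = false by lia.
  have e3 : (k.+2 == k.+1) = false by lia.
  rewrite /s; case: ifP => kl; rewrite !big_cons big_nil /chain_mat !eqxx e1 e2 ?e3 ?eqxx /=; lia.
- by rewrite /s; case: ifP => _ /=; rewrite !inE; lia.
- by rewrite /s => j; case: ifP => ?; rewrite !inE; lia.
- move=> j jN; rewrite /s /chain_mat; case: ifP => kl; rewrite !inE => H.
    by do ![case: eqP => ? //]; lia.
  by do ![case: eqP => ? //]; lia.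
Qed.

(** The coefficients of al 0 + ... + al l. *)
Definition step (l j : nat) : int := (j <= l)%N%:Z.

Lemma closed_a N : closed_list (chain_mat (fun _ => 1) (fun _ => 1)) N
  (in_family (fun l => (l <= N)%N) step N).
Proof.
apply: closed_family => [l k _ kN||||]; first exact: pairing_chain.
- by move=> l lN; rewrite /step; split=> [|j jN]; lia.
- by exists 0%N => // j jN; rewrite /step; lia.
- move=> l k kN lN H; have [e|ne] := eqVneq l.+1 k.
    by exists k; split=> [|j jN]; rewrite /step; lia.
  exfalso; move: H; rewrite /step; case: ltnP => kl.
    case=> [|[p0 [t' [t'N E]]]]; first lia.
    have := E k; have := E l; have := E t'; rewrite /step; lia.
  case=> [|[p0 [t' [t'N E]]]]; first lia.
  have := E k; have := E l; have := E t'; rewrite /step; lia.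
- move=> l lN [j jN Fj]; have l1 : (1 <= l)%N by move: Fj; rewrite /step; lia.
  exists l; first lia.
  left; exists l.-1; first by split=> [|i iN]; rewrite /step; lia.
  by rewrite /step; case: ltnP; lia.
Qed.

(** Two nested initial segments: these are the roots e_i + e_j of a system of type C. *)
Definition dom_b N (t : nat * nat) : bool := (t.2 <= t.1 <= N)%N.
Definition fam_b (t : nat * nat) j : int := step t.1 j + (1 <= j <= t.2)%N%:Z.

Lemma closed_b N : closed_list (chain_mat (fun _ => 1) (fun k => if k == 1%N then 2 else 1)) N
  (in_family (dom_b N) fam_b N).
Proof.
pose D := dom_b N; pose F := fam_b.
pose p (t : nat * nat) (k : nat) : int :=
  (k == t.1)%:Z - (k == t.1.+1)%:Z + (k == t.2)%:Z - (k == t.2.+1)%:Z.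
apply: (closed_family (p := p)) => [[l m] k /andP[/= ml lN] kN||||].
- rewrite pairing_chain //; rewrite /p /F /fam_b /step /=.
  by case: (ltnP k N) => kl; case: (k =P 1%N) => k1; compare_nats.
- by move=> [l m] /andP[/= ml lN]; rewrite /F /fam_b /step /=; split=> [|j jN]; compare_nats.
- exists (0%N, 0%N); first by rewrite /dom_b /=; lia.
  by move=> j jN; rewrite /F /fam_b /step /=; compare_nats.
- move=> [l m] k kN /andP[/= ml lN] H; have [e|nl] := eqVneq l.+1 k.
    by exists (k, m); split=> [|j jN]; rewrite /dom_b /fam_b /step /=; compare_nats.
  have [e|nm] := eqVneq m.+1 k.
    by exists (l, k); split=> [|j jN]; rewrite /dom_b /fam_b /step /=; compare_nats.
  exfalso; move: H; rewrite /p /=.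
  case=> [|[p0 [[l' m'] [/andP[/= ml' lN'] E]]]]; first compare_nats.
  have := E k; have := E l; have := E m; rewrite /F /fam_b /step /=; compare_nats.
- move=> [l m] /andP[/= ml lN] [j jN Fj].
  have l1 : (1 <= l)%N by move: Fj; rewrite /F /fam_b /step /=; compare_nats.
  have [m0|m0] := posnP m.
    exists l; first lia.
    left; exists (l.-1, 0%N); last by rewrite /p /=; compare_nats.
    by split=> [|i iN]; rewrite /dom_b /fam_b /step /=; compare_nats.
  exists m; first lia.
  have [e|ne] := eqVneq m l.
    right; split; first by rewrite /p /=; compare_nats.
    by exists (l.-1, l.-1); split=> [|i iN]; rewrite /dom_b /fam_b /p /step /=; compare_nats.
  left; exists (l, m.-1); last by rewrite /p /=; compare_nats.
  by split=> [|i iN]; rewrite /dom_b /fam_b /step /=; compare_nats.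
Qed.

(** An initial segment and, once it is complete, a final one; t.2 = N + 1 stands for an empty final
    segment. *)
Definition dom_c N (t : nat * nat) : bool :=
  (t.1 <= N)%N && (1 <= t.2 <= N.+1)%N && ((t.1 == N) || (t.2 == N.+1)).
Definition fam_c (t : nat * nat) j : int := step t.1 j + (t.2 <= j)%N%:Z.

(** What is needed to see that a vector is not in the family: where a coefficient is at least 1, so
    are the earlier ones, and where it is 2, so are the later ones. *)
Lemma fam_cP N t : dom_c N t ->
  (forall j k, 0 <= fam_c t j /\ ((j <= k <= N)%N -> 1 <= fam_c t k -> 1 <= fam_c t j)) /\
  (forall j k, (j <= k <= N)%N -> 2 <= fam_c t j -> 2 <= fam_c t k).
Proof.
case: t => l m /andP[/andP[/= lN mN] lm]; rewrite /fam_c /step /=.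
by split=> j k; [split=> [|jk]|move=> jk]; compare_nats.
Qed.

Lemma closed_c N : (1 <= N)%N ->
  closed_list (chain_mat (fun _ => 1) (fun k => if k == N then 2 else 1)) N
    (in_family (dom_c N) fam_c N).
Proof.
move=> N1; pose D := dom_c N; pose F := fam_c.
pose p (t : nat * nat) k : int :=
  if (k < N)%N then (k == t.1)%:Z - (k == t.1.+1)%:Z + (k == t.2)%:Z - (k.+1 == t.2)%:Z
  else 2 * (k == t.2)%:Z - 2 * (k == t.1.+1)%:Z.
apply: (closed_family (p := p)) => [[l m] k /andP[/andP[/= lN mN] lm] kN||||].
- rewrite pairing_chain //; rewrite /p /F /fam_c /step /=.
  by case: (ltnP k N) => kl; case: (k =P N) => k1; compare_nats.
- by move=> [l m] /andP[/andP[/= lN mN] lm]; rewrite /F /fam_c /step /=; split=> [|j jN]; compare_nats.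
- exists (0%N, N.+1); first by rewrite /dom_c /=; lia.
  by move=> j jN; rewrite /F /fam_c /step /=; compare_nats.
- move=> [l m] k kN /andP[/andP[/= lN mN] lm] H; have [e|nl] := eqVneq l.+1 k.
    by exists (k, m); split=> [|j jN]; rewrite /dom_c /fam_c /step /=; compare_nats.
  have [/andP[/eqP e /eqP e']|nm] := boolP ((m == k.+1) && (l == N)).
    by exists (l, k); split=> [|j jN]; rewrite /dom_c /fam_c /step /=; compare_nats.
  exfalso; move: H; rewrite /p /=.
  case: (ltnP k N) => kl [|[p0 [t' [/fam_cP[g1 g2] E]]]]; try (compare_nats).
    move: p0 (g1 k l) (g1 k N) (g2 k m) (g2 m k) (E k) (E l) (E m) (E N) => {g1 g2 E}.
    by move: (fam_c t') => f'; rewrite /fam_c /step; compare_nats.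
  move: p0 (g1 k l) (g1 k N) (g2 k m) (g2 m k) (E k) (E l) (E m) (E N) => {g1 g2 E}.
  by move: (fam_c t') => f'; rewrite /fam_c /step; compare_nats.
- move=> [l m] /andP[/andP[/= lN mN] lm] [j jN Fj].
  have l1 : (1 <= l)%N by move: Fj; rewrite /F /fam_c /step /=; compare_nats.
  have [m0|m0] := eqVneq m N.+1.
    exists l; first lia.
    left; exists (l.-1, m); last by rewrite /p /=; case: (ltnP l N); compare_nats.
    by split=> [|i iN]; rewrite /dom_c /fam_c /step /=; compare_nats.
  exists m; first lia.
  have [e|ne] := eqVneq m N.
    right; split; first by rewrite /p /=; case: (ltnP m N); compare_nats.
    exists (N.-1, N.+1); split=> [|i iN]; rewrite /dom_c /fam_c /p /step /=; first compare_nats.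
    by case: (ltnP m N); lia.
  left; exists (l, m.+1); last by rewrite /p /=; case: (ltnP m N); compare_nats.
  by split=> [|i iN]; rewrite /dom_c /fam_c /step /=; compare_nats.
Qed.

(** As above, but the long root al N is never counted twice; t.2 = N stands for an empty second
    segment. *)
Definition dom_d N (t : nat * nat) : bool :=
  (t.1 <= N)%N && (1 <= t.2 <= N)%N && ((t.1 == N) || (t.2 == N)).
Definition fam_d N (t : nat * nat) j : int := step t.1 j + (t.2 <= j < N)%N%:Z.

Lemma fam_dP N t : dom_d N t ->
  (forall j k, 0 <= fam_d N t j /\ ((j <= k <= N)%N -> 1 <= fam_d N t k -> 1 <= fam_d N t j)) /\
  (forall j k, ((j <= k < N)%N -> 2 <= fam_d N t j -> 2 <= fam_d N t k) /\
               (2 <= fam_d N t j -> 1 <= fam_d N t N)).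
Proof.
case: t => l m /andP[/andP[/= lN mN] lm]; rewrite /fam_d /step /=.
by split=> j k; [split=> [|jk]|split=> [jk|]]; compare_nats.
Qed.

Lemma closed_d N : (2 <= N)%N ->
  closed_list (chain_mat (fun k => if k == N.-1 then 2 else 1) (fun _ => 1)) N
    (in_family (dom_d N) (fam_d N) N).
Proof.
move=> N1; pose D := dom_d N; pose F := fam_d N.
pose p (t : nat * nat) k := 2 * F t k -
  (if (k < N)%N then (if k == N.-1 then 2 else 1) * F t k.+1 else 0) - F t k.-1.
have pE t k : p t k = 2 * F t k -
  (if (k < N)%N then (if k == N.-1 then 2 else 1) * F t k.+1 else 0) - F t k.-1 by [].
apply: (closed_family (p := p)) => [[l m] k /andP[/andP[/= lN mN] lm] kN||||].
- by rewrite pairing_chain // mul1r.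
- by move=> [l m] /andP[/andP[/= lN mN] lm]; rewrite /F /fam_d /step /=; split=> [|j jN]; compare_nats.
- exists (0%N, N); first by rewrite /dom_d /=; lia.
  by move=> j jN; rewrite /F /fam_d /step /=; compare_nats.
- move=> [l m] k kN /andP[/andP[/= lN mN] lm] H; have [e|nl] := eqVneq l.+1 k.
    by exists (k, m); split=> [|j jN]; rewrite /dom_d /fam_d /step /=; compare_nats.
  have [/andP[/eqP e /eqP e']|nm] := boolP ((m == k.+1) && (l == N)).
    by exists (l, k); split=> [|j jN]; rewrite /dom_d /fam_d /step /=; compare_nats.
  exfalso; move: H; rewrite pE /F.
  case: (ltnP k N) => kl; [case: (k =P N.-1) => k1|];
    move=> [|[p0 [t' [/fam_dP[g1 g2] E]]]]; try (rewrite /fam_d /step; compare_nats);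
    move: p0 (g1 k l) (g1 k N) (g2 N.-1 k) (g2 m k) (E k) (E l) (E m) (E N) (E N.-1) => {g1 g2 E};
    move: (fam_d N t') => f'; rewrite /fam_d /step; compare_nats.
- move=> [l m] /andP[/andP[/= lN mN] lm] [j jN Fj].
  have l1 : (1 <= l)%N by move: Fj; rewrite /F /fam_d /step /=; compare_nats.
  have [m0|m0] := eqVneq m N.
    exists l; first lia.
    left; exists (l.-1, m); first by split=> [|i iN]; rewrite /dom_d /fam_d /step /=; compare_nats.
    by rewrite pE /F /fam_d /step /=; case: (ltnP l N) => ?; [case: eqP => ?|]; compare_nats.
  exists m; first lia.
  left; exists (l, m.+1); first by split=> [|i iN]; rewrite /dom_d /fam_d /step /=; compare_nats.
  by rewrite pE /F /fam_d /step /=; case: (ltnP m N) => ?; [case: eqP => ?|]; compare_nats.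
Qed.

End Families.

(** * Strings of type D *)

Section Fork.
Implicit Types (c d : nat -> int) (N k j : nat).

(** The chain 0, ..., N - 1 with N attached to N - 2. *)
Definition fork_mat N k j : int :=
  if j == k then 2 else
  - ((k < N) && (j < N) && ((j == k.+1) || (k == j.+1)) ||
     (k == N) && (j == N - 2) || (j == N) && (k == N - 2))%N%:Z.

Lemma pairing_fork N k c : (3 <= N)%N -> (1 <= k <= N)%N ->
  pairing (fork_mat N) N k c =
  if k == N then 2 * c k - c (N - 2)%N
  else 2 * c k - c k.-1 - (if (k < N.-1)%N then c k.+1 else 0) - (if k == (N - 2)%N then c N else 0).
Proof.
move=> N3 kN; pose s := if k == N then [:: k; (N - 2)%N] else
  [:: k; k.-1] ++ (if (k < N.-1)%N then [:: k.+1] else [::]) ++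
                  (if k == (N - 2)%N then [:: N] else [::]).
rewrite (@pairing_support _ _ _ _ s).
- rewrite /s /fork_mat; case: eqP => k1; [|case: (ltnP k N.-1) => k2; case: eqP => k3];
    rewrite ?big_cat /= !big_cons !big_nil /=.
  + have -> : (N - 2 == k)%N = false by lia.
    by rewrite eqxx; lia.
  + have -> : (k.-1 == k)%N = false by lia.
    have -> : (k.+1 == k)%N = false by lia.
    have -> : (N == k)%N = false by lia.
    by rewrite eqxx; lia.
  + have -> : (k.-1 == k)%N = false by lia.
    have -> : (k.+1 == k)%N = false by lia.
    by rewrite eqxx; lia.
  + by lia.
  + have -> : (k.-1 == k)%N = false by lia.
    by rewrite eqxx; lia.
- rewrite /s; case: eqP => k1; [|case: (ltnP k N.-1) => k2; case: eqP => k3]; rewrite /= !inE; lia.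
- by rewrite /s => j; case: eqP => k1; [|case: (ltnP k N.-1) => k2; case: eqP => k3]; rewrite /= !inE; lia.
- move=> j jN; rewrite /s /fork_mat.
  case: eqP => k1; [|case: (ltnP k N.-1) => k2; case: eqP => k3]; rewrite /= !inE; case: eqP => jk //; lia.
Qed.

(** An initial segment and, once it is complete, a segment that ends at the branch node N - 2; the flag
    t.2 marks the one vector whose initial segment skips N - 1 instead of stopping there, and
    t.1.2 = N - 1 stands for an empty second segment. *)
Definition dom_e N (t : nat * nat * bool) : bool :=
  [&& (t.1.1 <= N)%N, (1 <= t.1.2 <= N.-1)%N, (t.1.1 == N) || (t.1.2 == N.-1)
    & t.2 ==> (t.1.1 == N) && (t.1.2 == N.-1)].
Definition fam_e N (t : nat * nat * bool) j : int :=
  step t.1.1 j + (t.1.2 <= j < N.-1)%N%:Z - (t.2 && (j == N.-1))%:Z.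

Lemma fam_eP N t : (3 <= N)%N -> dom_e N t ->
  (forall j k, 0 <= fam_e N t j /\
     ((j <= k <= N)%N -> j != N.-1 -> 1 <= fam_e N t k -> 1 <= fam_e N t j)) /\
  (forall j k, ((j <= k <= N - 2)%N -> 2 <= fam_e N t j -> 2 <= fam_e N t k) /\
               ((N.-1 <= k <= N)%N -> 2 <= fam_e N t j -> 1 <= fam_e N t k)).
Proof.
move=> N3; case: t => [[l m] b] /and4P[/= lN mN lm bb]; rewrite /fam_e /step /=.
by case: b bb => bb; split=> j k; [split=> [|jk jN]|split=> jk|split=> [|jk jN]|split=> jk];
  compare_nats.
Qed.

Lemma closed_e N : (3 <= N)%N -> closed_list (fork_mat N) N (in_family (dom_e N) (fam_e N) N).
Proof.
move=> N3; pose D := dom_e N; pose F := fam_e N.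
pose p (t : nat * nat * bool) k :=   if k == N then 2 * F t k - F t (N - 2)%N
  else 2 * F t k - F t k.-1 - (if (k < N.-1)%N then F t k.+1 else 0) -
       (if k == (N - 2)%N then F t N else 0).
have pE t k : p t k = if k == N then 2 * F t k - F t (N - 2)%N
  else 2 * F t k - F t k.-1 - (if (k < N.-1)%N then F t k.+1 else 0) -
       (if k == (N - 2)%N then F t N else 0) by [].
apply: (closed_family (p := p)) => [[[l m] b] k /and4P[/= lN mN lm bb] kN||||].
- by rewrite pairing_fork.
- move=> [[l m] b] /and4P[/= lN mN lm bb]; rewrite /F /fam_e /step /=.
  by split=> [|j jN]; case: b bb => /=; compare_nats.
- exists (0%N, N.-1, false); first by rewrite /dom_e /=; lia.
  by move=> j jN; rewrite /F /fam_e /step /=; compare_nats.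
- move=> [[l m] b] k kN /and4P[/= lN mN lm bb] H.
  have [/andP[/eqP e e']|n1] := boolP ((k == N.-1) && b).
    exists (l, m, false); rewrite e' in bb *.
    by split=> [|j jN]; rewrite /dom_e /fam_e /step /=; compare_nats.
  have [/andP[/eqP e /negbTE e']|n2] := boolP ((l.+1 == k) && ~~ b).
    exists (k, m, false); rewrite e' in bb *.
    by split=> [|j jN]; rewrite /dom_e /fam_e /step /=; compare_nats.
  have [/andP[/eqP e /eqP e']|n3] := boolP ((l == N - 2)%N && (k == N)).
    exists (N, m, true).
    by split=> [|j jN]; rewrite /dom_e /fam_e /step /=; case: b bb {n1 n2 H} => /=; compare_nats.
  have [/and3P[/eqP e /eqP e' /negbTE e'']|n4] := boolP [&& m == k.+1, l == N & ~~ b].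
    exists (l, k, false); rewrite e'' in bb *.
    by split=> [|j jN]; rewrite /dom_e /fam_e /step /=; compare_nats.
  exfalso; move: H; rewrite pE /F.
  case: b bb n1 n2 n4; rewrite /= ?andbT ?andbF => bb n1 n2 n4.
    have {bb lm} [lE mE] : l = N /\ m = N.-1 by lia.
    case: (k =P N) => k1; [|case: (ltnP k N.-1) => k2; case: (k =P (N - 2)%N) => k3];
    move=> [|[p0 [t' [/(fam_eP N3)[g1 g2] E]]]]; try (rewrite /fam_e /step; compare_nats);
    move: p0 (g1 k N) (E k) (E N) => {g1 g2 E};
    move: (fam_e N t') => f'; rewrite /fam_e /step; compare_nats.
  case: (ltngtP l N) => [lN'| |lE]; [|lia|].
    have {lm} mE : m = N.-1 by lia.
    case: (k =P N) => k1; [|case: (ltnP k N.-1) => k2; case: (k =P (N - 2)%N) => k3];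
    move=> [|[p0 [t' [/(fam_eP N3)[g1 g2] E]]]]; try (rewrite /fam_e /step; compare_nats);
    move: p0 (g1 k l) (E k) (E l) => {g1 g2 E};
    move: (fam_e N t') => f'; rewrite /fam_e /step; compare_nats.
  case: (k =P N) => k1; [|case: (ltnP k N.-1) => k2; case: (k =P (N - 2)%N) => k3];
    move=> [|[p0 [t' [/(fam_eP N3)[g1 g2] E]]]]; try (rewrite /fam_e /step; compare_nats);
    move: p0 (g1 k N) (g2 m k) (g2 m (N - 2)%N) (E k) (E m) (E N) (E (N - 2)%N) => {g1 g2 E};
    move: (fam_e N t') => f'; rewrite /fam_e /step; compare_nats.
- move=> [[l m] b] /and4P[/= lN mN lm bb] [j jN Fj].
  have l1 : (1 <= l)%N by move: Fj; rewrite /F /fam_e /step /=; compare_nats.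
  case: b bb Fj => /= bb Fj.
    exists N; first lia.
    left; exists ((N - 2)%N, N.-1, false); first by split=> [|i iN]; rewrite /dom_e /fam_e /step /=; compare_nats.
    by rewrite pE /F /fam_e /step /= eqxx; compare_nats.
  have [m0|m0] := eqVneq m N.-1.
    exists l; first lia.
    left; exists (l.-1, m, false); first by split=> [|i iN]; rewrite /dom_e /fam_e /step /=; compare_nats.
    by rewrite pE /F /fam_e /step /=; case: (l =P N) => k1; [|case: (ltnP l N.-1) => k2; case: (l =P (N - 2)%N) => k3]; compare_nats.
  exists m; first lia.
  left; exists (l, m.+1, false); first by split=> [|i iN]; rewrite /dom_e /fam_e /step /=; compare_nats.
  by rewrite pE /F /fam_e /step /=; case: (m =P N) => k1; [|case: (ltnP m N.-1) => k2; case: (m =P (N - 2)%N) => k3]; compare_nats.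
Qed.
End Fork.

(** * Strings given by finite lists *)

Section FiniteLists.
Implicit Types (M : nat -> nat -> int) (N k j : nat) (s : seq int).

Definition pairing_comp M N k s : int := foldr (fun j z => M k j * s`_j + z) 0 (iota 0 N.+1).

Definition update s k (m : int) : seq int := set_nth 0 s k (s`_k + m).

Definition unit_code N : seq int := mkseq (fun j => (j == 0%N)%:Z) N.+1.

(** The computable form of [closed_list]. *)
Definition closed_codes M N (L : seq (seq int)) : bool :=
  [&& all (fun s => (s`_0 == 1) && all (fun z => 0 <= z) s) L, unit_code N \in L,
      all (fun s => all (fun k =>
        let p := pairing_comp M N k s in
        (p < 0) || (update s k (- (p + 1)) \in L) ==> (update s k 1 \in L)) (iota 1 N)) L &
      all (fun s => (s != unit_code N) ==> has (fun k =>
        let p := pairing_comp M N k s in let s' := update s k (-1) in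
        (s' \in L) && (pairing_comp M N k s' < 0) ||
        (0 < p) && (update s k (- p) \in L)) (iota 1 N)) L].

Lemma pairing_compE M N k c : pairing M N k c = pairing_comp M N k (mkseq c N.+1).
Proof.
rewrite /pairing -(big_mkord xpredT (fun j => M k j * c j)) /index_iota subn0 /pairing_comp.
have : forall j, j \in iota 0 N.+1 -> (j < N.+1)%N by move=> j; rewrite mem_iota.
elim: (iota 0 N.+1) => [|i r IH] H; first by rewrite big_nil.
rewrite big_cons /= nth_mkseq ?H ?inE ?eqxx // IH // => j jr.
by apply: H; rewrite inE jr orbT.
Qed.

Lemma mkseq_bump N k m c : (k <= N)%N ->
  mkseq (bump_at k m c) N.+1 = update (mkseq c N.+1) k m.
Proof.
move=> kN; apply: (@eq_from_nth _ 0) => [|j].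
  by rewrite size_set_nth !size_mkseq; apply/esym/maxn_idPr.
rewrite size_mkseq => jN; rewrite nth_mkseq // nth_set_nth /= /bump_at.
case: eqP => [->|_]; first by rewrite nth_mkseq // mulr1.
by rewrite nth_mkseq // mulr0 addr0.
Qed.

Lemma mkseq_inj N c d : mkseq c N.+1 = mkseq d N.+1 <-> forall j, (j <= N)%N -> c j = d j :> int.
Proof.
split=> [e j jN|e].
  by have := congr1 (nth 0 ^~ j) e; rewrite !nth_mkseq.
by apply/eq_in_map => j; rewrite mem_iota => jN; apply: e; rewrite -ltnS.
Qed.

Lemma closed_codesP M N L : closed_codes M N L -> closed_list M N (fun c => mkseq c N.+1 \in L).
Proof.
case/and4P => /allP L0 L1 /allP Lup /allP Ldown; split=> //.
- move=> c Lc; have /andP[/eqP c0 /allP cge] := L0 _ Lc.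
  rewrite nth_mkseq // in c0; split=> // j jN; apply: cge.
  by apply/mapP; exists j => //; rewrite mem_iota.
- by move=> c d Lc /mkseq_inj <-.
- move=> c k kN Lc H; have [_ kN'] := andP kN; rewrite mkseq_bump //.
  have /allP/(_ k) := Lup _ Lc; rewrite mem_iota add1n ltnS kN => /(_ isT)/implyP; apply.
  rewrite -pairing_compE -mkseq_bump //; case: H => [->//|[_ ->]]; exact: orbT.
- move=> c Lc [j /andP[j1 jN] cj]; have := Ldown _ Lc; case: eqP => [/mkseq_inj e|_ /hasP[k]].
    by move: cj; rewrite e // gtn_eqF.
  rewrite mem_iota add1n ltnS => kN; have [_ kN'] := andP kN.
  cbv zeta; rewrite -mkseq_bump // -!pairing_compE -mkseq_bump // => H; exists k => //.
  by case/orP: H => /andP[]; [left|right].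
Qed.

Definition cmat_comp (D : diagram) i j : int :=
  if i == j then 2 else if (i, j, 2%N) \in D then - 2 else - (mult_comp D i j != 0)%N%:Z.

Lemma cmat_compE D i j : cmat D i j = cmat_comp D i j.
Proof. by rewrite /cmat mult_compE. Qed.

Definition bonds_comp (D : diagram) N : bool :=
  all (fun i => all (fun j => (i == j) || (mult_comp D i j <= 2)%N &&
    ((mult_comp D i j == 2%N) ==> ((i, j, 2%N) \in D) || ((j, i, 2%N) \in D))) (iota 0 N.+1)) (iota 0 N.+1).

Lemma bonds_compP D N : bonds_comp D N -> simple_bonds D N.
Proof.
move=> /allP H i j iN jN ij; have := H i; rewrite mem_iota => /(_ iN)/allP/(_ j).
rewrite mem_iota => /(_ jN); rewrite (negbTE ij) -!mult_compE => /andP[-> h]; split=> // e.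
by move: h; rewrite e => /orP.
Qed.

(** The coefficient vector of a code; a digit whose label is missing is 0. *)
Definition code_coef (labels c : seq nat) j : nat :=
  foldr (fun x n => (if x.1 == j then x.2 else 0) + n)%N 0%N (zip labels c).

Context {R : realType} {V : vectType R}.
Implicit Type al : nat -> V.

Lemma vecD N al c d : vec N al (fun j => c j + d j) = vec N al c + vec N al d.
Proof. by rewrite -big_split; apply: eq_bigr => j _; rewrite mulrzDr. Qed.

Lemma vec0 N al : vec N al (fun _ => 0) = 0.
Proof. by rewrite /vec big1. Qed.

Lemma vec_single N al k (m : int) : (forall j, (N < j)%N -> al j = 0) ->
  vec N al (fun j => if k == j then m else 0) = al k *~ m.
Proof.
move=> al0; have [kN|kN] := leqP k N; last first.
  rewrite al0 // mul0rz -(vec0 N al); apply: eq_vec => j jN.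
  by case: eqP => // e; move: kN; rewrite e ltnNge jN.
have := vec_bump al m (fun _ => 0) kN; rewrite vec0 add0r => <-; apply: eq_vec => j jN.
by rewrite /bump_at add0r eq_sym; case: eqP; rewrite ?mulr1 ?mulr0.
Qed.

(** Labels beyond N are harmless because al vanishes there. *)
Lemma lincombE N al labels c : (forall j, (N < j)%N -> al j = 0) ->
  lincomb al labels c = vec N al (fun j => (code_coef labels c j)%:Z).
Proof.
move=> al0; rewrite /lincomb /code_coef; elim: (zip labels c) => [|x r IH].
  by rewrite big_nil -(vec0 N al).
rewrite big_cons IH pmulrn -(vec_single _ _ al0) -vecD; apply: eq_vec => j jN /=.
by rewrite PoszD; case: eqP.
Qed.

Definition string_codes N labels (codes : seq (seq nat)) : seq (seq int) :=
  [seq mkseq (fun j => (j == 0%N)%:Z + (code_coef labels c j)%:Z) N.+1 | c <- codes].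
(* Here the codes contain the coefficient of al 0. *)
Definition full_codes N labels (codes : seq (seq nat)) : seq (seq int) :=
  [seq mkseq (fun j => (code_coef labels c j)%:Z) N.+1 | c <- codes].

Lemma string_codesP N al labels codes g : (forall j, (N < j)%N -> al j = 0) ->
  (exists c, mkseq c N.+1 \in string_codes N labels codes /\ g = vec N al c) <->
  g \in [seq al 0%N + lincomb al labels c | c <- codes].
Proof.
move=> al0; split=> [[c [/mapP[x cx /mkseq_inj e] ->]]|/mapP[x cx ->]].
  apply/mapP; exists x => //; rewrite (lincombE _ _ al0) -{1}(vec_unit N al) -vecD.
  exact: eq_vec.
exists (fun j => (j == 0%N)%:Z + (code_coef labels x j)%:Z); split; first exact: map_f.
by rewrite vecD vec_unit -lincombE.
Qed.

Lemma full_codesP N al labels codes g : (forall j, (N < j)%N -> al j = 0) ->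
  (exists c, mkseq c N.+1 \in full_codes N labels codes /\ g = vec N al c) <->
  g \in [seq lincomb al labels c | c <- codes].
Proof.
move=> al0; split=> [[c [/mapP[x cx /mkseq_inj e] ->]]|/mapP[x cx ->]].
  by apply/mapP; exists x => //; rewrite (lincombE _ _ al0); apply: eq_vec.
by exists (fun j => (code_coef labels x j)%:Z); split; [exact: map_f|rewrite -lincombE].
Qed.

Local Notation checked D n cs :=
  (bonds_comp D n && closed_codes (cmat_comp D) n cs).

Lemma check_f : [&& checked (diagram_f 5) 5 (string_codes 5 labels_f codes_f1),
  checked (diagram_f 6) 6 (string_codes 6 labels_f (codes_f1 ++ codes_f2)) &
  checked (diagram_f 7) 7 (string_codes 7 labels_f (codes_f1 ++ codes_f2 ++ codes_f3))].
Proof. by vm_compute. Qed.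

Lemma check_g : [&& checked (diagram_g 5) 5 (string_codes 5 labels_g codes_g1),
  checked (diagram_g 6) 6 (string_codes 6 labels_g (codes_g1 ++ codes_g2)) &
  checked (diagram_g 7) 7 (string_codes 7 labels_g (codes_g1 ++ codes_g2 ++ codes_g3))].
Proof. by vm_compute. Qed.

Lemma check_h : checked ([:: (0, 6, 1); (3, 1, 1); (2, 4, 1)]%N ++ chain 3 3) 6
  (string_codes 6 labels_h codes_h).
Proof. by vm_compute. Qed.

Lemma check_j : checked ([:: (0, 7, 1); (3, 1, 1); (2, 4, 1)]%N ++ chain 3 4) 7
  (string_codes 7 labels_g codes_j).
Proof. by vm_compute. Qed.

Lemma check_k : checked [:: (0, 1, 1); (1, 2, 2); (2, 3, 1)]%N 3
  (full_codes 3 [:: 0; 1; 2; 3]%N codes_k).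
Proof. by vm_compute. Qed.

Lemma check_l : checked [:: (3, 2, 1); (2, 1, 2); (1, 0, 1)]%N 3
  (full_codes 3 [:: 3; 2; 1; 0]%N codes_l).
Proof. by vm_compute. Qed.

End FiniteLists.

(** * The families as sets of vectors *)

Section FamilyStrings.
Context {R : realType} {V : vectType R}.
Implicit Types (al : nat -> V) (g : V).

Lemma in_familyE (T : Type) (D : T -> Prop) F N al g :
  (exists c, in_family D F N c /\ g = vec N al c) <-> exists2 t, D t & g = vec N al (F t).
Proof.
split=> [[c [[t Dt e] ->]]|[t Dt ->]]; first by exists t => //; exact: eq_vec.
by exists (F t); split=> //; exists t.
Qed.

Lemma vec_interval N al lo hi : (hi <= N.+1)%N ->
  vec N al (fun j => (lo <= j < hi)%N%:Z) = \sum_(lo <= j < hi) al j.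
Proof.
move=> hN; rewrite /vec -(big_mkord xpredT (fun j => al j *~ (lo <= j < hi)%N%:Z)).
rewrite (big_nat_widen _ _ _ _ _ hN) (big_nat_widenl _ _ _ _ _ (leq0n lo)) [RHS]big_mkcond.
by apply: eq_bigr => j _ /=; rewrite andbC; case: (_ && _).
Qed.

Lemma vec_step N al l : (l <= N)%N -> vec N al (step l) = al 0%N + \sum_(1 <= j < l.+1) al j.
Proof.
move=> lN; rewrite -(@big_ltn _ _ _ 0%N l.+1) // -(@vec_interval N) //.
Qed.

Lemma sum_rev al n p k : (k <= n)%N -> (p <= k)%N ->
  \sum_(p <= j < k.+1) al (n - j)%N = \sum_(n - k <= j < (n - p).+1) al j.
Proof.
move=> kn pk; rewrite big_nat_rev -[p in LHS]add0n big_addn -[(n - k)%N in RHS]add0n big_addn.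
have -> : ((n - p).+1 - (n - k) = k.+1 - p)%N by lia.
by apply: eq_big_nat => i ik; congr al; lia.
Qed.

Lemma string_aE N al g :
  (exists c, in_family (fun l => (l <= N)%N) step N c /\ g = vec N al c) <-> string_a N al g.
Proof.
rewrite in_familyE; split=> [[l lN ->]|[->|[l lN ->]]].
- rewrite vec_step //; have [->|l0] := posnP l; last by right; exists l; rewrite ?l0.
  by left; rewrite big_geq //= addr0.
- by exists 0%N => //; rewrite vec_step // big_geq // addr0.
- by case/andP: lN => _ lN; exists l => //; rewrite vec_step.
Qed.

Lemma string_bE N al g :
  (exists c, in_family (dom_b N) fam_b N c /\ g = vec N al c) <-> string_b N al g.
Proof.
have E l m : (m <= l)%N -> (l <= N)%N ->
    vec N al (fam_b (l, m)) = al 0%N + \sum_(1 <= j < l.+1) al j + \sum_(1 <= j < m.+1) al j.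
  by move=> ml lN; rewrite vecD vec_step // -(@vec_interval N al 1 m.+1) //; lia.
rewrite in_familyE; split=> [[[l m] /andP[/= ml lN] ->]|].
  rewrite E //; have [m0|m0] := posnP m; last by right; exists l, m; split=> //; lia.
  rewrite m0 [X in _ + X]big_geq // addr0; left.
  have [->|l0] := posnP l; last by right; exists l; rewrite ?l0.
  by left; rewrite big_geq //= addr0.
move=> [[->|[l lN ->]]|[l [m [lN ml ->]]]].
- by exists (0%N, 0%N) => //; rewrite E // !big_geq // !addr0.
- exists (l, 0%N); first by rewrite /dom_b /=; lia.
  by rewrite E ?[X in _ = _ + X]big_geq ?addr0 //; lia.
- exists (l, m); first by rewrite /dom_b /=; lia.
  by rewrite E //; lia.
Qed.

Lemma string_cE N al g : (1 <= N)%N ->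
  (exists c, in_family (dom_c N) fam_c N c /\ g = vec N al c) <-> string_c N al g.
Proof.
move=> N1; have E l s : (l <= N)%N ->
    vec N al (fam_c (l, s)) = al 0%N + \sum_(1 <= j < l.+1) al j + \sum_(s <= j < N.+1) al j.
  move=> lN; rewrite -(vec_step al lN) -(@vec_interval N al s) // -vecD; apply: eq_vec => j jN.
  by rewrite /fam_c /= ltnS jN andbT.
rewrite in_familyE; split=> [[[l s] /andP[/andP[/= lN sN] ls] ->]|].
  rewrite E //; have [s0|s0] := eqVneq s N.+1.
    rewrite s0 [X in _ + X]big_geq // addr0; left.
    have [->|l0] := posnP l; last by right; exists l; rewrite ?l0.
    by left; rewrite big_geq //= addr0.
  right; exists (N - s)%N; first by lia.
  have -> : l = N by lia.
  by rewrite sum_rev ?subn0 ?subKn //; lia.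
move=> [[->|[l lN ->]]|[k kN ->]].
- exists (0%N, N.+1); first by rewrite /dom_c /=; lia.
  by rewrite E // !big_geq // !addr0.
- exists (l, N.+1); first by rewrite /dom_c /=; lia.
  by rewrite E ?[X in _ = _ + X]big_geq ?addr0 //; lia.
- exists (N, N - k)%N; first by rewrite /dom_c /=; lia.
  by rewrite E // sum_rev ?subn0 //; lia.
Qed.

Lemma string_dE N al g : (2 <= N)%N ->
  (exists c, in_family (dom_d N) (fam_d N) N c /\ g = vec N al c) <-> string_d N al g.
Proof.
move=> N1; have E l s : (l <= N)%N ->
    vec N al (fam_d N (l, s)) = al 0%N + \sum_(1 <= j < l.+1) al j + \sum_(s <= j < N) al j.
  by move=> lN; rewrite -(vec_step al lN) -(@vec_interval N al s) // -vecD; apply: eq_vec.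
have e1 : (N - 1).+1 = N by lia.
rewrite in_familyE; split=> [[[l s] /andP[/andP[/= lN sN] ls] ->]|].
  rewrite E //; have [s0|s0] := eqVneq s N.
    rewrite s0 [X in _ + X]big_geq // addr0; left.
    have [->|l0] := posnP l; last by right; exists l; rewrite ?l0.
    by left; rewrite big_geq //= addr0.
  right; exists (N - s)%N; first by lia.
  have -> : l = N by lia.
  by rewrite sum_rev ?subKn ?e1 //; lia.
move=> [[->|[l lN ->]]|[k kN ->]].
- exists (0%N, N); first by rewrite /dom_d /=; lia.
  by rewrite E // !big_geq // !addr0.
- exists (l, N); first by rewrite /dom_d /=; lia.
  by rewrite E ?[X in _ = _ + X]big_geq ?addr0 //; lia.
- exists (N, N - k)%N; first by rewrite /dom_d /=; lia.
  by rewrite E // sum_rev ?e1 //; lia.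
Qed.

Lemma string_eE N al g : (3 <= N)%N ->
  (exists c, in_family (dom_e N) (fam_e N) N c /\ g = vec N al c) <-> string_e N al g.
Proof.
move=> N1; have E l s : (l <= N)%N -> vec N al (fam_e N (l, s, false)) =
    al 0%N + \sum_(1 <= j < l.+1) al j + \sum_(s <= j < N.-1) al j.
  move=> lN; rewrite -(vec_step al lN) -(@vec_interval N al s) ?(leqW (leq_pred _)) // -vecD.
  by apply: eq_vec => j jN; rewrite /fam_e /= subr0.
have EX : vec N al (fam_e N (N, N.-1, true)) =
    al 0%N + \sum_(1 <= i < N.+1 | i != N.-1) al i.
  rewrite /vec big_ord_recl; congr (_ + _).
    have -> : fam_e N (N, N.-1, true) 0 = 1 by rewrite /fam_e /step /=; lia.
    by [].
  rewrite big_add1 /= big_mkord [RHS]big_mkcond; apply: eq_bigr => j _.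
  have := ltn_ord j; rewrite /fam_e /step /= => jN; rewrite jN.
  have -> : (N.-1 <= j.+1 < N.-1)%N = false by lia.
  by rewrite addr0; case: eqP.
have e2 : (N - 2).+1 = N.-1 by lia.
rewrite in_familyE; split=> [[[[l s] b] /and4P[/= lN sN ls bb] ->]|].
  case: b bb => /= bb.
    have [-> ->] : l = N /\ s = N.-1 by lia.
    by rewrite EX; left; left; right.
  rewrite E //; have [s0|s0] := eqVneq s N.-1.
    rewrite s0 [X in _ + X]big_geq // addr0; left.
    have [->|l0] := posnP l; last by right; exists l; rewrite ?l0.
    by left; left; rewrite big_geq //= addr0.
  right; exists (N - s)%N; first by lia.
  have -> : l = N by lia.
  by rewrite sum_rev ?subKn ?e2 //; lia.
move=> [[[->|->]|[l lN ->]]|[k kN ->]].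
- exists (0%N, N.-1, false); first by rewrite /dom_e /=; lia.
  by rewrite E // !big_geq // !addr0.
- exists (N, N.-1, true); first by rewrite /dom_e /=; lia.
  by rewrite EX.
- exists (l, N.-1, false); first by rewrite /dom_e /=; lia.
  by rewrite E ?[X in _ = _ + X]big_geq ?addr0 //; lia.
- exists (N, N - k, false)%N; first by rewrite /dom_e /=; lia.
  by rewrite E // sum_rev ?e2 //; lia.
Qed.

End FamilyStrings.

(** * The rows of the tables *)

Section Rows.
Implicit Types (N k j : nat).

(** The diagrams of the rows of the first table, with lam at the node 0. *)
Definition diagram_AB N : diagram := (0, 1, 2)%N :: chain 1 N.-1.
Definition diagram_AC N : diagram := (1, 0, 2)%N :: chain 1 N.-1.
Definition diagram_BB N : diagram := rcons (chain 0 N.-1) (N, N.-1, 2%N).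
Definition diagram_CC N : diagram := rcons (chain 0 N.-1) (N.-1, N, 2%N).
Definition diagram_DD N : diagram :=
  chain 0 N.-2 ++ [:: (N.-2, N.-1, 1%N); (N.-2, N, 1%N)].

Lemma mem_AB N i j m : ((i, j, m.+2) \in diagram_AB N) = (i == 0) && (j == 1) && (m == 0).
Proof. by rewrite inE mem_chain orbF !xpair_eqE. Qed.
Lemma mem_AC N i j m : ((i, j, m.+2) \in diagram_AC N) = (i == 1) && (j == 0) && (m == 0).
Proof. by rewrite inE mem_chain orbF !xpair_eqE. Qed.
Lemma mem_BB N i j m : ((i, j, m.+2) \in diagram_BB N) = (i == N) && (j == N.-1) && (m == 0).
Proof. by rewrite mem_rcons inE mem_chain orbF !xpair_eqE. Qed.
Lemma mem_CC N i j m : ((i, j, m.+2) \in diagram_CC N) = (i == N.-1) && (j == N) && (m == 0).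
Proof. by rewrite mem_rcons inE mem_chain orbF !xpair_eqE. Qed.
Lemma mem_DD N i j m : ((i, j, m.+2) \in diagram_DD N) = false.
Proof. by rewrite mem_cat mem_chain !inE !xpair_eqE /= !andbF. Qed.

Lemma mult_AB N i j : mult (diagram_AB N) i j =
  ((if (i == 0) && (j == 1) || (i == 1) && (j == 0) then 2 else 0) +
   ((j == i.+1) && (1 <= i < 1 + N.-1) || (i == j.+1) && (1 <= j < 1 + N.-1)))%N.
Proof. by rewrite mult_cons mult_chain /= !xpair_eqE; congr ((if _ then _ else _) + _)%N; lia. Qed.
Lemma mult_AC N i j : mult (diagram_AC N) i j =
  ((if (i == 0) && (j == 1) || (i == 1) && (j == 0) then 2 else 0) +
   ((j == i.+1) && (1 <= i < 1 + N.-1) || (i == j.+1) && (1 <= j < 1 + N.-1)))%N.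
Proof. by rewrite mult_cons mult_chain /= !xpair_eqE; congr ((if _ then _ else _) + _)%N; lia. Qed.
Lemma mult_BB N i j : mult (diagram_BB N) i j =
  (((j == i.+1) && (i < N.-1) || (i == j.+1) && (j < N.-1)) +
   if (i == N) && (j == N.-1) || (i == N.-1) && (j == N) then 2 else 0)%N.
Proof.
by rewrite mult_rcons mult_chain /= !xpair_eqE; congr (_ + (if _ then _ else _))%N; lia.
Qed.
Lemma mult_CC N i j : mult (diagram_CC N) i j =
  (((j == i.+1) && (i < N.-1) || (i == j.+1) && (j < N.-1)) +
   if (i == N) && (j == N.-1) || (i == N.-1) && (j == N) then 2 else 0)%N.
Proof.
by rewrite mult_rcons mult_chain /= !xpair_eqE; congr (_ + (if _ then _ else _))%N; lia.
Qed.
Lemma mult_DD N i j : mult (diagram_DD N) i j =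
  (((j == i.+1) && (i < N.-2) || (i == j.+1) && (j < N.-2)) +
   ((if (i == N.-2) && (j == N.-1) || (i == N.-1) && (j == N.-2) then 1 else 0) +
    (if (i == N.-2) && (j == N) || (i == N) && (j == N.-2) then 1 else 0)))%N.
Proof.
rewrite mult_cat mult_chain !mult_cons mult_nil /= !xpair_eqE addn0.
by congr (_ + ((if _ then _ else _) + (if _ then _ else _)))%N; lia.
Qed.

Lemma bonds_chain N : simple_bonds (chain 0 N) N.
Proof. by move=> i j iN jN ij; rewrite mult_chain; lia. Qed.
Lemma bonds_AB N : (1 <= N)%N -> simple_bonds (diagram_AB N) N.
Proof.
move=> N1 i j iN jN ij; rewrite mult_AB !mem_AB; case: ifP => h; last by lia.
by split; [lia|move=> _; lia].
Qed.
Lemma bonds_AC N : (1 <= N)%N -> simple_bonds (diagram_AC N) N.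
Proof.
move=> N1 i j iN jN ij; rewrite mult_AC !mem_AC; case: ifP => h; last by lia.
by split; [lia|move=> _; lia].
Qed.
Lemma bonds_BB N : simple_bonds (diagram_BB N) N.
Proof.
move=> i j iN jN ij; rewrite mult_BB !mem_BB; case: ifP => h; last by lia.
by split; [lia|move=> _; lia].
Qed.
Lemma bonds_CC N : simple_bonds (diagram_CC N) N.
Proof.
move=> i j iN jN ij; rewrite mult_CC !mem_CC; case: ifP => h; last by lia.
by split; [lia|move=> _; lia].
Qed.
Lemma bonds_DD N : (3 <= N)%N -> simple_bonds (diagram_DD N) N.
Proof. by move=> N3 i j iN jN ij; rewrite mult_DD; do 2 case: ifP => ?; lia. Qed.

Lemma cmat_chain N k j : (k <= N)%N -> (j <= N)%N ->
  cmat (chain 0 N) k j = chain_mat (fun _ => 1) (fun _ => 1) k j.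
Proof.
move=> kN jN; rewrite /cmat /chain_mat mem_chain mult_chain eq_sym.
by do ![case: eqP => ? //]; lia.
Qed.

Lemma cmat_AB N k j : (1 <= k <= N)%N -> (j <= N)%N ->
  cmat (diagram_AB N) k j = chain_mat (fun _ => 1) (fun _ => 1) k j.
Proof.
move=> /andP[k1 kN] jN; rewrite /cmat /chain_mat mem_AB mult_AB eq_sym.
case: (j =P k) => // jk; case: (k =P 0%N) => [|k0] /=; first lia.
case: ifP => h; case: (j =P k.+1) => // h1; case: (k =P j.+1) => // h2; lia.
Qed.

Lemma cmat_AC N k j : (1 <= k <= N)%N -> (j <= N)%N ->
  cmat (diagram_AC N) k j = chain_mat (fun _ => 1) (fun k => if k == 1%N then 2 else 1) k j.
Proof.
move=> /andP[k1 kN] jN; rewrite /cmat /chain_mat mem_AC mult_AC eq_sym andbT.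
case: (j =P k) => // jk; case: ifP => h; case: ifP => h0;
  case: (j =P k.+1) => // h1; case: (k =P j.+1) => // h2; case: (k =P 1%N) => // h3; lia.
Qed.

Lemma cmat_BB N k j : (1 <= k <= N)%N -> (j <= N)%N ->
  cmat (diagram_BB N) k j = chain_mat (fun _ => 1) (fun k => if k == N then 2 else 1) k j.
Proof.
move=> /andP[k1 kN] jN; rewrite /cmat /chain_mat mem_BB mult_BB eq_sym andbT.
case: (j =P k) => // jk; case: ifP => h; case: ifP => h0;
  case: (j =P k.+1) => // h1; case: (k =P j.+1) => // h2; case: (k =P N) => // h3; lia.
Qed.

Lemma cmat_CC N k j : (1 <= k <= N)%N -> (j <= N)%N ->
  cmat (diagram_CC N) k j = chain_mat (fun k => if k == N.-1 then 2 else 1) (fun _ => 1) k j.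
Proof.
move=> /andP[k1 kN] jN; rewrite /cmat /chain_mat mem_CC mult_CC eq_sym andbT.
case: (j =P k) => // jk; case: ifP => h; case: ifP => h0;
  case: (j =P k.+1) => // h1; case: (k =P j.+1) => // h2; case: (k =P N.-1) => // h3; lia.
Qed.

Lemma cmat_DD N k j : (3 <= N)%N -> (k <= N)%N -> (j <= N)%N ->
  cmat (diagram_DD N) k j = fork_mat N k j.
Proof.
move=> N3 kN jN; rewrite /cmat /fork_mat mem_DD mult_DD eq_sym.
by case: (j =P k) => // jk; compare_nats.
Qed.

Context {R : realType} {V : vectType R} (ip : {dot V for @idfun R}).
Context (S : set V) (s : seq V) (lam : V) (low : lowest ip S s lam).
Context (obt : forall i j, (i <= size s)%N -> (j <= size s)%N -> i != j ->
  ip (lam :: s)`_i (lam :: s)`_j <= 0).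
Local Notation al := (nth 0 (lam :: s)).

(** The string depends on the diagram only. *)
Lemma diagram_string D L : has_diagram ip (lam :: s) D -> simple_bonds D (size s) ->
  closed_list (cmat D) (size s) L ->
  forall g, (S g /\ ispan s (g - lam)) <-> exists c, L c /\ g = vec (size s) al c.
Proof.
move=> hD wf cl; apply: (closed_list_string low _ _ cl).
  move=> k j /andP[_ kN] jN; case: (low) => rS _ lS _.
  exact: (@cartan_cmat _ _ ip S (lam :: s) D (size s) rS erefl lS obt hD wf k j kN jN).
by move=> k _; rewrite /cmat eqxx.
Qed.

Lemma classical_row X Y D F : @classical_table R V (size s) X Y D F ->
  has_diagram ip (lam :: s) D -> forall g, (S g /\ ispan s (g - lam)) <-> F al g.
Proof.
move=> row; case: row => n1 hD g.
- rewrite -string_aE; apply: (diagram_string hD); first exact: bonds_chain.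
  apply: closed_list_ext (closed_a _) => k j /andP[_ kN] jN; exact/esym/cmat_chain.
- rewrite -string_aE; apply: (diagram_string hD); first exact: bonds_AB.
  by apply: closed_list_ext (closed_a _) => k j kN jN; apply/esym/cmat_AB.
- rewrite -string_aE; apply: (diagram_string hD); first exact: bonds_AB.
  by apply: closed_list_ext (closed_a _) => k j kN jN; apply/esym/cmat_AB.
- rewrite -string_bE; apply: (diagram_string hD); first exact: bonds_AC.
  by apply: closed_list_ext (closed_b _) => k j kN jN; apply/esym/cmat_AC.
- rewrite -string_cE; last exact: ltnW.
  apply: (diagram_string hD); first exact: bonds_BB.
  by apply: closed_list_ext (closed_c (ltnW n1)) => k j kN jN; apply/esym/cmat_BB.
- rewrite -string_cE //; apply: (diagram_string hD); first exact: bonds_BB.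
  by apply: closed_list_ext (closed_c n1) => k j kN jN; apply/esym/cmat_BB.
- rewrite -string_dE //; apply: (diagram_string hD); first exact: bonds_CC.
  by apply: closed_list_ext (closed_d n1) => k j kN jN; apply/esym/cmat_CC.
- rewrite -string_eE //; apply: (diagram_string hD); first exact: bonds_DD.
  apply: closed_list_ext (closed_e n1) => k j /andP[_ kN] jN; exact/esym/cmat_DD.
Qed.

Lemma coded_row D L : has_diagram ip (lam :: s) D ->
  bonds_comp D (size s) && closed_codes (cmat_comp D) (size s) L ->
  forall g, (S g /\ ispan s (g - lam)) <->
    exists c, mkseq c (size s).+1 \in L /\ g = vec (size s) al c.
Proof.
move=> hD /andP[/bonds_compP wf /closed_codesP cl]; apply: (diagram_string hD wf).
by apply: closed_list_ext cl => k j _ _; rewrite cmat_compE.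
Qed.

Lemma exceptional_row X Y D F : @exceptional_table R V (size s) X Y D F ->
  has_diagram ip (lam :: s) D -> forall g, (S g /\ ispan s (g - lam)) <-> F al g.
Proof.
have al0 n : size s = n -> forall j, (n < j)%N -> al j = 0.
  by move=> sn j nj; rewrite nth_default //= sn.
have coded n labels codes D' : size s = n -> has_diagram ip (lam :: s) D' ->
    bonds_comp D' n && closed_codes (cmat_comp D') n (string_codes n labels codes) ->
    forall g, (S g /\ ispan s (g - lam)) <-> coded_string labels codes al g.
  move=> sn hD; rewrite -sn => chk g; apply: iff_trans (coded_row hD chk g) _.
  exact: string_codesP (al0 _ erefl).
have full n labels codes D' : size s = n -> has_diagram ip (lam :: s) D' ->
    bonds_comp D' n && closed_codes (cmat_comp D') n (full_codes n labels codes) ->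
    forall g, (S g /\ ispan s (g - lam)) <-> [set` [seq lincomb al labels c | c <- codes]] g.
  move=> sn hD; rewrite -sn => chk g; apply: iff_trans (coded_row hD chk g) _.
  exact: full_codesP (al0 _ erefl).
have [f5 f6 f7] := and3P check_f; have [g5 g6 g7] := and3P check_g.
case=> sn hD g; rewrite ?sn in hD.
- exact: coded sn hD f5 g.
- exact: coded sn hD f6 g.
- exact: coded sn hD f7 g.
- exact: coded sn hD g5 g.
- exact: coded sn hD g6 g.
- exact: coded sn hD g7 g.
- exact: coded sn hD check_h g.
- exact: coded sn hD check_j g.
- exact: full sn hD check_k g.
- exact: full sn hD check_l g.
Qed.

End Rows.

(** * Relabelling diagrams *)

Section Relabelling.
Implicit Types (D : diagram) (idx : seq nat).

(** The node i of D corresponds to the node nth 0 idx i of D0. *)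
Definition relabels D D0 idx : Prop :=
  (forall i j, (i < size idx)%N -> (j < size idx)%N -> i != j ->
     mult D i j = mult D0 (nth 0%N idx i) (nth 0%N idx j)) /\
  (forall i j k, (i, j, k) \in D -> (1 < k)%N ->
     [/\ (i < size idx)%N, (j < size idx)%N & (nth 0%N idx i, nth 0%N idx j, k) \in D0]).

Definition relabels_comp D D0 idx : bool :=
  all (fun i => all (fun j => (i == j) ||
      (mult_comp D i j == mult_comp D0 (nth 0%N idx i) (nth 0%N idx j)))
    (iota 0 (size idx))) (iota 0 (size idx)) &&
  all (fun b => (1 < b.2)%N ==> [&& (b.1.1 < size idx)%N, (b.1.2 < size idx)%N &
    (nth 0%N idx b.1.1, nth 0%N idx b.1.2, b.2) \in D0]) D.

Lemma relabels_compP D D0 idx : relabels_comp D D0 idx -> relabels D D0 idx.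
Proof.
move=> /andP[/allP H1 /allP H2]; split=> [i j iN jN ij|i j k ijk k1].
  have := H1 i; rewrite mem_iota => /(_ iN)/allP/(_ j); rewrite mem_iota => /(_ jN).
  by rewrite (negbTE ij) !mult_compE => /eqP.
by have := H2 _ ijk; rewrite k1 => /and3P[].
Qed.

Context {R : realType} {V : vectType R} (ip : {dot V for @idfun R}).

Lemma relabels_diagram (t : seq V) D D0 idx : has_diagram ip t D0 ->
  uniq idx -> {subset idx <= iota 0 (size t)} -> relabels D D0 idx ->
  has_diagram ip [seq t`_i | i <- idx] D.
Proof.
move=> [hE hL] ui sub [rE rL].
have lt i : (i < size idx)%N -> (nth 0%N idx i < size t)%N.
  by move=> /(mem_nth 0%N)/sub; rewrite mem_iota.
split=> [i j|i j k ijk k1]; rewrite ?size_map.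
  move=> iN jN ij; rewrite !(nth_map 0%N) // rE // hE ?lt //.
  by rewrite nth_uniq.
have [iN jN ijk0] := rL i j k ijk k1.
by rewrite !(nth_map 0%N) //; apply: hL ijk0 k1.
Qed.

Lemma map_nth_set (t : seq V) idx : uniq t -> uniq idx -> {subset idx <= iota 0 (size t)} ->
  uniq [seq t`_i | i <- idx].
Proof.
move=> ut ui sub; rewrite map_inj_in_uniq // => i j /sub; rewrite mem_iota /= => iN /sub.
by rewrite mem_iota /= => jN /eqP; rewrite nth_uniq // => /eqP.
Qed.

(** A connected set of nodes lies on one side of every cut. *)
Lemma connected_cut (Phi : set V) (t : seq V) D0 p (chi : nat -> bool) : uniq t ->
  has_diagram ip t D0 -> connected ip Phi ->
  (forall a, Phi a -> exists2 i, (i < size t)%N && (i != p) & a = t`_i) ->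
  (forall i, (i < size t)%N -> i != p -> Phi t`_i) ->
  (forall i j, (i < size t)%N -> (j < size t)%N -> i != p -> j != p -> i != j ->
     mult D0 i j != 0%N -> chi i = chi j) ->
  forall i j, (i < size t)%N -> (j < size t)%N -> i != p -> j != p -> chi i = chi j.
Proof.
move=> ut [hE _] con Phit tPhi cut i j iN jN ip_ jp.
have [q [pq lq qPhi]] := con _ _ (tPhi i iN ip_) (tPhi j jN jp).
elim: q i iN ip_ pq lq qPhi => [|b q IH] i iN ip_ /=.
  by move=> _ /eqP; rewrite nth_uniq // => /eqP ->.
move=> /andP[ib pq] lq qPhi.
have [k /andP[kN kp] eb] := Phit b (qPhi b (mem_head _ _)).
have -> : chi i = chi k.
  have [->//|ik] := eqVneq i k; apply: cut => //.
  by move: ib; rewrite /joined eb hE // pnatr_eq0.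
rewrite eb in pq lq; apply: IH pq lq _ => //.
by move=> x qx; apply: qPhi; rewrite /= inE qx orbT.
Qed.

Section Labels.
Context (S Phi : set V) (lam : V) (t : seq V) (p : nat) (idx : seq nat).
Context (ut : uniq t) (et : [set` t] = lam |` Phi) (nlam : ~ Phi lam).
Context (pt : (p < size t)%N) (lamp : lam = t`_p).
Context (pe : perm_eq (p :: idx) (iota 0 (size t))).

Let sub1 : {subset p :: idx <= iota 0 (size t)}.
Proof. by move=> i; rewrite (perm_mem pe). Qed.
Let sub : {subset idx <= iota 0 (size t)}.
Proof. by move=> i ii; apply: sub1; rewrite inE ii orbT. Qed.
Let upi : uniq (p :: idx).
Proof. by rewrite (perm_uniq pe) iota_uniq. Qed.

Lemma label_set l : perm_eq l idx -> [set` [seq t`_i | i <- l]] = Phi.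
Proof.
move=> pl; apply/seteqP; split=> a /=.
  move=> /mapP[i il ->]; have ii : i \in idx by rewrite -(perm_mem pl).
  have : [set` t] t`_i by apply: mem_nth; have := sub ii; rewrite mem_iota.
  rewrite et => -[e|//]; move: (ii); suff -> : i = p by case/andP: upi => /negbTE ->.
  have := sub ii; rewrite mem_iota /= => iN.
  by apply/eqP; rewrite -(nth_uniq 0 iN pt ut) -lamp e.
move=> Pa; have ta : a \in t by have : [set` t] a by rewrite et; right.
apply/mapP; exists (index a t); last by rewrite nth_index.
rewrite (perm_mem pl); have : index a t \in p :: idx.
  by rewrite (perm_mem pe) mem_iota /= index_mem.
rewrite inE => /orP[/eqP e|//]; case: nlam.
by rewrite lamp -e nth_index.
Qed.

Lemma type_sub D0 idx2 X : has_diagram ip t D0 -> perm_eq idx2 idx -> size idx2 = rank X ->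
  relabels (type_diagram X) D0 idx2 ->
  (reduced (sub_roots S Phi) <-> if X is TBC _ then False else True) ->
  has_type ip (sub_roots S Phi) Phi X.
Proof.
move=> hD pe2 sX rX red; have u2 : uniq idx2.
  by rewrite (perm_uniq pe2); case/andP: upi.
have sub2 : {subset idx2 <= iota 0 (size t)} by move=> i; rewrite (perm_mem pe2); apply: sub.
split=> //; exists [seq t`_i | i <- idx2]; rewrite size_map; split=> //.
- exact: map_nth_set.
- exact: label_set.
- exact: relabels_diagram hD u2 sub2 rX.
Qed.

(** A row applies as soon as its diagrams match the diagram of the whole system, in which lam is the
    node p, up to relabelling. *)
Lemma row_intro (T : table (R := R) (V := V)) D0 idx2 X Y D F :
  has_diagram ip t D0 -> has_type ip (sub_roots S (lam |` Phi)) (lam |` Phi) Y ->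
  perm_eq idx2 idx -> T (size idx) X Y D F -> size idx2 = rank X ->
  relabels D D0 (p :: idx) -> relabels (type_diagram X) D0 idx2 ->
  (reduced (sub_roots S Phi) <-> if X is TBC _ then False else True) ->
  exists X Y D F s, T (size s) X Y D F /\ row_applies ip S Phi lam X Y D s.
Proof.
move=> hD hY pe2 row sX rD rX red.
exists X, Y, D, F, [seq t`_i | i <- idx]; rewrite size_map; split=> //; split=> //.
- by apply: map_nth_set => //; case/andP: upi.
- exact: label_set.
- rewrite lamp -/(map (fun i => t`_i) (p :: idx)).
  exact: (relabels_diagram hD upi sub1 rD).
- exact: type_sub hD pe2 sX rX red.
Qed.

End Labels.

Lemma type_relabel (S B : set V) (t : seq V) D0 idx X : uniq t -> [set` t] = B ->
  has_diagram ip t D0 -> perm_eq idx (iota 0 (size t)) -> size idx = rank X ->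
  relabels (type_diagram X) D0 idx ->
  (reduced S <-> if X is TBC _ then False else True) -> has_type ip S B X.
Proof.
move=> ut et hD pe sX rX red; split=> //; exists [seq t`_i | i <- idx].
have sub : {subset idx <= iota 0 (size t)} by move=> i; rewrite (perm_mem pe).
have ui : uniq idx by rewrite (perm_uniq pe) iota_uniq.
rewrite size_map; split=> //; [exact: map_nth_set | | exact: relabels_diagram hD ui sub rX].
rewrite -et; apply/seteqP; split=> a /=.
  by move=> /mapP[i /sub]; rewrite mem_iota /= => iN ->; apply: mem_nth.
move=> ta; apply/mapP; exists (index a t); last by rewrite nth_index.
by rewrite (perm_mem pe) mem_iota /= index_mem.
Qed.

End Relabelling.

(** * Ends of diagrams *)

Section Leaves.
Implicit Types (D : diagram) (N n k p i j : nat).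

(** Removing the node p from a diagram with N nodes leaves a connected diagram. *)
Definition noncut D N p : Prop := forall chi : nat -> bool,
  (forall i j, (i < N)%N -> (j < N)%N -> i != p -> j != p -> i != j ->
     mult D i j != 0%N -> chi i = chi j) ->
  forall i j, (i < N)%N -> (j < N)%N -> i != p -> j != p -> chi i = chi j.

Definition cut_comp D N p (chi : pred nat) i j : bool :=
  all (fun i => all (fun j => [|| i == p, j == p, mult_comp D i j == 0 | chi i == chi j]%N)
    (iota 0 N)) (iota 0 N) &&
  [&& (i < N)%N, (j < N)%N, i != p, j != p & chi i != chi j].

Lemma cut_compP D N p chi i j : noncut D N p -> cut_comp D N p chi i j -> False.
Proof.
move=> nc /andP[/allP H /and5P[iN jN ip jp /eqP ne]]; apply: ne; apply: nc => // i' j' iN' jN' ip' jp' ij' m.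
have := H i'; rewrite mem_iota => /(_ iN')/allP/(_ j'); rewrite mem_iota => /(_ jN').
by rewrite (negbTE ip') (negbTE jp') -mult_compE (negbTE m) => /eqP.
Qed.

Lemma mult_TD k i j : mult (type_diagram (TD k.+3)) i j =
  (((j == i.+1) && (i < k.+1) || (i == j.+1) && (j < k.+1)) +
   if (i == k) && (j == k.+2) || (i == k.+2) && (j == k) then 1 else 0)%N.
Proof. by rewrite mult_rcons mult_chain /= !xpair_eqE; congr (_ + (if _ then _ else _))%N; lia. Qed.

(** An inner node of a path separates the nodes on its left from those on its right. *)
Lemma leaf_path D n p : (forall i j, (i <= n)%N -> (j <= n)%N -> mult D i j != 0%N -> (i <= j.+1)%N /\ (j <= i.+1)%N) ->
  (p <= n)%N -> noncut D n.+1 p -> p = 0%N \/ p = n.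
Proof.
move=> path pn nc; have [?|p0] := posnP p; first by left.
right; apply/eqP; apply: contraT => np; exfalso.
have : (p.-1 < p)%N = (p.+1 < p)%N.
  apply: (nc (fun i => i < p)%N); try lia.
  by move=> i j iN jN ip jp ij /(path i j iN jN)[? ?]; apply/idP/idP; lia.
by lia.
Qed.

Lemma leaf_TA n p : (p <= n)%N -> noncut (type_diagram (TA n.+1)) n.+1 p -> p = 0%N \/ p = n.
Proof. by apply: leaf_path => i j iN jN; rewrite mult_chain; lia. Qed.
Lemma leaf_TB k p : (p <= k.+1)%N -> noncut (type_diagram (TB k.+2)) k.+2 p -> p = 0%N \/ p = k.+1.
Proof. by apply: leaf_path => i j iN jN; rewrite (mult_BB k.+1); case: ifP; lia. Qed.
Lemma leaf_TC k p : (p <= k.+1)%N -> noncut (type_diagram (TC k.+2)) k.+2 p -> p = 0%N \/ p = k.+1.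
Proof. by apply: leaf_path => i j iN jN; rewrite (mult_CC k.+1); case: ifP; lia. Qed.
Lemma leaf_TD k p : (p <= k.+2)%N -> noncut (type_diagram (TD k.+3)) k.+3 p ->
  [\/ p = 0%N, p = k.+1 | p = k.+2] /\ (p = 0 -> 0 < k)%N.
Proof.
move=> pk nc; case: (ltnP p k.+1) => pk1; last first.
  have e : p = k.+1 \/ p = k.+2 by lia.
  by split; [case: e => ->; [apply: Or32 | apply: Or33] | lia].
have [p0|p0] := posnP p.
  split; first by apply: Or31.
  move=> _; apply: contraT => k0; exfalso.
  have : (1 == 1)%N = (2 == 1)%N.
    apply: (nc (fun i => i == 1)%N); try lia.
    by move=> i j iN jN ip jp ij; rewrite mult_TD; case: ifP => ? ?; apply/idP/idP; lia.
  by [].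
exfalso; have : (p.-1 < p)%N = (p.+1 < p)%N.
  apply: (nc (fun i => i < p)%N); try lia.
  by move=> i j iN jN ip jp ij; rewrite mult_TD; case: ifP => ? ?; apply/idP/idP; lia.
by lia.
Qed.

Lemma leaf_TE6 p : (p < 6)%N -> noncut (type_diagram (TE 6)) 6 p -> [\/ p = 0%N, p = 1%N | p = 5%N].
Proof.
case: p => [|[|[|[|[|[|//]]]]]] _ nc; [exact: Or31|exact: Or32| | | |exact: Or33]; exfalso.
- by apply: (@cut_compP _ _ _ (pred1 0%N) 0%N 1%N nc); vm_compute.
- by apply: (@cut_compP _ _ _ (pred1 1%N) 1%N 0%N nc); vm_compute.
- by apply: (@cut_compP _ _ _ (fun i => i < 4)%N 0%N 5%N nc); vm_compute.
Qed.

Lemma leaf_TE7 p : (p < 7)%N -> noncut (type_diagram (TE 7)) 7 p -> [\/ p = 0%N, p = 1%N | p = 6%N].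
Proof.
case: p => [|[|[|[|[|[|[|//]]]]]]] _ nc; [exact: Or31|exact: Or32| | | | |exact: Or33]; exfalso.
- by apply: (@cut_compP _ _ _ (pred1 0%N) 0%N 1%N nc); vm_compute.
- by apply: (@cut_compP _ _ _ (pred1 1%N) 1%N 0%N nc); vm_compute.
- by apply: (@cut_compP _ _ _ (fun i => i < 4)%N 0%N 6%N nc); vm_compute.
- by apply: (@cut_compP _ _ _ (fun i => i < 5)%N 0%N 6%N nc); vm_compute.
Qed.

Lemma leaf_TE8 p : (p < 8)%N -> noncut (type_diagram (TE 8)) 8 p -> [\/ p = 0%N, p = 1%N | p = 7%N].
Proof.
case: p => [|[|[|[|[|[|[|[|//]]]]]]]] _ nc; [exact: Or31|exact: Or32| | | | | |exact: Or33]; exfalso.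
- by apply: (@cut_compP _ _ _ (pred1 0%N) 0%N 1%N nc); vm_compute.
- by apply: (@cut_compP _ _ _ (pred1 1%N) 1%N 0%N nc); vm_compute.
- by apply: (@cut_compP _ _ _ (fun i => i < 4)%N 0%N 7%N nc); vm_compute.
- by apply: (@cut_compP _ _ _ (fun i => i < 5)%N 0%N 7%N nc); vm_compute.
- by apply: (@cut_compP _ _ _ (fun i => i < 6)%N 0%N 7%N nc); vm_compute.
Qed.

Lemma leaf_TF4 p : (p < 4)%N -> noncut (type_diagram TF4) 4 p -> p = 0%N \/ p = 3%N.
Proof.
case: p => [|[|[|[|//]]]] _ nc; [by left| | |by right]; exfalso.
- by apply: (@cut_compP _ _ _ (pred1 0%N) 0%N 2%N nc); vm_compute.
- by apply: (@cut_compP _ _ _ (fun i => i < 2)%N 0%N 3%N nc); vm_compute.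
Qed.

Lemma relabels_map D D0 (sigma : nat -> nat) a n :
  (forall i j, (i < n)%N -> (j < n)%N -> i != j -> mult D i j = mult D0 (sigma (a + i)%N) (sigma (a + j)%N)) ->
  (forall i j k, (i, j, k) \in D -> (1 < k)%N ->
     [/\ (i < n)%N, (j < n)%N & (sigma (a + i)%N, sigma (a + j)%N, k) \in D0]) ->
  relabels D D0 [seq sigma i | i <- iota a n].
Proof.
move=> H1 H2; have nthE i : (i < n)%N -> nth 0%N [seq sigma i | i <- iota a n] i = sigma (a + i)%N.
  by move=> iN; rewrite (nth_map 0%N) ?size_iota // nth_iota.
split=> [i j|i j k ijk k1]; rewrite size_map size_iota.
  by move=> iN jN ij; rewrite !nthE // H1.
by have [iN jN m] := H2 i j k ijk k1; rewrite !nthE.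
Qed.

Lemma perm_reverse n : perm_eq [seq (n - i)%N | i <- iota 0 n.+1] (iota 0 n.+1).
Proof.
apply: uniq_perm; rewrite ?iota_uniq //.
  by rewrite map_inj_in_uniq ?iota_uniq // => i j; rewrite !mem_iota; lia.
move=> i; rewrite mem_iota; apply/mapP/idP => [[j]|iN]; first by rewrite mem_iota; lia.
by exists (n - i)%N; rewrite ?mem_iota; lia.
Qed.

Lemma mem_chain1 i j m a k : (i, j, m) \in chain a k -> m = 1%N.
Proof. by case/mapP => ? _ []. Qed.

(** In the relabellings by the identity lam is the node 0 of the whole system, in the reversed ones it
    is the last node; the lists that start at 1 label Phi alone. *)
Lemma relabels_A0 n : relabels (chain 0 n) (chain 0 n) [seq i | i <- iota 0 n.+1].
Proof. by apply: (relabels_map (sigma := id)) => // i j k /mem_chain1->. Qed.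
Lemma relabels_An n : relabels (chain 0 n) (chain 0 n) [seq (n - i)%N | i <- iota 0 n.+1].
Proof.
apply: (relabels_map (sigma := fun i => n - i)%N) => [i j iN jN ij|i j k /mem_chain1-> //].
by rewrite !mult_chain; lia.
Qed.
Lemma relabels_A1 n : relabels (chain 0 n.-1) (chain 0 n) [seq i | i <- iota 1 n].
Proof.
apply: (relabels_map (sigma := id)) => [i j iN jN ij|i j k /mem_chain1-> //].
by rewrite !mult_chain; lia.
Qed.
Lemma relabels_An1 n : relabels (chain 0 n.-1) (chain 0 n) [seq (n - i)%N | i <- iota 1 n].
Proof.
apply: (relabels_map (sigma := fun i => n - i)%N) => [i j iN jN ij|i j k /mem_chain1-> //].
by rewrite !mult_chain; lia.
Qed.
Lemma relabels_B0 n : relabels (diagram_BB n) (diagram_BB n) [seq i | i <- iota 0 n.+1].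
Proof.
apply: (relabels_map (sigma := id)) => // i j [|[|k]] // ijk _.
have := ijk; rewrite mem_BB => /andP[/andP[/eqP iE /eqP jE] _].
by split; [lia | lia | move: ijk; rewrite mem_BB].
Qed.
Lemma relabels_B1 n : (2 <= n)%N ->
  relabels (diagram_BB n.-1) (diagram_BB n) [seq i | i <- iota 1 n].
Proof.
move=> n2; apply: (relabels_map (sigma := id)) => [i j iN jN ij|i j [|[|k]] //].
  by rewrite !mult_BB; compare_nats.
by rewrite !mem_BB => /andP[/andP[/eqP -> /eqP ->] ->] _; split; lia.
Qed.
Lemma relabels_C0 n : relabels (diagram_CC n) (diagram_CC n) [seq i | i <- iota 0 n.+1].
Proof.
apply: (relabels_map (sigma := id)) => // i j [|[|k]] // ijk _.
have := ijk; rewrite mem_CC => /andP[/andP[/eqP iE /eqP jE] _].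
by split; [lia | lia | move: ijk; rewrite mem_CC].
Qed.
Lemma relabels_C1 n : (2 <= n)%N ->
  relabels (diagram_CC n.-1) (diagram_CC n) [seq i | i <- iota 1 n].
Proof.
move=> n2; apply: (relabels_map (sigma := id)) => [i j iN jN ij|i j [|[|k]] //].
  by rewrite !mult_CC; compare_nats.
by rewrite !mem_CC => /andP[/andP[/eqP -> /eqP ->] ->] _; split; lia.
Qed.
Lemma relabels_AB n : (1 <= n)%N ->
  relabels (diagram_AB n) (diagram_BB n) [seq (n - i)%N | i <- iota 0 n.+1].
Proof.
move=> n1; apply: (relabels_map (sigma := fun i => n - i)%N) => [i j iN jN ij|i j [|[|k]] //].
  by rewrite mult_AB mult_BB; compare_nats.
by rewrite mem_AB mem_BB => /andP[/andP[/eqP -> /eqP ->] ->] _; split; lia.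
Qed.
Lemma relabels_AC n : (1 <= n)%N ->
  relabels (diagram_AC n) (diagram_CC n) [seq (n - i)%N | i <- iota 0 n.+1].
Proof.
move=> n1; apply: (relabels_map (sigma := fun i => n - i)%N) => [i j iN jN ij|i j [|[|k]] //].
  by rewrite mult_AC mult_CC; compare_nats.
by rewrite mem_AC mem_CC => /andP[/andP[/eqP -> /eqP ->] ->] _; split; lia.
Qed.
Lemma relabels_AB1 n : (1 <= n)%N ->
  relabels (chain 0 n.-1) (diagram_BB n) [seq (n - i)%N | i <- iota 1 n].
Proof.
move=> n1; apply: (relabels_map (sigma := fun i => n - i)%N) => [i j iN jN ij|i j k /mem_chain1-> //].
by rewrite mult_chain mult_BB; compare_nats.
Qed.
Lemma relabels_AC1 n : (1 <= n)%N ->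
  relabels (chain 0 n.-1) (diagram_CC n) [seq (n - i)%N | i <- iota 1 n].
Proof.
move=> n1; apply: (relabels_map (sigma := fun i => n - i)%N) => [i j iN jN ij|i j k /mem_chain1-> //].
by rewrite mult_chain mult_CC; compare_nats.
Qed.
Lemma mem_TD k i j m : ((i, j, m.+2) \in type_diagram (TD k.+3)) = false.
Proof. by rewrite mem_rcons inE mem_chain !xpair_eqE /= !andbF. Qed.
Lemma relabels_D0 k : relabels (diagram_DD k.+2) (type_diagram (TD k.+3)) [seq i | i <- iota 0 k.+3].
Proof.
apply: (relabels_map (sigma := id)) => [i j iN jN ij|i j [|[|m]] //].
  by rewrite mult_DD mult_TD; compare_nats.
by rewrite mem_DD.
Qed.
Lemma relabels_D1 k : relabels (type_diagram (TD k.+3)) (type_diagram (TD k.+4)) [seq i | i <- iota 1 k.+3].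
Proof.
apply: (relabels_map (sigma := id)) => [i j iN jN ij|i j [|[|m]] //].
  by rewrite !mult_TD; compare_nats.
by rewrite mem_TD.
Qed.
(** What remains of the diagram of type D without one of its two short ends. *)
Lemma relabels_AD1 k : relabels (chain 0 k.+1) (type_diagram (TD k.+3))
  [seq (if i <= k then i else k.+2)%N | i <- iota 0 k.+2].
Proof.
apply: (relabels_map (sigma := fun i => if i <= k then i else k.+2)%N) => [i j iN jN ij|i j m /mem_chain1-> //].
by rewrite mult_chain mult_TD; compare_nats.
Qed.
Lemma relabels_AD2 k : relabels (chain 0 k.+1) (type_diagram (TD k.+3)) [seq i | i <- iota 0 k.+2].
Proof.
apply: (relabels_map (sigma := id)) => [i j iN jN ij|i j m /mem_chain1-> //].
by rewrite mult_chain mult_TD; compare_nats.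
Qed.

End Leaves.

(** * Doubled roots *)

Section Doubling.
Context {R : realType} {V : vectType R} (ip : {dot V for @idfun R}).
Local Notation A := (cartan ip).

(** Descent by simple reflections brings a pair b, 2 b of roots to a pair a, 2 a with a simple. *)
Lemma double_simple (S : set V) (f : seq V) b : is_roots ip S -> free f ->
  (forall a, a \in f -> S a) ->
  (forall d, S d -> ispan f d -> nspan f d \/ nspan f (- d)) ->
  S b -> S (b *+ 2) -> ispan f b -> exists2 a, a \in f & S (a *+ 2).
Proof.
move=> rS ff fS sgn.
have uf := free_uniq ff.
wlog nb : b / nspan f b.
  move=> H Sb S2b sb; have [nb|nb] := sgn b Sb sb; first exact: H nb Sb S2b sb.
  apply: (H (- b)) => //; [exact: (root_opp rS) | | exact: ispanN].
  by rewrite mulNrn; exact: (root_opp rS).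
have [N] : exists N : nat, ht f b < N%:R.
  have [h0|h0] := leP 0 (ht f b); last by exists 0%N.
  by exists (Num.bound (ht f b)); apply: archi_boundP.
elim: N b nb => [|N IH] b nb hN Sb S2b sb.
  by have := ht_ge0 ff nb; rewrite leNgt hN.
have [c ec] := nb; have b0 := root_neq0 rS Sb.
have [a [fa ca ab]] := acute_support ip b0 ec; have Sa := fS a fa.
have cE d : d \in f -> cf f d b = (c d)%:R by move=> fd; rewrite ec cf_nat.
have [/vlineP[k ek]|nab] := boolP (b \in <[a]>%VS).
  have ek' : k = (c a)%:R by rewrite -cE // ek cfZ cf_id // eqxx mulr1.
  exists a => //; rewrite ek ek' scaler_nat in Sb S2b.
  have := root_line rS Sa Sb; rewrite -mulrnA in S2b; have := root_line rS Sa S2b.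
  by case: (c a) ca S2b {Sb} => [|[|n]].
have [m em] := root_cartan rS Sa Sb.
have m0 : 0 < m by rewrite -(ltr0z R) -em cartan_gt0 // (root_neq0 rS).
pose b' := b - A a b *: a.
have Sb' : S b' by exact: root_refl.
have sb' : ispan f b'.
  rewrite /b' em scaler_int; apply: ispanB => //; apply: ispanMz; exact: ispan_id.
have nb' : nspan f b'.
  have [//|nN] := sgn b' Sb' sb'; exfalso.
  have [d [fd da cd]] : exists d, [/\ d \in f, d != a & (0 < c d)%N].
    apply: contrapT => H; move/negP: nab; apply; rewrite ec big_seq memv_suml // => d fd.
    have [->|da] := eqVneq d a; first by rewrite rpredMn // memv_line.
    have [->|cd] := posnP (c d); first by rewrite mem0v.
    by case: H; exists d.
  have := cf_nspan_ge0 ff nN fd; rewrite cfN cfB cfZ cE // cf_id // (negbTE da) mulr0 subr0.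
  by rewrite oppr_ge0 lern0; case: (c d) cd.
apply: (IH b') => //.
  rewrite htB htZ (ht_id ff fa) mulr1 em; move: hN; rewrite -natr1.
  have : (1 : R) <= m%:~R by rewrite ler1z; lia.
  by lra.
have := root_refl rS Sa S2b; rewrite -scaler_nat cartanZr -scalerA -scalerBr scaler_nat.
by [].
Qed.

(** If a and 2 a are roots then the Cartan numbers of a are even. *)
Lemma double_even (S : set V) a b : is_roots ip S -> S a -> S (a *+ 2) -> S b -> A a b <> -1.
Proof.
move=> rS Sa S2a Sb e; have [m] := root_cartan rS S2a Sb.
have ga := ip_gt0 ip (root_neq0 rS Sa).
have nza : ip a a != 0 by rewrite gt_eqF.
have -> : A (a *+ 2) b = A a b / 2.
  by rewrite /cartan -scaler_nat ipZr !ipZl; field.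
rewrite e => em; have : (m * 2)%:~R = (-1)%:~R :> R by rewrite intrM -em; lra.
by move/eqP; rewrite eqr_int => /eqP; lia.
Qed.

End Doubling.

(** * Existence of a row *)

Section Existence.
Context {R : realType} {V : vectType R} (ip : {dot V for @idfun R}).
Context (S : set V) (f : seq V) (lam : V).
Local Notation Phi := [set` f].
Local Notation B := (lam |` [set` f]).
Local Notation S' := (sub_roots S B).
Local Notation A := (cartan ip).

Context (rS : is_roots ip S) (flf : free (lam :: f)) (lfS : forall a, a \in lam :: f -> S a).
Context (obt : {in lam :: f &, forall a b, a != b -> ip a b <= 0}).
Context (sgn : forall d, S d -> ispan (lam :: f) d -> nspan (lam :: f) d \/ nspan (lam :: f) (- d)).
Context (con : connected ip Phi) (nonempty : exists a, Phi a).

Let ulf : uniq (lam :: f). Proof. exact: free_uniq flf. Qed.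
Let uf : uniq f. Proof. by case/andP: ulf. Qed.
Let nlam : ~ Phi lam. Proof. by case/andP: ulf => /negP. Qed.
Let ff : free f. Proof. by move: flf; rewrite free_cons => /andP[]. Qed.

Lemma set_consE a (s : seq V) : [set` a :: s] = a |` [set` s].
Proof.
apply/seteqP; split=> x /=; rewrite inE; first by case/orP => [/eqP|]; [left|right].
by case=> [->|/= ->]; rewrite ?eqxx ?orbT.
Qed.

Lemma sub_rootsP s d : uniq s -> sub_roots S [set` s] d <-> ispan s d /\ S d.
Proof. by move=> us; split=> -[/(zspanP _ us) ? ?]; split=> //; apply/zspanP. Qed.

Lemma reduced_sub : reduced S' -> reduced (sub_roots S Phi).
Proof.
move=> red a [za Sa] [z2 S2]; apply: (red a); rewrite -set_consE.
  by apply/sub_rootsP => //; split=> //; apply: (@ispan_sub _ _ f) => //;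
    [move=> x fx; rewrite inE fx orbT | apply/zspanP].
by apply/sub_rootsP => //; split=> //; apply: (@ispan_sub _ _ f) => //;
  [move=> x fx; rewrite inE fx orbT | apply/zspanP].
Qed.

Section Labelled.
Context (t : seq V) (X : rtype) (hX : has_type ip S' B X).
Context (ut : uniq t) (et : [set` t] = B) (st : size t = rank X) (hD : has_diagram ip t (type_diagram X)).
Local Notation p := (index lam t).
Local Notation row_exists T :=
  (exists X Y D F s, T (size s) X Y D F /\ row_applies ip S Phi lam X Y D s).

Let mem_t : t =i lam :: f.
Proof.
move=> a; apply/idP/idP => [ta|].
  by have : [set` t] a by []; rewrite et -set_consE.
by move=> la; have : [set` t] a by rewrite et -set_consE.
Qed.
Let pt : (p < size t)%N. Proof. by rewrite index_mem mem_t inE eqxx. Qed.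
Let lamp : lam = t`_p. Proof. by rewrite nth_index // mem_t inE eqxx. Qed.

(** As Phi is connected, lam is an end of the Dynkin diagram of the whole system. *)
Lemma label_noncut : noncut (type_diagram X) (size t) p.
Proof.
move=> chi cut; apply: (connected_cut ut hD con _ _ cut) => [a fa|i iN ip_].
  have ta : a \in t by rewrite mem_t inE fa orbT.
  exists (index a t); last by rewrite nth_index.
  rewrite index_mem ta; apply/eqP => e; apply: nlam.
  by rewrite lamp -e nth_index.
have : t`_i \in lam :: f by rewrite -mem_t mem_nth.
rewrite inE => /orP[/eqP e|//]; case/eqP: ip_.
by rewrite -e index_uniq.
Qed.

Lemma label_size : (2 <= size t)%N.
Proof.
have [a fa] := nonempty; have s2 : {subset [:: lam; a] <= t}.
  by move=> x; rewrite !inE mem_t inE => /orP[->//|/eqP->]; rewrite fa orbT.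
apply: (uniq_leq_size _ s2); rewrite /= inE andbT; apply/eqP => e; apply: nlam.
by rewrite e.
Qed.

Lemma row_map (T : table (R := R) (V := V)) (sigma : nat -> nat) n X' Y D F : size t = n.+1 ->
  perm_eq [seq sigma i | i <- iota 0 n.+1] (iota 0 n.+1) -> p = sigma 0%N ->
  has_type ip S' B Y -> T n X' Y D F -> rank X' = n ->
  relabels D (type_diagram X) [seq sigma i | i <- iota 0 n.+1] ->
  relabels (type_diagram X') (type_diagram X) [seq sigma i | i <- iota 1 n] ->
  (reduced (sub_roots S Phi) <-> if X' is TBC _ then False else True) -> row_exists T.
Proof.
move=> sn pe ps hY row rX rD rX' red.
apply: (row_intro (p := p) (idx := [seq sigma i | i <- iota 1 n]) ut et nlam pt lamp _ hD hY _ _ _ _ rX' red).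
- by rewrite ps sn.
- exact: perm_refl.
- by rewrite size_map size_iota; exact: row.
- by rewrite size_map size_iota rX.
- by rewrite ps.
Qed.

Lemma row_list (T : table (R := R) (V := V)) idx idx2 X' Y D F :
  perm_eq (p :: idx) (iota 0 (size t)) ->
  has_type ip S' B Y -> perm_eq idx2 idx -> T (size idx) X' Y D F -> size idx2 = rank X' ->
  relabels_comp D (type_diagram X) (p :: idx) ->
  relabels_comp (type_diagram X') (type_diagram X) idx2 ->
  (reduced (sub_roots S Phi) <-> if X' is TBC _ then False else True) -> row_exists T.
Proof.
move=> pe hY pe2 row sX /relabels_compP rD /relabels_compP rX red.
exact: (row_intro ut et nlam pt lamp pe hD hY pe2 row sX rD rX red).
Qed.

Lemma label_cartan N : size t = N.+1 -> simple_bonds (type_diagram X) N ->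
  forall i j, (i <= N)%N -> (j <= N)%N -> A t`_i t`_j = (cmat (type_diagram X) i j)%:~R.
Proof.
move=> sN wf; apply: (cartan_cmat rS sN _ _ hD wf) => [a ta|i j iN jN ij].
  by apply: lfS; rewrite -mem_t.
by apply: obt; rewrite -?mem_t ?mem_nth ?sN // nth_uniq ?sN.
Qed.

End Labelled.

Lemma sgn_sub d : S d -> ispan f d -> nspan f d \/ nspan f (- d).
Proof.
have sub : {subset f <= lam :: f} by move=> x fx; rewrite inE fx orbT.
move=> Sd sd; have [n|n] := sgn Sd (ispan_sub uf ulf sub sd); [left|right].
  exact: (nspan_sign flf uf sub sd n).
exact: (nspan_sign flf uf sub (ispanN sd) n).
Qed.

(** In a system of type BC only the short simple root can be doubled, as the others have a Cartan
    number equal to -1. *)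
Lemma BC_double k t : uniq t -> [set` t] = B -> size t = k.+2 ->
  has_diagram ip t (type_diagram (TBC k.+2)) ->
  forall a, a \in t -> S (a *+ 2) -> a = t`_k.+1.
Proof.
move=> ut et st hD a ta S2a.
have mem_t x : x \in t -> x \in lam :: f.
  by move=> tx; have : [set` t] x by []; rewrite et -set_consE.
have hC := @label_cartan t (TBC k.+2) ut et hD k.+1 st (@bonds_BB k.+1).
have iN : (index a t < k.+2)%N by rewrite -st index_mem.
rewrite -(nth_index 0 ta); congr (nth _ _ _); apply/eqP; apply: contraT => ik; exfalso.
have iN' : (index a t < k.+1)%N by rewrite ltn_neqAle ik -ltnS.
have jN : ((index a t).+1 < size t)%N by rewrite st ltnS.
apply: (@double_even _ _ ip S a t`_(index a t).+1 rS) => //.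
- by apply: lfS; apply: mem_t.
- by apply: lfS; apply: mem_t; apply: mem_nth.
rewrite -[in A a](nth_index 0 ta) hC ?(ltnW iN') //.
move: (index a t) iN' {ik iN jN hC} => i iN.
suff -> : cmat (type_diagram (TBC k.+2)) i i.+1 = -1 by [].
by rewrite [type_diagram _]/(diagram_BB k.+1) /cmat mem_BB mult_BB; compare_nats.
Qed.

Lemma BC_nonreduced k t : uniq t -> [set` t] = B -> size t = k.+2 ->
  has_diagram ip t (type_diagram (TBC k.+2)) -> ~ reduced S' -> index lam t = 0%N ->
  ~ reduced (sub_roots S Phi).
Proof.
move=> ut et st hD nred p0 red; apply: nred => b.
rewrite -set_consE => /(sub_rootsP _ ulf)[sb Sb] /(sub_rootsP _ ulf)[_ S2b].
have [a la S2a] := double_simple rS flf lfS sgn Sb S2b sb.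
have ta : a \in t by have : [set` t] a by rewrite et -set_consE.
have tl : lam \in t by have : [set` t] lam by rewrite et; left.
have ea := BC_double ut et st hD ta S2a.
have fa : a \in f.
  move: la; rewrite inE => /orP[/eqP al|//]; move: p0.
  by rewrite -al ea index_uniq // st.
apply: (red a); apply/(sub_rootsP _ uf); split=> //; try exact: ispan_id.
  by apply: lfS; rewrite inE fa orbT.
by apply: (ispanMz 2); exact: ispan_id.
Qed.

Lemma BC_reduced k t : uniq t -> [set` t] = B -> size t = k.+2 ->
  has_diagram ip t (type_diagram (TBC k.+2)) -> index lam t = k.+1 ->
  reduced (sub_roots S Phi).
Proof.
move=> ut et st hD pk b /(sub_rootsP _ uf)[sb Sb] /(sub_rootsP _ uf)[_ S2b].
have fS a : a \in f -> S a by move=> fa; apply: lfS; rewrite inE fa orbT.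
have [a fa S2a] := double_simple rS ff fS sgn_sub Sb S2b sb.
have ta : a \in t by have : [set` t] a by rewrite et; right.
have tl : lam \in t by have : [set` t] lam by rewrite et; left.
by apply: nlam; rewrite -(nth_index 0 tl) pk -(BC_double ut et st hD ta S2a).
Qed.

(** The position of lam among the ends of the diagram selects the row. The short ends of a fork of rank
    at least 5 give the excluded pairs (A_n, D_(n+1)). In rank 2 and in type D_3 the same diagram is read
    with another name. *)
Lemma classical_exists X : classical X -> has_type ip S' B X -> ~ type_AD ip S Phi lam ->
  exists X Y D F s, @classical_table R V (size s) X Y D F /\ row_applies ip S Phi lam X Y D s.
Proof.
move=> cX hX nAD; have [[t [ut et st hD]] hred] := hX.
have s2 := label_size et; have nc := label_noncut ut et hD.
have pt : (index lam t < size t)%N.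
  by rewrite index_mem; have : [set` t] lam by rewrite et; left.
rewrite st in s2 nc pt.
case: X cX hX st hD hred s2 nc pt => [m|m|m|m|m|//|//|//] cX hX st hD hred s2 nc pt.
- case: m cX hX st hD hred s2 nc pt => [|[|n]] // cX hX st hD hred s2 nc pt.
  have red : reduced (sub_roots S Phi) <-> True by split=> // _; apply: reduced_sub; apply/hred.
  have [p0|p0] := @leaf_TA n.+1 _ pt nc.
    apply: (row_map ut et hD (sigma := id) (T := @classical_table R V) st _ p0 hX (@row_AA R V n.+1 isT)) => //.
    + by rewrite map_id.
    + exact: relabels_A0.
    + exact: relabels_A1.
  apply: (row_map ut et hD (T := @classical_table R V) (sigma := fun i => (n.+1 - i)%N) st _ _ hX (@row_AA R V n.+1 isT)) => //.
  + exact: perm_reverse.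
  + exact: relabels_An.
  + exact: relabels_An1.
- case: m cX hX st hD hred s2 nc pt => [|[|k]] // cX hX st hD hred s2 nc pt.
  have red : reduced (sub_roots S Phi) <-> True by split=> // _; apply: reduced_sub; apply/hred.
  have [p0|p0] := @leaf_TB k _ pt nc.
    case: k cX hX st hD hred s2 nc pt p0 => [|k] cX hX st hD hred s2 nc pt p0.
      have hC : has_type ip S' B (TC 2).
        apply: (type_relabel (idx := [:: 1; 0]%N) ut et hD) => //; first by rewrite st.
        exact: relabels_compP.
      apply: (row_list ut et hD (T := @classical_table R V) (idx := [:: 1%N]) (idx2 := [:: 1%N]) _ hC _
                (@row_AC R V 1 isT)) => //; by rewrite p0 ?st.
    apply: (row_map ut et hD (sigma := id) (T := @classical_table R V) st _ p0 hX (@row_BB R V k.+2 isT)) => //.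
    + by rewrite map_id.
    + exact: relabels_B0.
    + exact: (@relabels_B1 k.+2).
  apply: (row_map ut et hD (T := @classical_table R V) (sigma := fun i => (k.+1 - i)%N) st _ _ hX (@row_AB R V k.+1 isT)) => //.
  + exact: perm_reverse.
  + exact: (@relabels_AB k.+1).
  + exact: (@relabels_AB1 k.+1).
- case: m cX hX st hD hred s2 nc pt => [|[|k]] // cX hX st hD hred s2 nc pt.
  have red : reduced (sub_roots S Phi) <-> True by split=> // _; apply: reduced_sub; apply/hred.
  have [p0|p0] := @leaf_TC k _ pt nc.
    case: k cX hX st hD hred s2 nc pt p0 => [|k] cX hX st hD hred s2 nc pt p0.
      have hB : has_type ip S' B (TB 2).
        apply: (type_relabel (idx := [:: 1; 0]%N) ut et hD) => //; first by rewrite st.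
        exact: relabels_compP.
      apply: (row_list ut et hD (T := @classical_table R V) (idx := [:: 1%N]) (idx2 := [:: 1%N]) _ hB _
                (@row_AB R V 1 isT)) => //; by rewrite p0 ?st.
    apply: (row_map ut et hD (sigma := id) (T := @classical_table R V) st _ p0 hX (@row_CC R V k.+2 isT)) => //.
    + by rewrite map_id.
    + exact: relabels_C0.
    + exact: (@relabels_C1 k.+2).
  apply: (row_map ut et hD (T := @classical_table R V) (sigma := fun i => (k.+1 - i)%N) st _ _ hX (@row_AC R V k.+1 isT)) => //.
  + exact: perm_reverse.
  + exact: (@relabels_AC k.+1).
  + exact: (@relabels_AC1 k.+1).
- case: m cX hX st hD hred s2 nc pt => [|[|[|k]]] // cX hX st hD hred s2 nc pt.
  have red : reduced (sub_roots S Phi) <-> True by split=> // _; apply: reduced_sub; apply/hred.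
  have [leaf kpos] := @leaf_TD k _ pt nc.
  have [p0|p0] := posnP (index lam t).
    case: k cX hX st hD hred s2 nc pt leaf kpos => [|k] cX hX st hD hred s2 nc pt leaf kpos.
      by have := kpos p0.
    apply: (row_map ut et hD (sigma := id) (T := @classical_table R V) st _ p0 hX (@row_DD R V k.+3 isT)) => //.
    + by rewrite map_id.
    + exact: relabels_D0.
    + exact: relabels_D1.
  have {leaf} leaf : index lam t = k.+1 \/ index lam t = k.+2.
    by case: leaf => e; [rewrite e in p0 | left | right].
  case: k cX hX st hD hred s2 nc pt leaf kpos => [|[|k]] cX hX st hD hred s2 nc pt leaf kpos.
  + have hA : has_type ip S' B (TA 3).
      apply: (type_relabel (idx := [:: 1; 0; 2]%N) ut et hD) => //; first by rewrite st.
      exact: relabels_compP.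
    case: leaf => e.
      apply: (row_list ut et hD (T := @classical_table R V) (idx := [:: 0; 2]%N) (idx2 := [:: 0; 2]%N) _ hA _
                (@row_AA R V 2 isT)) => //; by rewrite e ?st.
    apply: (row_list ut et hD (T := @classical_table R V) (idx := [:: 0; 1]%N) (idx2 := [:: 0; 1]%N) _ hA _
              (@row_AA R V 2 isT)) => //; by rewrite e ?st.
  + case: leaf => e.
      apply: (row_list ut et hD (T := @classical_table R V) (idx := [:: 1; 0; 3]%N) (idx2 := [:: 1; 0; 3]%N) _ hX _
                (@row_DD R V 3 isT)) => //; by rewrite e ?st.
    apply: (row_list ut et hD (T := @classical_table R V) (idx := [:: 1; 0; 2]%N) (idx2 := [:: 1; 0; 2]%N) _ hX _
              (@row_DD R V 3 isT)) => //; by rewrite e ?st.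
  + case: nAD; exists k.+4; split=> //.
    have tl : lam \in t by have : [set` t] lam by rewrite et; left.
    have pl := esym (nth_index 0 tl).
    have pt' : (index lam t < size t)%N by rewrite st.
    case: leaf => e.
      apply: (type_sub ut et nlam pt' pl (X := TA k.+4) (idx := [seq (if i <= k.+2 then i else k.+4)%N | i <- iota 0 k.+4])
                _ hD (perm_refl _) _ (relabels_AD1 k.+2) red).
      * rewrite e st; apply: uniq_perm; rewrite ?iota_uniq //.
          rewrite cons_uniq map_inj_in_uniq ?iota_uniq ?andbT.
            by apply/mapP => -[j]; rewrite mem_iota; case: ifP; lia.
          by move=> i j; rewrite !mem_iota; do 2 case: ifP; lia.
        move=> i; rewrite inE [RHS]mem_iota; apply/idP/idP.
          by case/orP => [/eqP->|/mapP[j]]; rewrite ?mem_iota /=; [lia | case: ifP; lia].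
        move=> iN; have [->|ie] := eqVneq i k.+3; first by rewrite ?eqxx.
        rewrite orFb; apply/mapP; exists (if (i <= k.+2)%N then i else k.+3).
          by move: iN; rewrite !mem_iota; case: ifP; lia.
        have [h|h] := leqP i k.+2; first by rewrite ?h.
        have iN' : (i < k.+4.+1)%N by case/andP: iN.
        by rewrite ltnn; lia.
      * by rewrite size_map size_iota.
    apply: (type_sub ut et nlam pt' pl (X := TA k.+4) (idx := [seq i | i <- iota 0 k.+4])
              _ hD (perm_refl _) _ (relabels_AD2 k.+2) red).
    * rewrite e st map_id -[rank _]/(k.+4.+1) -[in iota 0 k.+4.+1]addn1 iotaD add0n cats1.
      by rewrite perm_sym perm_rcons.
    * by rewrite size_map size_iota.
- case: m cX hX st hD hred s2 nc pt => [|[|k]] // cX hX st hD hred s2 nc pt.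
  have [p0|p0] := @leaf_TB k _ pt nc.
    have red : reduced (sub_roots S Phi) <-> False.
      by split=> //; apply: (BC_nonreduced ut et st hD) => // /hred.
    apply: (row_map ut et hD (sigma := id) (T := @classical_table R V) st _ p0 hX (@row_BCBC R V k.+1 isT)) => //.
    + by rewrite map_id.
    + exact: relabels_B0.
    + case: k {cX hX st hD hred s2 nc pt p0 red} => [|k]; first exact: relabels_compP.
      exact: (@relabels_B1 k.+2).
  have red : reduced (sub_roots S Phi) <-> True.
    by split=> // _; exact: (BC_reduced ut et st hD).
  apply: (row_map ut et hD (T := @classical_table R V) (sigma := fun i => (k.+1 - i)%N) st _ _ hX (@row_ABC R V k.+1 isT)) => //.
  + exact: perm_reverse.
  + exact: (@relabels_AB k.+1).
  + exact: (@relabels_AB1 k.+1).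
Qed.

Lemma exceptional_exists X : exceptional X -> has_type ip S' B X -> ~ has_type ip S' B TG2 ->
  exists X Y D F s, @exceptional_table R V (size s) X Y D F /\ row_applies ip S Phi lam X Y D s.
Proof.
move=> cX hX nG2; have [[t [ut et st hD]] hred] := hX.
have s2 := label_size et; have nc := label_noncut ut et hD.
have pt : (index lam t < size t)%N.
  by rewrite index_mem; have : [set` t] lam by rewrite et; left.
rewrite st in s2 nc pt.
case: X cX hX st hD hred s2 nc pt => [//|//|//|//|//|m| |] cX hX st hD hred s2 nc pt; last by case: nG2.
  have red : reduced (sub_roots S Phi) <-> True by split=> // _; apply: reduced_sub; apply/hred.
  have m678 : m = 6 \/ m = 7 \/ m = 8 by move: cX => /=; lia.
  case: m678 => [|[|]] em; subst m.
  - case: (leaf_TE6 pt nc) => e.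
    + apply: (row_list ut et hD (T := @exceptional_table R V) (idx := [:: 2; 1; 3; 4; 5]%N) (idx2 := [:: 5; 4; 3; 2; 1]%N) _ hX _
                (@row_DE6 R V 5 erefl)) => //; by rewrite e ?st.
    + apply: (row_list ut et hD (T := @exceptional_table R V) (idx := [:: 0; 2; 3; 4; 5]%N) (idx2 := [:: 0; 2; 3; 4; 5]%N) _ hX _
                (@row_AE6 R V 5 erefl)) => //; by rewrite e ?st.
    + apply: (row_list ut et hD (T := @exceptional_table R V) (idx := [:: 4; 1; 3; 2; 0]%N) (idx2 := [:: 0; 2; 3; 4; 1]%N) _ hX _
                (@row_DE6 R V 5 erefl)) => //; by rewrite e ?st.
  - case: (leaf_TE7 pt nc) => e.
    + apply: (row_list ut et hD (T := @exceptional_table R V) (idx := [:: 2; 1; 3; 4; 5; 6]%N) (idx2 := [:: 6; 5; 4; 3; 2; 1]%N) _ hX _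
                (@row_DE7 R V 6 erefl)) => //; by rewrite e ?st.
    + apply: (row_list ut et hD (T := @exceptional_table R V) (idx := [:: 0; 2; 3; 4; 5; 6]%N) (idx2 := [:: 0; 2; 3; 4; 5; 6]%N) _ hX _
                (@row_AE7 R V 6 erefl)) => //; by rewrite e ?st.
    + apply: (row_list ut et hD (T := @exceptional_table R V) (idx := iota 0 6) (idx2 := iota 0 6) _ hX _
                (@row_E6E7 R V 6 erefl)) => //; by rewrite e ?st.
  - case: (leaf_TE8 pt nc) => e.
    + apply: (row_list ut et hD (T := @exceptional_table R V) (idx := [:: 2; 1; 3; 4; 5; 6; 7]%N) (idx2 := [:: 7; 6; 5; 4; 3; 2; 1]%N) _ hX _
                (@row_DE8 R V 7 erefl)) => //; by rewrite e ?st.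
    + apply: (row_list ut et hD (T := @exceptional_table R V) (idx := [:: 0; 2; 3; 4; 5; 6; 7]%N) (idx2 := [:: 0; 2; 3; 4; 5; 6; 7]%N) _ hX _
                (@row_AE8 R V 7 erefl)) => //; by rewrite e ?st.
    + apply: (row_list ut et hD (T := @exceptional_table R V) (idx := iota 0 7) (idx2 := iota 0 7) _ hX _
                (@row_E7E8 R V 7 erefl)) => //; by rewrite e ?st.
have red : reduced (sub_roots S Phi) <-> True by split=> // _; apply: reduced_sub; apply/hred.
case: (leaf_TF4 pt nc) => e.
  apply: (row_list ut et hD (T := @exceptional_table R V) (idx := [:: 1; 2; 3]%N) (idx2 := [:: 3; 2; 1]%N) _ hX _
            (@row_C3F4 R V 3 erefl)) => //; by rewrite e ?st.
apply: (row_list ut et hD (T := @exceptional_table R V) (idx := [:: 2; 1; 0]%N) (idx2 := [:: 0; 1; 2]%N) _ hX _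
          (@row_B3F4 R V 3 erefl)) => //; by rewrite e ?st.
Qed.

End Existence.

(** * Strings of an ambient root system *)

Section Assembly.
Context {R : realType} {V : vectType R} (ip : {dot V for @idfun R}).
Implicit Types (S : set V) (s f p : seq V).

Lemma root_system_roots W S : root_system ip W S -> is_roots ip S.
Proof. by case. Qed.

Lemma seq_of_subset p (Phi : set V) : uniq p -> Phi `<=` [set` p] ->
  exists f, [/\ uniq f, {subset f <= p} & [set` f] = Phi].
Proof.
move=> up sub; exists [seq a <- p | `[< Phi a >]]; split; first exact: filter_uniq.
  by move=> a; rewrite mem_filter => /andP[].
apply/seteqP; split=> a /=; rewrite mem_filter; first by case/andP => /asboolP.
by move=> Pa; apply/andP; split; [apply/asboolP | apply: sub].
Qed.

Lemma sub_root_subsystem S f : is_roots ip S -> uniq f -> (forall a, a \in f -> S a) ->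
  root_subsystem ip S (sub_roots S [set` f]).
Proof.
move=> rS uf fS; split; first by move=> a [].
have rS' := sub_is_roots rS uf fS; exists <<f>>%VS; case: (rS') => fin n0 int refl; split=> //.
have /finite_seqP[r0 er0] := fin; have er : sub_roots S [set` f] = [set` undup r0].
  by rewrite er0; apply/seteqP; split=> a /=; rewrite mem_undup.
have mem a : a \in undup r0 <-> sub_roots S [set` f] a by rewrite er.
rewrite er; apply/seteqP; split=> v.
  move=> /(rspanP _ (undup_uniq r0)); apply: subvP; apply/span_subvP => a /mem[za _].
  by apply: ispan_span; apply/zspanP.
move=> fv; apply/(rspanP _ (undup_uniq r0)); apply: subvP fv; apply: sub_span => a fa.
by apply/mem; split; [apply/zspanP => //; exact: ispan_id | exact: fS].
Qed.

Lemma root_stringP S f lam g : uniq f ->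
  root_string S [set` f] lam g <-> (S g \/ g = 0) /\ ispan f (g - lam).
Proof.
move=> uf; split=> [[Sg [n eg]]|[Sg [n eg]]]; split=> //.
  by exists n; rewrite eg [lam + _]addrC addrK -fsbig_seq.
by exists n; rewrite -fsbig_seq // -eg addrC subrK.
Qed.

(** Coordinates on a basis show that a lattice vector in the real span of a subfamily of the basis is
    in the lattice of this subfamily. *)
Lemma ispan_descent f p v : free p -> uniq f -> {subset f <= p} ->
  ispan p v -> v \in <<f>>%VS -> ispan f v.
Proof.
move=> fp uf sfp [c ec] fv; have ff := free_sub uf sfp fp; exists c.
rewrite (sum_subseq _ uf (free_uniq fp) sfp) big_mkcond ec big_seq [RHS]big_seq.
apply: eq_bigr => a pa; case: ifP => // /negbT nfa; suff -> : c a = 0 by rewrite mulr0z.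
apply/eqP; rewrite -(eqr_int R) -(cf_int c fp pa) -ec (cf_span ff fv) cf_sum big_seq.
rewrite big1 // => b fb; rewrite cfZ (cf_id fp pa (sfp b fb)).
by have /negbTE -> : a != b; [apply: contraNneq nfa => -> | rewrite mulr0].
Qed.

Section Ambient.
Context (S : set V) (rS : is_roots ip S) (h : V) (h0 : forall a, S a -> ip h a != 0).
Local Notation P := (positive ip S h).
Context (p : seq V) (fp : free p) (sp : [set` p] = simple_roots P).
Context (pP : forall b, P b -> nspan p b).

Let up : uniq p. Proof. exact: free_uniq. Qed.

Lemma mem_simple a : a \in p -> simple_roots P a.
Proof. by rewrite -sp. Qed.

Lemma root_sign d : S d -> nspan p d \/ nspan p (- d).
Proof.
move=> Sd; have := h0 Sd; rewrite neq_lt => /orP[] hd; [right|left]; apply: pP; split=> //.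
  exact: (root_opp rS).
by rewrite ipNr oppr_gt0.
Qed.

Lemma root_ispan d : S d -> ispan p d.
Proof.
by move=> /root_sign[/nspan_ispan//|/nspan_ispan/ispanN]; rewrite opprK.
Qed.

Context (f : seq V) (uf : uniq f) (sfp : {subset f <= p}).

Let ff : free f. Proof. exact: free_sub uf sfp fp. Qed.
Let fP a : a \in f -> simple_roots P a. Proof. by move/sfp/mem_simple. Qed.
Let fS a : a \in f -> S a. Proof. by move/fP => [[]]. Qed.

Lemma string_span lam : S lam -> lam \in <<f>>%VS ->
  root_string S [set` f] lam = sub_roots S [set` f] `|` [set 0].
Proof.
move=> Slam lf; have il := ispan_descent fp uf sfp (root_ispan Slam) lf.
apply/seteqP; split=> g.
  move=> /(root_stringP _ _ _ uf)[[Sg|->] sg]; last by right.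
  left; apply/sub_rootsP => //; split=> //.
  by rewrite -(subrK lam g); apply: ispanD.
case=> [/(sub_rootsP _ _ uf)[sg Sg]|->]; apply/root_stringP => //.
  by split; [left|apply: ispanB].
by split; [right|rewrite sub0r; apply: ispanN].
Qed.

Context (lam : V) (Plam : P lam) (nlam : lam \notin <<f>>%VS).
Context (minlam : min_level S [set` p] (root_string S [set` f] lam) lam).

(** Subtracting a nonnegative combination of f lowers the level by the sum of its coefficients. *)
Lemma min_level_lowest (c : V -> nat) : S (lam - \sum_(a <- f) a *+ c a) ->
  forall a, a \in f -> c a = 0%N.
Proof.
set g := lam - _ => Sg a fa.
have eg : lam = g + \sum_(a <- f) a *~ (c a)%:Z by rewrite subrK.
have [_ _ /(_ g)] := minlam.
have -> : level [set` p] lam = level [set` p] g + \sum_(a <- f) (c a)%:Z.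
  by rewrite {1}eg level_add //; apply: root_ispan.
have Ig : root_string S [set` f] lam g.
  apply/root_stringP => //; split; [by left|exists (fun a => - (c a)%:Z)].
  rewrite /g addrAC subrr add0r -sumrN; apply: eq_bigr => b _.
  by rewrite mulrNz.
move=> /(_ Ig Sg); rewrite gerDl => le0.
have : \sum_(a <- f) (c a)%:Z == 0.
  by rewrite eq_le le0 sumr_ge0.
rewrite big_seq psumr_eq0 // => /allP/(_ a fa); rewrite fa => /eqP[].
by [].
Qed.

Let flf : free (lam :: f). Proof. by rewrite free_cons nlam ff. Qed.
Let ulf : uniq (lam :: f). Proof. exact: free_uniq. Qed.

Lemma string_lowest : lowest ip S f lam.
Proof. exact: (lowest_intro rS h0 uf fP Plam flf min_level_lowest). Qed.
Let low := string_lowest.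

Lemma string_system_simple :
  simple_roots (positive ip (sub_roots S [set` lam :: f]) h) = [set` lam :: f] /\
  (forall b, sub_roots S [set` lam :: f] b -> 0 < ip h b -> nspan (lam :: f) b).
Proof. exact: (lowest_simple rS h0 uf fP Plam flf min_level_lowest). Qed.

Lemma string_roots g : root_string S [set` f] lam g <-> S g /\ ispan f (g - lam).
Proof.
split=> [/(root_stringP _ _ _ uf)[[Sg|->] sg]|[Sg sg]]; [by split| |].
  move: nlam; rewrite -(opprK lam) memvN -sub0r.
  by rewrite (ispan_span sg).
by apply/root_stringP => //; split=> //; left.
Qed.

Lemma string_positive g : root_string S [set` f] lam g -> P g.
Proof.
move=> /string_roots[Sg sg]; split=> //; have [c ec] := lowest_nspan low Sg sg.
rewrite -(subrK lam g) ec ipDr ltr_wpDl //; last by case: Plam.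
rewrite ip_sumr big_seq sumr_ge0 // => a fa; rewrite ipMnr mulrn_wge0 //.
by case: (fP fa) => -[_ /ltW].
Qed.

Lemma string_min_unique g : min_level S [set` p] (root_string S [set` f] lam) g -> g = lam.
Proof.
move=> [/string_roots[_ sg] Sg /(_ lam)]; have [c ec] := lowest_nspan low Sg sg.
have Ilam : root_string S [set` f] lam lam by case: minlam.
have Slam : S lam by case: Plam.
have eg : g = lam + \sum_(a <- f) a *~ (c a)%:Z by rewrite -ec addrC subrK.
have -> : level [set` p] g = level [set` p] lam + \sum_(a <- f) (c a)%:Z.
  by rewrite {1}eg level_add //; apply: root_ispan.
move=> /(_ Ilam Slam); rewrite gerDl => le0.
have : \sum_(a <- f) (c a)%:Z == 0 by rewrite eq_le le0 sumr_ge0.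
rewrite eg big_seq psumr_eq0 // => /allP H.
rewrite big_seq big1 ?addr0 // => a fa.
by have := H a fa; rewrite fa => /eqP ->; rewrite mulr0z.
Qed.

Lemma string_system_obtuse : {in lam :: f &, forall a b, a != b -> ip a b <= 0}.
Proof.
move=> a b; rewrite !inE => /orP[/eqP->|fa] /orP[/eqP->|fb] ab.
- by rewrite eqxx in ab.
- exact: (string_obtuse low fb).
- by rewrite ipC; exact: (string_obtuse low fa).
- exact: (simple_obtuse rS h0 (fP fa) (fP fb) ab).
Qed.

Lemma string_system_sign d : S d -> ispan (lam :: f) d ->
  nspan (lam :: f) d \/ nspan (lam :: f) (- d).
Proof.
have [_ pos] := string_system_simple.
move=> Sd sd; have := h0 Sd; rewrite neq_lt => /orP[] hd; [right|left]; apply: pos => //.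
- by apply/sub_rootsP => //; split; [exact: ispanN|exact: (root_opp rS)].
- by rewrite ipNr oppr_gt0.
- by apply/sub_rootsP.
Qed.

Lemma label_obtuse s : s =i f -> size s = size f -> uniq s ->
  forall i j, (i <= size s)%N -> (j <= size s)%N -> i != j ->
  ip (lam :: s)`_i (lam :: s)`_j <= 0.
Proof.
move=> sf ss us i j iN jN ij; have mem k : (k <= size s)%N -> (lam :: s)`_k \in lam :: f.
  by move=> kN; have : (lam :: s)`_k \in lam :: s; [exact: mem_nth | rewrite !inE sf].
apply: string_system_obtuse; rewrite ?mem // nth_uniq //=.
by rewrite us andbT sf; have := ulf => /andP[].
Qed.

Section Components.
Context (n : nat) (Phis : 'I_n -> set V) (cover : [set` f] = \bigcup_k Phis k).
Context (orth : forall j k, j != k -> forall a b, Phis j a -> Phis k b -> ip a b = 0).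

Let fs k := [seq a <- f | `[< Phis k a >]].
Let ufs k : uniq (fs k). Proof. exact: filter_uniq. Qed.
Let sfs k : {subset fs k <= f}. Proof. by move=> a; rewrite mem_filter => /andP[]. Qed.
Let efs k : [set` fs k] = Phis k.
Proof.
apply/seteqP; split=> a /=; rewrite mem_filter; first by case/andP => /asboolP.
move=> Pa; apply/andP; split; first exact/asboolP.
by have : [set` f] a by rewrite cover; exists k.
Qed.
Let orths j k : j != k -> forall a b, a \in fs j -> b \in fs k -> ip a b = 0.
Proof.
move=> jk a b; rewrite !mem_filter => /andP[/asboolP Pa _] /andP[/asboolP Pb _].
exact: (orth jk).
Qed.
Let covers a : a \in f -> exists k, a \in fs k.
Proof.
move=> fa; have : (\bigcup_k Phis k) a by rewrite -cover.
by case=> k _ Pa; exists k; rewrite mem_filter fa andbT; apply/asboolP.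
Qed.
Let lowk k : lowest ip S (fs k) lam.
Proof. exact: lowest_sub low (ufs k) (@sfs k). Qed.

Lemma component_string k g : root_string S (Phis k) lam g <-> S g /\ ispan (fs k) (g - lam).
Proof.
rewrite -efs; split=> [/(root_stringP _ _ _ (ufs k))[[Sg|->] sg]|[Sg sg]]; [by split| |].
  have := lowest_notin (lowk k); rewrite -(opprK lam) memvN -sub0r.
  by rewrite (ispan_span sg).
by apply/root_stringP => //; split=> //; left.
Qed.

Lemma component_positive k : root_string S (Phis k) lam `<=` P.
Proof.
move=> g /component_string[Sg sg]; apply: string_positive; apply/string_roots; split=> //.
exact: (ispan_sub (ufs k) uf (@sfs k) sg).
Qed.

Lemma component_sum (c : V -> int) :
  \sum_(k < n) \sum_(a <- fs k) a *~ c a = \sum_(a <- f) a *~ c a.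
Proof.
rewrite (eq_bigr (fun k => \sum_(a <- f) if a \in fs k then a *~ c a else 0)); last first.
  by move=> k _; rewrite (sum_subseq _ (ufs k) uf (@sfs k)) big_mkcond.
rewrite exchange_big big_seq [RHS]big_seq; apply: eq_bigr => a fa.
have [k fk] := covers fa; rewrite (bigD1 k) //= fk big1 ?addr0 // => j jk.
case: ifP => // fj; have := orths jk fj fk => /eqP.
by rewrite gt_eqF // ip_gt0 // (root_neq0 rS) //; exact: fS.
Qed.

Lemma component_strings : root_string S [set` f] lam =
  [set g | exists gam : 'I_n -> V, g = lam + \sum_(k < n) gam k /\
     forall k, rspan (Phis k) (gam k) /\ root_string S (Phis k) lam (lam + gam k)].
Proof.
apply/seteqP; split=> g.
  move=> /string_roots[Sg [c ec]].
  pose gam k := \sum_(a <- fs k) a *~ c a.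
  have sg k : ispan (fs k) (gam k) by exists c.
  have eg : g = lam + \sum_(k < n) gam k by rewrite component_sum -ec addrC subrK.
  exists gam; split=> // k; split.
    by rewrite -efs; apply/rspanP => //; exact: ispan_span.
  apply/component_string; split; last by rewrite [lam + _]addrC addrK.
  have Sl : S (lam + \sum_j gam j) by rewrite -eg.
  exact: (string_split low ufs sfs covers orths sg Sl).
move=> [gam [-> H]].
have comp k : S (lam + gam k) /\ ispan (fs k) (lam + gam k - lam).
  by have [_ /component_string] := H k.
have sg k : ispan (fs k) (gam k).
  by have [_ sk] := comp k; rewrite [lam + _]addrC addrK in sk.
apply/string_roots; split.
  by apply: (string_join low ufs sfs orths sg) => k; have [] := comp k.
by rewrite [lam + _]addrC addrK; exact: (family_span low ufs sfs sg).
Qed.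

End Components.
End Ambient.
End Assembly.

(** * The theorem *)

Unset Implicit Arguments.
Set Strict Implicit.
Set Printing Implicit Defensive.

Theorem mainTheorem1 (R : realType) (V : vectType R) (ip : {dot V for @idfun R})
    (Sigma SigmaP Pi Phi : set V) (lam : V) :
  root_system ip fullv Sigma ->
  positive_system ip Sigma SigmaP ->
  Pi = simple_roots SigmaP ->
  Phi `<` Pi ->
  Sigma lam ->
           
  (rspan Phi lam ->
     root_subsystem ip Sigma (sub_roots Sigma Phi) /\
     root_string Sigma Phi lam = sub_roots Sigma Phi `|` [set 0]) /\
  (SigmaP lam -> ~ rspan Phi lam ->
   min_level Sigma Pi (root_string Sigma Phi lam) lam ->
   [/\           
       [/\ root_subsystem ip Sigma (sub_roots Sigma (lam |` Phi)),
           simple_roots (sub_roots Sigma (lam |` Phi) `&` SigmaP) = lam |` Phi &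
           forall g, min_level Sigma Pi (root_string Sigma Phi lam) g -> g = lam],
                  
       forall g, root_string Sigma Phi lam g -> g <> lam ->
         exists2 a, Phi a & Sigma (g - a),
                 
       connected ip Phi ->
       root_string Sigma Phi lam <> [set lam] ->
       ~ has_type ip (sub_roots Sigma (lam |` Phi)) (lam |` Phi) TG2 ->
         ((exists2 X, classical X &
             has_type ip (sub_roots Sigma (lam |` Phi)) (lam |` Phi) X) ->
          ~ type_AD ip Sigma Phi lam ->
          string_given_by ip (@classical_table R V) Sigma Phi lam) /\
         ((exists2 X, exceptional X &
             has_type ip (sub_roots Sigma (lam |` Phi)) (lam |` Phi) X) ->
          string_given_by ip (@exceptional_table R V) Sigma Phi lam) &
                
       forall (n : nat) (Phis : 'I_n -> set V),
         (forall k, connected ip (Phis k)) ->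
         (forall j k, j != k ->
            forall a b, Phis j a -> Phis k b -> ip a b = 0) ->
         Phi = \bigcup_k Phis k ->
         (forall k, root_string Sigma (Phis k) lam `<=` SigmaP) /\
         root_string Sigma Phi lam =
           [set g | exists gam : 'I_n -> V,
              g = lam + \sum_(k < n) gam k /\
              forall k, rspan (Phis k) (gam k) /\
                        root_string Sigma (Phis k) lam (lam + gam k)]]).
Proof.
move=> rsS [h [_ h0 eP]] ePi [sPhi nPhi] Slam.
have rS := root_system_roots rsS.
have [p [sp fp pP]] := simple_seq rS h0.
have up := free_uniq fp.
rewrite eP -[[set a | _]]/(positive ip Sigma h) in ePi *.
rewrite -sp in ePi; rewrite ePi in sPhi *.
have [f [uf sfp ef]] := seq_of_subset up sPhi; rewrite -{}ef in nPhi *.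
have fS a : a \in f -> Sigma a by move=> /sfp/(mem_simple sp)[[]].
split.
  move=> /(rspanP _ uf) lf; split; first exact: sub_root_subsystem.
  exact: (string_span rS h0 fp pP uf sfp Slam lf).
move=> Plam nspan_lam minlam.
have nlam : lam \notin <<f>>%VS by apply/negP => /(rspanP _ uf).
have flf : free (lam :: f) by rewrite free_cons nlam (free_sub uf sfp fp).
have ulf := free_uniq flf.
have low := string_lowest rS h0 fp sp pP uf sfp Plam nlam minlam.
have [simp pos] := string_system_simple rS h0 fp sp pP uf sfp Plam nlam minlam.
have obt := string_system_obtuse rS h0 fp sp pP uf sfp Plam nlam minlam.
have sgn := string_system_sign rS h0 fp sp pP uf sfp Plam nlam minlam.
have strE g : root_string Sigma [set` f] lam g <-> Sigma g /\ ispan f (g - lam).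
  exact: string_roots.
have lfS a : a \in lam :: f -> Sigma a by rewrite inE => /orP[/eqP->|/fS].
split.
- split.
  + by rewrite -set_consE; exact: sub_root_subsystem.
  + rewrite -set_consE -{2}simp; congr simple_roots.
    apply/seteqP; split=> a; first by case=> Sa [_ ha]; split.
    by case=> -[za Sa] ha; do 2 split.
  + exact: (string_min_unique rS h0 fp sp pP uf sfp Plam nlam minlam).
- by move=> g /strE[Sg sg] gl; exact: (no_gap low Sg sg gl).
- move=> con ntriv nG2.
  have nonempty : exists a, [set` f] a.
    apply: contrapT => empty; apply: ntriv; apply/seteqP; split=> g.
      move=> /strE[_ [c]]; rewrite big_seq big1 => [/eqP|a fa]; last by case: empty; exists a.
      by rewrite subr_eq0 => /eqP.
    by move=> ->; apply/strE; split=> //; rewrite subrr; exact: ispan0.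
  (* The rows are sound for every labelling s of Phi, as lowest only depends on the set of its members. *)
  have every X Y D F s (T : table (R := R) (V := V)) :
      (has_diagram ip (lam :: s) D -> lowest ip Sigma s lam ->
       (forall i j, (i <= size s)%N -> (j <= size s)%N -> i != j -> ip (lam :: s)`_i (lam :: s)`_j <= 0) ->
       forall g, (Sigma g /\ ispan s (g - lam)) <-> F (nth 0 (lam :: s)) g) ->
      row_applies ip Sigma [set` f] lam X Y D s ->
      root_string Sigma [set` f] lam = F (nth 0 (lam :: s)).
    move=> row [us es hD _ _].
    have sf : s =i f.
      move=> a; apply/idP/idP => sa; first by have : [set` s] a by []; rewrite es.
      by have : [set` f] a by []; rewrite -es.
    have ss : size s = size f by apply: perm_size; apply: uniq_perm.
    have lows : lowest ip Sigma s lam by apply: (lowest_sub low us) => a; rewrite sf.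
    have obts := label_obtuse rS h0 fp sp pP uf sfp Plam nlam minlam sf ss us.
    apply/seteqP; split=> g.
      move=> /strE[Sg sg]; apply/(row hD lows obts); split=> //.
      by apply: (ispan_sub uf us _ sg) => a; rewrite sf.
    move=> /(row hD lows obts)[Sg sg]; apply/strE; split=> //.
    by apply: (ispan_sub us uf _ sg) => a; rewrite sf.
  (* in each of the two tables, existence of a row and then soundness of all rows *)
  split=> [[X cX hX] nAD|[X cX hX]]; split.
  + exact: (classical_exists rS flf lfS obt sgn con nonempty cX hX nAD).
  + move=> X' Y D F s row; apply: (every _ _ _ _ _ (@classical_table R V)) => hD lows obts.
    exact: (classical_row lows obts row hD).
  + exact: (exceptional_exists flf con nonempty cX hX nG2).
  + move=> X' Y D F s row; apply: (every _ _ _ _ _ (@exceptional_table R V)) => hD lows obts.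
    exact: (exceptional_row lows obts row hD).
- move=> n Phis _ orth cover; split.
    exact: (component_positive rS h0 fp sp pP uf sfp Plam nlam minlam cover).
  exact: (component_strings rS h0 fp sp pP uf sfp Plam nlam minlam cover orth).
Qed.
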